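(* Let $\alpha\in(1,2)$ and let $\mu:[0,1]^2\to\mathbb{C}$ be an essentially bounded (measurable) function, whose values at all grid points satisfy $|\mu(ih,jh)|\le\|\mu\|_\infty$ ($1\le i,j\le n$, $h=\frac1{n+1}$, $n\in\mathbb N$), so that $\|h^\alpha D_{\mathbf n}(\mu)\|\le h^\alpha\|\mu\|_\infty$ for every $n$. Let $\{\bar\mu_{h(n)}\}_n$ be a bounded sequence of complex numbers, and let $\hat B_{\mathbf n}=T_{\mathbf n}(t_\alpha)$, $\mathbf n=(n,n)$. Then, for each of the two choices $P_{\mathbf n}=\tau(\hat B_{\mathbf n})$ and $P_{\mathbf n}=\tau(\hat B_{\mathbf n})+h^\alpha\bar\mu_{h(n)}I_{n^2}$ (in statement (p2) $P_{\mathbf n}$ is assumed invertible): (p1) $\{P_{\mathbf n}\}_n\sim_{\rm GLT}t_\alpha$, $\{P_{\mathbf n}\}_n\sim_{\sigma}t_\alpha$ and $\{P_{\mathbf n}\}_n\sim_{\lambda}t_\alpha$; (p2) $\left\{P_{\mathbf n}^{-1}\left(\hat B_{\mathbf n}+h^\alpha D_{\mathbf n}(\mu)\right)\right\}_n\sim_{\rm GLT}1$ and $\left\{P_{\mathbf n}^{-1}\left(\hat B_{\mathbf n}+h^\alpha D_{\mathbf n}(\mu)\right)\right\}_n\sim_{\sigma}1$. If moreover all the $\bar\mu_{h(n)}$ are real and nonnegative, then $\left\{P_{\mathbf n}^{-1}\left(\hat B_{\mathbf n}+h^\alpha D_{\mathbf n}(\mu)\right)\right\}_n\sim_{\lamb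da}1$.
   Context: **Matrices.** For $n\in\mathbb N$ put $\mathbf n=(n,n)$ and $h=h(n)=\frac{1}{n+1}$; all matrix sequences below are indexed by $n\to\infty$ and consist of matrices of size $d_n=n^2$. Rows and columns are indexed by pairs $\mathbf i=(i_1,i_2)$, $1\le i_1,i_2\le n$, in lexicographic order. For $f\in L^1([-\pi,\pi]^2)$, $T_{\mathbf n}(f)=[\hat f_{\mathbf i-\mathbf j}]_{\mathbf i,\mathbf j}$ with $\hat f_{\mathbf k}=\frac1{(2\pi)^2}\int_{[-\pi,\pi]^2}f(\theta_1,\theta_2)e^{-\mathrm i(k_1\theta_1+k_2\theta_2)}\,d\theta_1d\theta_2$. The function $t_\alpha$ is $t_\alpha(\theta_1,\theta_2)=\left[4\sin^2(\theta_1/2)+4\sin^2(\theta_2/2)\right]^{\alpha/2}$. $D_{\mathbf n}(\mu)$ is the $n^2\times n^2$ diagonal matrix with diagonal entries $\mu(ih,jh)$, $1\le i,j\le n$, in lexicographic order. $\|\cdot\|$ is the spectral norm and $\|\mu\|_\infty$ the $L^\infty$ norm. **The $\tau$ preconditioner.** For a real symmetric $n\times n$ Toeplitz matrix $T$ with first column $[a_0,a_1,\dots,a_{n-1}]^\top$, $\tau(T)=T-H(T)$, where $H(T)$ is the Hankel matrix with first row $[a_2,a_3,\dots,a_{n-1},0,0]$ and last column $[0,0,a_{n-1},\dots,a_3,a_2]^\top$. For the 2-level matrix $T_{\mathbf n}(f)$ with $f$ real and even in each variable, $\tau$ is obtained by applying this correction level by level: writing $S_0=I_n$ and, for $1\le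 k\le n-1$, $S_k$ for the $n\times n$ symmetric Toeplitz matrix with ones exactly where $|i-j|=k$, one has $T_{\mathbf n}(f)=\sum_{k_1,k_2=0}^{n-1}\hat f_{(k_1,k_2)}S_{k_1}\otimes S_{k_2}$ and $\tau(T_{\mathbf n}(f))=\sum_{k_1,k_2=0}^{n-1}\hat f_{(k_1,k_2)}\,\tau(S_{k_1})\otimes\tau(S_{k_2})$. **Distributions.** Let $\psi:D\subset\mathbb R^t\to\mathbb C$ be measurable with $0<|D|<\infty$. $\{A_n\}_n\sim_\sigma\psi$ means $\lim_{n\to\infty}\frac1{d_n}\sum_{i=1}^{d_n}F(\sigma_i(A_n))=\frac1{|D|}\int_D F(|\psi(x)|)\,dx$ for every continuous compactly supported $F:\mathbb R\to\mathbb C$, where $\sigma_i$ denotes singular values. $\{A_n\}_n\sim_\lambda\psi$ means $\lim_{n\to\infty}\frac1{d_n}\sum_{i=1}^{d_n}F(\lambda_i(A_n))=\frac1{|D|}\int_D F(\psi(x))\,dx$ for every continuous compactly supported $F:\mathbb C\to\mathbb C$, where $\lambda_i$ denotes eigenvalues. For $t_\alpha$ take $D=[-\pi,\pi]^2$; $1$ denotes the constant function. **GLT sequences (2-level, scalar).** A class $\{\{B_{n,m}\}_n\}_m$ is an approximating class of sequences (a.c.s.) for $\{A_n\}_n$ if for every $m$ there is $n_m$ such that for all $n\ge n_m$ one has $A_n=B_{n,m}+R_{n,m}+N_{n,m}$ with $\mathrm{rank}\,R_{n,m}\le c(m)d_n$ and $\|N_{n,m}\|\le\omega(m)$, where $n_m$,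 $c(m)$, $\omega(m)$ depend only on $m$ and $c(m),\omega(m)\to0$ as $m\to\infty$. For a measurable $\kappa:[0,1]^2\times[-\pi,\pi]^2\to\mathbb C$, $\{A_n\}_n\sim_{\rm GLT}\kappa$ (generalized locally Toeplitz sequence with symbol $\kappa$) means: for each $m\in\mathbb N$ there are finitely many functions $a_{i,m}\in C^\infty([0,1]^2)$ and trigonometric polynomials $f_{i,m}$ in two variables, $i=1,\dots,N_m$, such that $\sum_i a_{i,m}(\mathbf x)f_{i,m}(\boldsymbol\theta)\to\kappa(\mathbf x,\boldsymbol\theta)$ in measure as $m\to\infty$ and $\{\{\sum_{i}\mathrm{diag}_{\mathbf j}\big(a_{i,m}(\mathbf j/n)\big)\,T_{\mathbf n}(f_{i,m})\}_n\}_m$ is an a.c.s. for $\{A_n\}_n$. A function of $\boldsymbol\theta$ only, such as $t_\alpha$, is regarded as a function of $(\mathbf x,\boldsymbol\theta)$. *)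

(* Defs.v *)
From HB Require Import structures.
From mathcomp Require Import all_boot all_order all_algebra.
From mathcomp Require Import all_classical all_reals all_analysis.
From mathcomp Require Import measurable_realfun complex mxtens.
Set Implicit Arguments.
Unset Strict Implicit.
Unset Printing Implicit Defensive.
Import Order.TTheory GRing.Theory Num.Theory.
Import numFieldNormedType.Exports.
Local Open Scope classical_set_scope.
Local Open Scope complex_scope.
Local Open Scope ring_scope.

(* The modulus as an element of R; `|z| is its image in R[i]. *)
Notation cabs := Normc.normc.

(* The topology of the norm of R[i], which the library attaches to the sort of
   a numClosedFieldType but not to the constant complex. *)
HB.instance Definition _ (R : rcfType) :=
  NormedModule.copy R[i] (R[i] : numClosedFieldType)^o.

Notation leb2 := (@lebesgue_measure _ \x @lebesgue_measure _)%E.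
Notation leb4 := (leb2 \x leb2)%E.

Section Measure.
Context {R : realType}.

Definition box01 : set (R * R) := `[0, 1] `*` `[0, 1].
Definition boxpi : set (R * R) := `[- pi, pi] `*` `[- pi, pi].

(* Measurability for the completion of mu.  The library's measurable_fun on
   R * R is Borel measurability, which is strictly more restrictive. *)
Definition lmeasurable_fun d (T : measurableType d) (mu : set T -> \bar R)
    (D : set T) (f : T -> R) : Prop :=
  forall Y, measurable Y -> completed_algebra_gen mu (D `&` f @^-1` Y).

Definition lmeasurable_cfun d (T : measurableType d) (mu : set T -> \bar R)
    (D : set T) (f : T -> R[i]) : Prop :=
  lmeasurable_fun mu D (fun x => complex.Re (f x)) /\
  lmeasurable_fun mu D (fun x => complex.Im (f x)).

Definition cintegral (D : set (R * R)) (f : R * R -> R[i]) : R[i] :=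
  (\int[leb2]_(x in D) complex.Re (f x)) +i*
  (\int[leb2]_(x in D) complex.Im (f x)).

Definition Linf_norm01 (f : R * R -> R[i]) : \bar R :=
  'N[leb2]_+oo [ (fun x => (cabs (f x))%:E) \_ box01 ]%E.

(* The outer measure agrees with leb4 on measurable sets, and with Lebesgue
   measure on Lebesgue measurable ones. *)
Definition cvg_in_measure (g : nat -> (R * R) * (R * R) -> R[i])
    (kappa : (R * R) * (R * R) -> R[i]) : Prop :=
  forall eps : R, 0 < eps ->
    (leb4^*)%mu ([set z | (box01 `*` boxpi) z /\ eps < cabs (g m z - kappa z)])
      @[m --> \oo] --> (0 : \bar R)%E.

End Measure.

Section FunctionClasses.
Context {R : realType}.

Definition dir (b : bool) : R * R := if b then (1, 0) else (0, 1).

Definition iter_partial (s : seq bool) (g : R * R -> R) : R * R -> R :=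
  foldr (fun b h x => 'D_(dir b) h x) g s.

Definition smooth (g : R * R -> R) : Prop :=
  forall s : seq bool,
    continuous (iter_partial s g) /\
    forall x b, derivable (iter_partial s g) x (dir b).

(* C^oo on the closed square: existence of a smooth extension to the plane. *)
Definition smooth01 (a : R * R -> R[i]) : Prop :=
  exists u v : R * R -> R, [/\ smooth u, smooth v &
    forall x, box01 x -> a x = u x +i* v x].

Definition expi (t : R) : R[i] := cos t +i* sin t.

Definition trig_poly (f : R * R -> R[i]) : Prop :=
  exists (s : seq (int * int)) (c : int * int -> R[i]), forall theta : R * R,
    f theta = \sum_(k <- s) c k * expi (k.1%:~R * theta.1 + k.2%:~R * theta.2).

Definition t_alpha (alpha : R) (theta : R * R) : R[i] :=
  ((4 * sin (theta.1 / 2) ^+ 2 + 4 * sin (theta.2 / 2) ^+ 2)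
     `^ (alpha / 2))%:C.

End FunctionClasses.

Section Matrices.
Context {R : realType}.

Definition fourier (f : R * R -> R[i]) (k1 k2 : int) : R[i] :=
  (((2 * pi) ^+ 2)^-1)%:C *
  cintegral boxpi (fun theta =>
    f theta * expi (- (k1%:~R * theta.1 + k2%:~R * theta.2))).

(* mxtens_unindex : 'I_(n * n) -> 'I_n * 'I_n is the lexicographic order, the
   one for which *t is the Kronecker product.  Indices start at 0. *)
Definition toeplitz2 (n : nat) (f : R * R -> R[i]) : 'M[R[i]]_(n * n) :=
  \matrix_(i, j)
    fourier f ((mxtens_unindex i).1%:Z - (mxtens_unindex j).1%:Z)
              ((mxtens_unindex i).2%:Z - (mxtens_unindex j).2%:Z).

(* The samples are taken at (i1 * step, i2 * step), 1 <= i1, i2 <= n. *)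
Definition diag_sample (n : nat) (step : R) (f : R * R -> R[i]) :
    'M[R[i]]_(n * n) :=
  diag_mx (\row_j f ((mxtens_unindex j).1.+1%:R * step,
                     (mxtens_unindex j).2.+1%:R * step)).

Definition hstep (n : nat) : R := n.+1%:R^-1.

Definition Dmat (n : nat) (mu : R * R -> R[i]) : 'M[R[i]]_(n * n) :=
  diag_sample n (hstep n) mu.

(* Symmetric Toeplitz matrix with first column a 0, ..., a (n-1). *)
Definition sym_toeplitz (n : nat) (a : nat -> R[i]) : 'M[R[i]]_n :=
  \matrix_(i, j) a `|i%:Z - j%:Z|%N.

(* The entry on the antidiagonal s = i + j (from 0) is a (s + 2) while
   s + 2 <= n - 1, then 0 for s = n - 2, n - 1, n, then a (2n - s); in
   particular the first row is a 2, ..., a (n-1), 0, 0 and the last column is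
   0, 0, a (n-1), ..., a 2. *)
Definition tau_hankel (n : nat) (a : nat -> R[i]) : 'M[R[i]]_n :=
  \matrix_(i, j)
    (if (i + j + 2 < n)%N then a (i + j + 2)%N
     else if (n < i + j)%N then a (2 * n - (i + j))%N
     else 0).

Definition tau (n : nat) (a : nat -> R[i]) : 'M[R[i]]_n :=
  sym_toeplitz n a - tau_hankel n a.

(* tau (S_k), where S_k = sym_toeplitz n (fun l => (l == k)%:R). *)
Definition tauS (n k : nat) : 'M[R[i]]_n := tau n (fun l => (l == k)%:R).

(* The tau matrix of toeplitz2 n f, for f real and even in each variable. *)
Definition tau2 (n : nat) (f : R * R -> R[i]) : 'M[R[i]]_(n * n) :=
  \sum_(k1 < n) \sum_(k2 < n)
    fourier f k1%:Z k2%:Z *: (tauS n k1 *t tauS n k2).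

(* Eigenvalues with multiplicity, in unspecified order. *)
Definition eigvals (n : nat) (A : 'M[R[i]]_n) : seq R[i] :=
  sval (closed_field_poly_normal (char_poly A)).

Definition singvals (n : nat) (A : 'M[R[i]]_n) : seq R :=
  [seq Num.sqrt (complex.Re z) | z <- eigvals ((map_mx Num.conj A)^T *m A)].

Definition specnorm (n : nat) (A : 'M[R[i]]_n) : R :=
  \big[Num.max/0]_(s <- singvals A) s.

End Matrices.

Section Sequences.
Context {R : realType}.

Definition mxseq := forall n : nat, 'M[R[i]]_(n * n).

Definition compact_support (V : topologicalType) (F : V -> R[i]) : Prop :=
  compact (closure [set x | F x != 0]).

Definition mean_value (D : set (R * R)) (g : R * R -> R[i]) : R[i] :=
  ((fine (leb2 D))^-1)%:C * cintegral D g.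

Definition admissible (D : set (R * R)) (psi : R * R -> R[i]) : Prop :=
  [/\ measurable D, (0 < leb2 D < +oo)%E & lmeasurable_cfun leb2 D psi].

Definition sv_distr (A : mxseq) (D : set (R * R)) (psi : R * R -> R[i]) :
    Prop :=
  admissible D psi /\
  forall F : R -> R[i], continuous F -> compact_support F ->
    ((n * n)%:R^-1 * \sum_(s <- singvals (A n)) F s) @[n --> \oo]
      --> mean_value D (fun x => F (cabs (psi x))).

Definition eig_distr (A : mxseq) (D : set (R * R)) (psi : R * R -> R[i]) :
    Prop :=
  admissible D psi /\
  forall F : R[i] -> R[i], continuous F -> compact_support F ->
    ((n * n)%:R^-1 * \sum_(z <- eigvals (A n)) F z) @[n --> \oo]
      --> mean_value D (fun x => F (psi x)).

(* B n m is the m-th approximant of A n. *)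
Definition acs (B : forall n : nat, nat -> 'M[R[i]]_(n * n)) (A : mxseq) :
    Prop :=
  exists (n_ : nat -> nat) (c omega : nat -> R),
    [/\ c m @[m --> \oo] --> (0 : R),
        omega m @[m --> \oo] --> (0 : R) &
        forall m n, (n_ m <= n)%N -> exists Rk Nm : 'M[R[i]]_(n * n),
          [/\ A n = B n m + Rk + Nm,
              (\rank Rk)%:R <= c m * (n * n)%:R &
              specnorm Nm <= omega m]].

Definition GLT (A : mxseq) (kappa : (R * R) * (R * R) -> R[i]) : Prop :=
  lmeasurable_cfun leb4 (box01 `*` boxpi) kappa /\
  exists (N : nat -> nat) (a f : nat -> nat -> R * R -> R[i]),
    [/\ forall m i, (i < N m)%N -> smooth01 (a m i) /\ trig_poly (f m i),
        cvg_in_measure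
          (fun m z => \sum_(i < N m) a m i z.1 * f m i z.2) kappa &
        acs (fun n m => \sum_(i < N m)
               diag_sample n n%:R^-1 (a m i) *m toeplitz2 n (f m i)) A].

Definition of_theta (psi : R * R -> R[i]) : (R * R) * (R * R) -> R[i] :=
  fun z => psi z.2.

End Sequences.

Arguments mxseq : clear implicits.

(* Main.v *)
(* The sine transform diagonalizes tau (T_n (t_alpha)), with the values of the truncated
   Fourier series of t_alpha at the points (i pi / (n + 1), j pi / (n + 1)) as eigenvalues.
   In terms of y = 1/2 + (cos theta1 + cos theta2) / 4 the symbol is a multiple of
   (1 - y)^(alpha/2).  The binomial series in y has coefficients of one sign, and so have
   the cosine expansions of the powers of y: the uniform error of a partial sum therefore
   also bounds the l1 norm of the Fourier coefficients left out.  Hence the eigenvalues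
   are uniformly close to samples of t_alpha, and the Frobenius norm of
   E = T_n (t_alpha) - tau (T_n (t_alpha)) + h^alpha (D_n (mu) - mubar) is o(n).
   As few eigenvalues of P are small, P^-1 (B + h^alpha D) - I = P^-1 E is the sum of a
   matrix of rank o(n^2) and one of Frobenius norm o(n), which is all that the GLT and the
   singular value statements need.  For the eigenvalues, take the similar matrix
   I + P^(-1/2) E P^(-1/2): its skew-Hermitian part has Frobenius norm o(n) because the
   eigenvalues of P are at least of order h^alpha, so in its Schur form the part off the
   diagonal is negligible, and the diagonal clusters at 1. *)

Require Import Defs.
From HB Require Import structures.
From mathcomp Require Import all_boot all_order all_algebra.
From mathcomp Require Import all_classical all_reals all_analysis.
From mathcomp Require Import measurable_realfun complex mxtens.
From mathcomp Require Import spectral ring lra zify.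
Set Implicit Arguments.
Unset Strict Implicit.
Unset Printing Implicit Defensive.
Import Order.TTheory GRing.Theory Num.Theory.
Import numFieldNormedType.Exports.
Local Open Scope classical_set_scope.
Local Open Scope complex_scope.
Local Open Scope ring_scope.

(** * Frobenius norm, rank and spectra *)

Section LinearAlgebra.
Local Open Scope sesquilinear_scope.
Context (R : rcfType).
Local Notation C := R[i].

(** Sizes are squared Frobenius norms throughout: they add up over entries, are unitarily invariant
    and react simply to diagonal factors. An a.c.s. asks for a small spectral norm; the passage
    costs only rank, because few singular values of a matrix of squared Frobenius norm o(n^2) exceed
    a fixed threshold. The GLT approximants are exhibited directly, as Toeplitz matrices of
    polynomials in y with spatial factor 1. The obstacle is the spectrum. As [mu] is complex, the
    symmetrized matrix is not normal in general, and a perturbation of small rank could move all its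
    eigenvalues. What saves the argument is that its skew-Hermitian part comes from the diagonal
    term h^alpha D_n (mu) alone: the few tiny eigenvalues of P amplify the squared size of that term
    to at most a constant each, the others to something tending to 0. This requires the lower bound
    of order h^alpha for the truncated Fourier series itself; closeness to samples of t_alpha is too
    weak, the uniform error being possibly larger than h^alpha. *)

Definition nrm2 (z : C) : R := complex.Re z ^+ 2 + complex.Im z ^+ 2.

Lemma nrm2C z : (nrm2 z)%:C = z * z^*%R.
Proof.
by rewrite /nrm2 add_Re2_Im2 sqr_normc.
Qed.

Lemma nrm2_ge0 z : 0 <= nrm2 z.
Proof. by rewrite addr_ge0 ?sqr_ge0. Qed.

Lemma nrm2M z w : nrm2 (z * w) = nrm2 z * nrm2 w.
Proof. by case: z w => [a b] [c d]; rewrite /nrm2 /=; ring. Qed.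

Lemma nrm2_conj z : nrm2 z^*%R = nrm2 z.
Proof. by case: z => [a b]; rewrite /nrm2 /=; ring. Qed.

Lemma nrm2N z : nrm2 (- z) = nrm2 z.
Proof. by case: z => [a b]; rewrite /nrm2 /=; ring. Qed.

Lemma nrm2_real (x : R) : nrm2 x%:C = x ^+ 2.
Proof. by rewrite /nrm2 /= expr0n addr0. Qed.

Lemma nrm20 : nrm2 0 = 0.
Proof. by rewrite (nrm2_real 0) expr0n. Qed.

Lemma nrm2_eq0 z : (nrm2 z == 0) = (z == 0).
Proof.
rewrite -(inj_eq (@complexI R)) nrm2C (_ : 0%:C = 0) // mulf_eq0.
by rewrite fmorph_eq0 orbb.
Qed.

Lemma nrm2V z : nrm2 z^-1 = (nrm2 z)^-1.
Proof.
have [->|z0] := eqVneq z 0; first by rewrite invr0 nrm20 invr0.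
apply: (@mulIf _ (nrm2 z)); first by rewrite nrm2_eq0.
by rewrite -nrm2M !mulVf ?nrm2_eq0 // (nrm2_real 1) expr1n.
Qed.

Lemma nrm2D z w : nrm2 (z + w) <= 2 * (nrm2 z + nrm2 w).
Proof.
case: z w => [a b] [c d]; rewrite /nrm2 /=.
have := sqr_ge0 (a - c); have := sqr_ge0 (b - d); nra.
Qed.

Lemma adjM m n p (A : 'M[C]_(m, n)) (B : 'M[C]_(n, p)) : (A *m B)^t* = B^t* *m A^t*.
Proof. by rewrite trmx_mul map_mxM. Qed.

Lemma adjD m n (A B : 'M[C]_(m, n)) : (A + B)^t* = A^t* + B^t*.
Proof. by rewrite raddfD map_mxD. Qed.

Lemma adj_diag n (d : 'rV[C]_n) : (diag_mx d)^t* = diag_mx (\row_j (d 0 j)^*%R).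
Proof. by rewrite tr_diag_mx map_diag_mx; congr diag_mx; apply/rowP => j; rewrite !mxE. Qed.

Lemma adj_unitary n (V : 'M[C]_n) : V \is unitarymx -> V^t* \is unitarymx.
Proof. by rewrite trmxC_unitary. Qed.

Definition frob2 m n (A : 'M[C]_(m, n)) : R := \sum_i \sum_j nrm2 (A i j).

Lemma frob2_ge0 m n (A : 'M[C]_(m, n)) : 0 <= frob2 A.
Proof. by apply: sumr_ge0 => i _; apply: sumr_ge0 => j _; exact: nrm2_ge0. Qed.

Lemma frob2C m n (A : 'M[C]_(m, n)) : (frob2 A)%:C = \tr (A *m A^t*).
Proof.
rewrite /frob2 rmorph_sum; apply: eq_bigr => i _.
rewrite rmorph_sum !mxE; apply: eq_bigr => j _.
by rewrite [LHS]nrm2C !mxE.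
Qed.

Lemma frob2_adj m n (A : 'M[C]_(m, n)) : frob2 (A^t*) = frob2 A.
Proof.
rewrite /frob2 exchange_big; apply: eq_bigr => i _; apply: eq_bigr => j _.
by rewrite !mxE nrm2_conj.
Qed.

Lemma frob2D m n (A B : 'M[C]_(m, n)) : frob2 (A + B) <= 2 * (frob2 A + frob2 B).
Proof.
rewrite /frob2 -big_split mulr_sumr; apply: ler_sum => i _.
rewrite -big_split mulr_sumr; apply: ler_sum => j _ /=.
by rewrite mxE nrm2D.
Qed.

Lemma frob2N m n (A : 'M[C]_(m, n)) : frob2 (- A) = frob2 A.
Proof. by apply: eq_bigr => i _; apply: eq_bigr => j _; rewrite mxE nrm2N. Qed.

Lemma frob2Z m n c (A : 'M[C]_(m, n)) : frob2 (c *: A) = nrm2 c * frob2 A.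
Proof.
rewrite mulr_sumr; apply: eq_bigr => i _; rewrite mulr_sumr.
by apply: eq_bigr => j _; rewrite mxE nrm2M.
Qed.

Lemma frob2_unitaryr m n p (A : 'M[C]_(m, n)) (U : 'M[C]_(n, p)) :
  U \is unitarymx -> frob2 (A *m U) = frob2 A.
Proof.
move=> Uu; apply: complexI; rewrite !frob2C adjM mulmxA.
by rewrite -(mulmxA A) (unitarymxP Uu) mulmx1.
Qed.

Lemma frob2_unitaryl k m n (A : 'M[C]_(m, n)) (U : 'M[C]_(k, m)) :
  k = m -> U \is unitarymx -> frob2 (U *m A) = frob2 A.
Proof.
move=> km; case: _ / (esym km) in U * => Uu; rewrite -frob2_adj adjM.
by rewrite (frob2_unitaryr _ (adj_unitary Uu)) frob2_adj.
Qed.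

Lemma frob2_diagl m n (d : 'rV[C]_m) (A : 'M[C]_(m, n)) c :
  (forall i, nrm2 (d 0 i) <= c) -> frob2 (diag_mx d *m A) <= c * frob2 A.
Proof.
move=> dc; rewrite /frob2 mulr_sumr; apply: ler_sum => i _.
rewrite mulr_sumr; apply: ler_sum => j _.
by rewrite mul_diag_mx mxE nrm2M ler_wpM2r ?nrm2_ge0.
Qed.

Lemma frob2_diag n (d : 'rV[C]_n) : frob2 (diag_mx d) = \sum_i nrm2 (d 0 i).
Proof.
apply: eq_bigr => i _; rewrite (bigD1 i) //= big1 ?addr0 ?mxE ?eqxx ?mulr1n //.
by move=> j ji; rewrite mxE eq_sym (negPf ji) mulr0n nrm20.
Qed.

Lemma rank_diag n (d : 'rV[C]_n) (J : {pred 'I_n}) :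
  (forall i, i \notin J -> d 0 i = 0) -> (\rank (diag_mx d) <= #|J|)%N.
Proof.
move=> dJ.
rewrite -sum1_card.
have -> : diag_mx d = \sum_(i in J) d 0 i *: delta_mx i i.
  rewrite diag_mx_sum_delta (bigID [in J]) /= [X in _ + X]big1 ?addr0 //.
  by move=> i /dJ->; rewrite scale0r.
elim/big_rec2: _ => [|i k A _ IH]; first by rewrite mxrank0.
apply: leq_trans (mxrank_add _ _) _; rewrite leq_add //.
by apply: leq_trans (mxrank_scale _ _) _; rewrite mxrank_delta.
Qed.

Lemma charpoly_diag n (d : 'rV[C]_n) :
  char_poly (diag_mx d) = \prod_i ('X - (d 0 i)%:P).
Proof.
rewrite char_poly_trig ?diag_mx_is_trig //.
by apply: eq_bigr => i _; rewrite mxE eqxx mulr1n.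
Qed.

Lemma charpoly_sim n (V A : 'M[C]_n) : V \in unitmx ->
  char_poly (invmx V *m A *m V) = char_poly A.
Proof.
move=> Vu; rewrite /char_poly /char_poly_mx !map_mxM /=.
have VuP : map_mx polyC (invmx V) *m map_mx polyC V = 1%:M.
  by rewrite -map_mxM mulVmx // map_mx1.
have -> : 'X%:M - map_mx polyC (invmx V) *m map_mx polyC A *m map_mx polyC V =
   map_mx polyC (invmx V) *m ('X%:M - map_mx polyC A) *m map_mx polyC V.
  by rewrite mulmxBr mulmxBl -(mulmxA _ 'X%:M) -scalar_mxC mulmxA VuP mul1mx.
by rewrite !det_mulmx mulrC mulrA -det_mulmx (mulmx1C VuP) det1 mul1r.
Qed.

(** Unique factorization into linear factors fixes the multiset of eigenvalues, so any explicit
    factorization of the characteristic polynomial lists them up to order. *)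
Lemma charpoly_roots n (A : 'M[C]_n) (s : seq C) (z : 'I_n -> C) :
  char_poly A = lead_coef (char_poly A) *: \prod_(x <- s) ('X - x%:P) ->
  char_poly A = \prod_i ('X - (z i)%:P) -> perm_eq s [seq z i | i : 'I_n].
Proof.
rewrite (eqP (char_poly_monic A)) scale1r => -> sz.
by apply: prod_XsubC_eq; rewrite sz big_map big_enum.
Qed.

(** The spectral theorem for normal matrices gives complex eigenvalues; they are real and
    nonnegative because the i-th one is the squared norm of the i-th row of [V *m K^t*]. *)
Lemma gram_spectral m n (K : 'M[C]_(m, n)) : exists (V : 'M[C]_n) (d : 'I_n -> R),
  [/\ V \is unitarymx, forall i, 0 <= d i &
      K^t* *m K = V^t* *m diag_mx (\row_i (d i)%:C) *m V].
Proof.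
have Kh : K^t* *m K \is normalmx.
  apply/normalmxP; rewrite !trmx_mul !map_mxM !map_trmx trmxK -map_mx_comp.
  by rewrite (map_mx_id (@conjCK _)).
have Vu := spectral_unitarymx (K^t* *m K).
set V := spectralmx _ in Vu; pose D := V *m (K^t* *m K) *m V^t*.
have De : D = (V *m K^t*) *m (V *m K^t*)^t*.
  by rewrite adjM trmxCK /D !mulmxA.
have /orthomx_spectralP Ke := Kh.
have DE : D = diag_mx (spectral_diag (K^t* *m K)).
  rewrite /D {1}Ke -/V (invmx_unitary Vu) !mulmxA (unitarymxP Vu) mul1mx.
  by rewrite -!mulmxA (unitarymxP Vu) mulmx1.
exists V, (fun i => \sum_j nrm2 ((V *m K^t*) i j)); split => //.
  by move=> i; apply: sumr_ge0 => j _; exact: nrm2_ge0.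
rewrite [LHS]Ke -/V (invmx_unitary Vu); congr (_ *m diag_mx _ *m _).
apply/rowP => i; rewrite [RHS]mxE.
have /matrixP /(_ i i) := DE; rewrite [RHS]mxE eqxx mulr1n => <-.
rewrite De [LHS]mxE rmorph_sum; apply: eq_bigr => j _.
by rewrite [RHS]nrm2C [X in _ * X]mxE [X in _ * X^*%R]mxE.
Qed.

Lemma frob2_gram m n (K : 'M[C]_(m, n)) (V : 'M[C]_n) (d : 'I_n -> R) :
  V \is unitarymx -> K^t* *m K = V^t* *m diag_mx (\row_i (d i)%:C) *m V ->
  frob2 K = \sum_i d i.
Proof.
move=> Vu Ke; apply: complexI; rewrite frob2C mxtrace_mulC Ke.
rewrite mxtrace_mulC mulmxA (unitarymxP Vu) mul1mx mxtrace_diag.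
by rewrite rmorph_sum; apply: eq_bigr => i _; rewrite mxE.
Qed.

Lemma card_markov n (d : 'I_n -> R) t : 0 < t -> (forall i, 0 <= d i) ->
  t * #|[pred i | t < d i]|%:R <= \sum_i d i.
Proof.
move=> t0 d0; rewrite (bigID [pred i | t < d i]) /=.
rewrite -[leLHS]addr0 lerD ?sumr_ge0 //.
rewrite mulr_natr -sumr_const ler_sum // => i; exact: ltW.
Qed.

(* Split K along the eigenvectors of K^t* K whose eigenvalue exceeds t. *)
Lemma low_rank_small_norm n (K : 'M[C]_n) t : 0 < t -> exists (Rk N : 'M[C]_n) (d : 'I_n -> R),
  [/\ K = Rk + N, t * (\rank Rk)%:R <= frob2 K,
      char_poly (N^t* *m N) = \prod_i ('X - ((d i)%:C)%:P) &
      forall i, 0 <= d i <= t].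
Proof.
move=> t0; have [V [d [Vu d0 KE]]] := gram_spectral K.
pose J := [pred i | t < d i].
pose e := \row_i (i \in J)%:R : 'rV[C]_n; pose e' := \row_i (i \notin J)%:R : 'rV[C]_n.
have ee : diag_mx e + diag_mx e' = 1%:M.
  apply/matrixP => i j; rewrite !mxE; have [_|_] := eqVneq i j; last by rewrite !mulr0n addr0.
  by case: (i \in J) => /=; rewrite !mulr1n ?addr0 ?add0r.
exists (K *m V^t* *m diag_mx e *m V), (K *m V^t* *m diag_mx e' *m V).
exists (fun i => if i \in J then 0 else d i); split.
- rewrite -mulmxDl -mulmxDr ee mulmx1 mulmxKtV //.
- rewrite (frob2_gram Vu KE); apply: le_trans (card_markov t0 d0).
  rewrite ler_wpM2l ?(ltW t0) // ler_nat.
  apply: leq_trans (mxrankM_maxl _ _) _; apply: leq_trans (mxrankM_maxr _ _) _.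
  by apply: rank_diag => i; rewrite mxE => /negPf->.
- have -> : (K *m V^t* *m diag_mx e' *m V)^t* *m (K *m V^t* *m diag_mx e' *m V)
     = invmx V *m diag_mx (\row_i (if i \in J then 0 else d i)%:C) *m V.
    rewrite (invmx_unitary Vu) !adjM trmxCK adj_diag.
    have VV : V *m V^t* = 1%:M by exact/unitarymxP.
    move: (V^t*) (K^t*) KE VV => W L KE VW; rewrite -!mulmxA (mulmxA L) KE -!mulmxA.
    rewrite (mulmxA V) VW mul1mx (mulmxA V) VW mul1mx !mulmxA -(mulmxA W) mulmx_diag.
    rewrite -(mulmxA W) mulmx_diag.
    apply: (congr1 (fun D => W *m diag_mx D *m V)); apply/rowP => i; rewrite !mxE.
    by case: (i \in J); rewrite /= ?conjC0 ?conjC1 ?mul0r ?mulr0 ?mul1r ?mulr1.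
  rewrite charpoly_sim ?unitarymx_unit // charpoly_diag.
  by apply: eq_bigr => i _; rewrite mxE.
- move=> i; rewrite inE; case: ltP => [_|]; rewrite ?lexx ?(ltW t0) //.
  by move=> ->; rewrite d0.
Qed.

(** The eigenvalues d_i of the Gram matrix add up to [frob2 K]. Those above 1 number at most
    [frob2 K]; the others satisfy d_i^2 <= d_i, so the cutoff 1 bounds a sum of squares linearly. *)
Lemma gram_low_rank n (K : 'M[C]_n) : exists Rk N : 'M[C]_n,
  [/\ K^t* *m K = Rk + N, (\rank Rk)%:R <= frob2 K & frob2 N <= frob2 K].
Proof.
have [V [d [Vu d0 KE]]] := gram_spectral K.
pose J := [pred i | 1 < d i].
pose e := \row_i (if i \in J then d i else 0)%:C : 'rV[C]_n.
pose e' := \row_i (if i \in J then 0 else d i)%:C : 'rV[C]_n.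
exists (V^t* *m diag_mx e *m V), (V^t* *m diag_mx e' *m V); split.
- rewrite KE -mulmxDl -mulmxDr -raddfD /=; congr (_ *m diag_mx _ *m _).
  apply/rowP => i; rewrite !mxE -rmorphD; case: ifP; by rewrite ?addr0 ?add0r.
- rewrite (frob2_gram Vu KE).
  have := card_markov (@ltr01 R) d0; rewrite mul1r; apply: le_trans.
  rewrite ler_nat.
  apply: leq_trans (mxrankM_maxl _ _) _; apply: leq_trans (mxrankM_maxr _ _) _.
  by apply: rank_diag => i; rewrite mxE => /negPf->.
- rewrite frob2_unitaryr // (frob2_unitaryl _ (erefl _)) ?trmxC_unitary // (frob2_gram Vu KE).
  rewrite frob2_diag; apply: ler_sum => i _; rewrite mxE nrm2_real inE.
  by case: ltP => d1; rewrite ?expr0n //= expr2 ler_piMl.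
Qed.

Lemma frob2_col_mx m1 m2 n (A : 'M[C]_(m1, n)) (B : 'M[C]_(m2, n)) :
  frob2 (col_mx A B) = frob2 A + frob2 B.
Proof.
rewrite /frob2 big_split_ord /=; congr (_ + _); apply: eq_bigr => i _.
  by apply: eq_bigr => j _; rewrite col_mxEu.
by apply: eq_bigr => j _; rewrite col_mxEd.
Qed.

(* L is the identity on the kernel of 1 - L, so its Frobenius norm bounds the
   dimension of that kernel. *)
Lemma rank_one_sub n (L : 'M[C]_n) : n%:R <= (\rank (1%:M - L))%:R + frob2 L.
Proof.
pose Kx := kermx (1%:M - L).
have rK : (\rank Kx)%:R = n%:R - (\rank (1%:M - L))%:R :> R.
  by rewrite mxrank_ker natrB // rank_leq_row.
rewrite -lerBlDl -rK.
rewrite -(@frob2_unitaryl _ _ _ L (schmidt_complete Kx)) ?add_rank_ortho //; last first.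
  exact: schmidt_complete_unitarymx.
rewrite mul_col_mx frob2_col_mx -[leLHS]addr0 lerD ?frob2_ge0 //.
set S := schmidt _.
have SL : S *m L = S.
  apply/eqP; rewrite eq_sym -subr_eq0 -{1}[S]mulmx1 -mulmxBr; apply/eqP/sub_kermxP.
  by rewrite eqmx_schmidt_free ?row_base_free // eq_row_base.
have Su : S \is unitarymx by rewrite schmidt_unitarymx // rank_leq_col.
by rewrite SL -lecR frob2C (unitarymxP Su) mxtrace1 rmorph_nat.
Qed.

(** Restricted to the indices with large [z i] and divided by them row by row, the diagonal matrix
    becomes 1, split as [D] times a block of [Rk] plus [L]. Then [rank_one_sub] bounds the number of
    these indices by the rank plus [frob2 L], and the division has multiplied the squared entries of
    [K] by less than 1 / e. *)
Lemma count_low_rank n (z : 'I_n -> C) (Rk K : 'M[C]_n) e : 0 < e ->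
  diag_mx (\row_i z i) = Rk + K ->
  #|[pred i | e < nrm2 (z i)]|%:R <= (\rank Rk)%:R + e^-1 * frob2 K.
Proof.
move=> e0 zE; pose J := [pred i | e < nrm2 (z i)].
pose f (k : 'I_#|J|) : 'I_n := enum_val k.
have fJ k : e < nrm2 (z (f k)) by have := enum_valP k; rewrite inE.
pose D := diag_mx (\row_k (z (f k))^-1).
have DE : D *m mxsub f f (diag_mx (\row_i z i)) = 1%:M.
  apply/matrixP => k l; rewrite mul_diag_mx !mxE.
  rewrite (inj_eq enum_val_inj); case: eqP => [->|_]; last by rewrite !mulr0n mulr0.
  rewrite !mulr1n mulVf //; apply/eqP => z0.
  by have := fJ l; rewrite z0 nrm20 ltNge (ltW e0).
pose L := D *m mxsub f f K.
have RL : D *m mxsub f f Rk = 1%:M - L.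
  by rewrite -DE zE /L -mulmxBr; congr (_ *m _); apply/matrixP => k l; rewrite !mxE addrK.
have := rank_one_sub L; rewrite -RL => /le_trans; apply; apply: lerD.
  rewrite ler_nat; apply: leq_trans (mxrankM_maxr _ _) _.
  have -> : mxsub f f Rk = rowsub f 1%:M *m (Rk *m colsub f 1%:M).
    by rewrite -{1}[Rk]mul1mx mxsub_mul -{1}[Rk]mulmx1 mxsub_mul; congr (_ *m (_ *m _)); apply: mxsub_id.
  by apply: leq_trans (mxrankM_maxr _ _) _; apply: mxrankM_maxl.
apply: le_trans (frob2_diagl (c := e^-1) _ _) _.
  by move=> i; rewrite mxE nrm2V lef_pV2 ?posrE ?(ltW (fJ i)) // (lt_trans e0).
rewrite ler_wpM2l ?invr_ge0 ?(ltW e0) // /frob2.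
apply: (@le_trans _ _ (\sum_(i in J) \sum_(j in J) nrm2 (K i j))).
  rewrite [leRHS]big_enum_val; apply: ler_sum => k _.
  by rewrite [leRHS]big_enum_val; apply: ler_sum => l _; rewrite mxE.
rewrite [leRHS](bigID [in J]) /= -[leLHS]addr0 lerD //; last first.
  by apply: sumr_ge0 => i _; apply: sumr_ge0 => j _; exact: nrm2_ge0.
apply: ler_sum => i _; rewrite [leRHS](bigID [in J]) /= -[leLHS]addr0 lerD //.
by apply: sumr_ge0 => j _; exact: nrm2_ge0.
Qed.

(* Off the diagonal, the entries of T - T^t* are up to sign and conjugation those of
   the triangular matrix T, each occurring twice. *)
Lemma schur_skew n (G : 'M[C]_n) : exists U T : 'M[C]_n,
  [/\ U \is unitarymx, T = U *m G *m U^t*,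
     char_poly G = \prod_i ('X - (T i i)%:P) &
     2 * frob2 (T - diag_mx (\row_i T i i)) <= frob2 (G - G^t*)].
Proof.
have [U Uu Ut] : exists2 U : 'M[C]_n, U \is unitarymx & is_trig_mx (U *m G *m U^t*).
  case: n G => [|n] G.
    exists 1%:M; last by apply/is_trig_mxP => -[].
    by apply/unitarymxP; rewrite trmx1 map_mx1 mulmx1.
  by have [U Uu] := Schur G isT; rewrite /similar_to conjymx //; exists U.
exists U, (U *m G *m U^t*); set T := U *m G *m U^t*; split=> //.
  rewrite -(char_poly_trig Ut) -(charpoly_sim T (unitarymx_unit Uu)) (invmx_unitary Uu).
  by rewrite /T !mulmxA (mulmx1C (unitarymxP Uu)) mul1mx -mulmxA (mulmx1C (unitarymxP Uu)) mulmx1.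
suff main : 2 * frob2 (T - diag_mx (\row_i T i i)) <= frob2 (T - T^t*).
  apply: le_trans main _.
  have -> : T - T^t* = U *m (G - G^t*) *m U^t*.
    by rewrite mulmxBr mulmxBl /T !adjM trmxCK !mulmxA.
  by rewrite frob2_unitaryr ?trmxC_unitary // (frob2_unitaryl _ (erefl _)).
have {}Ut (i j : 'I_n) (ij : (i < j)%N) : T i j = 0 by exact: (is_trig_mxP Ut).
clearbody T; set N := T - _.
(* Taking (i, j) and (j, i) together allows a comparison entry by entry, since one of the two
   entries of [N] is 0. *)
have -> : 2 * frob2 N = \sum_i \sum_j (nrm2 (N i j) + nrm2 (N j i)).
  under eq_bigr do rewrite big_split; rewrite big_split /= [X in _ + X]exchange_big /=.
  by rewrite mulr2n mulrDl mul1r.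
apply: ler_sum => i _; apply: ler_sum => j _; rewrite !mxE.
have [<-|] := eqVneq i j; first by rewrite !mulr1n subrr nrm20 addr0 nrm2_ge0.
move=> ne; rewrite !mulr0n !subr0.
have [ij|ji|/val_inj ij] := ltngtP i j.
- by rewrite (Ut i j) // sub0r nrm20 add0r nrm2N nrm2_conj.
- by rewrite (Ut j i) // nrm20 addr0 conjC0 subr0.
- by rewrite ij eqxx in ne.
Qed.

End LinearAlgebra.

(** * Fourier coefficients of bounded functions *)

Section Integrals.
Context {R : realType}.
Local Notation T1 := (measurableTypeR R).
Local Notation T2 := (T1 * T1)%type.
Local Notation mu := (@lebesgue_measure R).
Local Notation II := ([set` `[- pi, pi]] : set R).

(** Bounded Borel functions on the whole space: closed under sums, products and inner composition
    with measurable maps, and integrable over every measurable set of finite measure, so that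
    integrability becomes structural. *)
Definition bmeas d (T : measurableType d) (g : T -> R) :=
  measurable_fun setT g /\ exists M, forall x, `|g x| <= M.

Lemma bmeasM d (T : measurableType d) (f g : T -> R) :
  bmeas f -> bmeas g -> bmeas (fun x => f x * g x).
Proof.
move=> [mf [M fM]] [mg [N gN]]; split; first exact: measurable_funM.
by exists (M * N) => x; rewrite normrM ler_pM.
Qed.

Lemma bmeasD d (T : measurableType d) (f g : T -> R) :
  bmeas f -> bmeas g -> bmeas (fun x => f x + g x).
Proof.
move=> [mf [M fM]] [mg [N gN]]; split; first exact: measurable_funD.
by exists (M + N) => x; rewrite (le_trans (ler_normD _ _)) // lerD.
Qed.

Lemma bmeas_cst d (T : measurableType d) (c : R) : bmeas (fun _ : T => c).
Proof. by split; [exact: measurable_cst | exists `|c|]. Qed.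

Lemma bmeas_integrable d (T : measurableType d) (m : {measure set T -> \bar R})
  (A : set T) g : measurable A -> (m A < +oo)%E -> bmeas g ->
  m.-integrable A (EFin \o g).
Proof.
move=> mA Afin [mg [M gM]]; apply: measurable_bounded_integrable => //.
  exact: measurable_funS mg.
by exists M; split; [exact: num_real | move=> x Mx y _ /=; rewrite (le_trans (gM y)) // ltW].
Qed.

Lemma bmeas_comp d (T : measurableType d) d' (T' : measurableType d') (f : T' -> R) (g : T -> T') :
  bmeas f -> measurable_fun setT g -> bmeas (f \o g).
Proof.
move=> [mf [M fM]] mg; split; first exact: measurableT_comp.
by exists M => x; exact: fM.
Qed.

Lemma bmeas_cos (a : R) : @bmeas _ T1 (fun x => cos (a * x)).
Proof.
split; last by exists 1 => x; exact: cos_max.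
apply: continuous_measurable_fun => x; apply: continuous_comp; last exact: continuous_cos.
by apply: cvgM; [exact: cvg_cst | exact: cvg_id].
Qed.

Lemma bmeas_sin (a : R) : @bmeas _ T1 (fun x => sin (a * x)).
Proof.
split; last by exists 1 => x; exact: sin_max.
apply: continuous_measurable_fun => x; apply: continuous_comp; last exact: continuous_sin.
by apply: cvgM; [exact: cvg_cst | exact: cvg_id].
Qed.

Lemma measurable_II : measurable (II : set T1). Proof. exact: measurable_itv. Qed.

Lemma ltN_pi : - pi < pi :> R. Proof. by rewrite gtrN ?pi_gt0. Qed.

Lemma lebesgue_II : mu II = (2 * pi)%:E.
Proof.
rewrite lebesgue_measure_itv /= lte_fin ltN_pi -EFinD; congr EFin.
by rewrite opprK mulr2n mulrDl !mul1r.
Qed.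

Lemma integrable_II (g : T1 -> R) : bmeas g -> mu.-integrable II (EFin \o g).
Proof.
have h : (mu II < +oo)%E by rewrite lebesgue_II ltry.
by apply: bmeas_integrable; [exact: measurable_II | exact: h].
Qed.

Lemma sin_intpi (m : int) : sin (m%:~R * pi) = 0 :> R.
Proof.
have Hn (n : nat) : sin (n%:R * pi) = 0 :> R.
  elim: n => [|n IH]; first by rewrite mul0r sin0.
  by rewrite -addn1 natrD mulrDl mul1r sinDpi IH oppr0.
case: m => n; first exact: Hn.
by rewrite NegzE mulrNz mulNr sinN Hn oppr0.
Qed.

Lemma int_cos (m : int) :
  \int[mu]_(x in II) cos (m%:~R * x) = if m == 0 then 2 * pi else 0.
Proof.
have [->|m0] := eqVneq m 0.
  under eq_Rintegral do rewrite mulr0z mul0r cos0.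
  rewrite Rintegral_cst; last exact: measurable_II.
  by rewrite [X in fine X]lebesgue_II mul1r.
have mR : m%:~R != 0 :> R by rewrite intr_eq0.
pose F (x : R) := sin (m%:~R * x) / m%:~R.
have dF (x : R) : is_derive x 1 F (cos (m%:~R * x)).
  rewrite /F; apply: is_derive_eq; rewrite /= ?scaler0 ?add0r /GRing.scale /=.
  by field.
have cF : continuous F.
  by move=> x; apply: differentiable_continuous; apply/derivable1_diffP; case: (dF x).
rewrite /Rintegral (@continuous_FTC2 _ _ F) ?ltN_pi //=.
- rewrite /F mulrN sinN sin_intpi; by rewrite mul0r oppr0 mul0r subr0.
- apply: continuous_subspaceT => x; apply: continuous_comp; last exact: continuous_cos.
  by apply: cvgM; [exact: cvg_cst | exact: cvg_id].
- split.
  + by move=> x _; case: (dF x).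
  + exact/cvg_at_right_filter/cF.
  + exact/cvg_at_left_filter/cF.
- by move=> x _; rewrite derive1E; case: (dF x).
Qed.

Lemma int_sin (m : int) : \int[mu]_(x in II) sin (m%:~R * x) = 0.
Proof.
have [->|m0] := eqVneq m 0.
  under eq_Rintegral do rewrite mulr0z mul0r sin0.
  by rewrite Rintegral_cst // mul0r.
have mR : m%:~R != 0 :> R by rewrite intr_eq0.
pose F (x : R) := - (cos (m%:~R * x) / m%:~R).
have dF (x : R) : is_derive x 1 F (sin (m%:~R * x)).
  rewrite /F; apply: is_derive_eq; rewrite /= ?scaler0 ?add0r /GRing.scale /=.
  by field.
have cF : continuous F.
  by move=> x; apply: differentiable_continuous; apply/derivable1_diffP; case: (dF x).
rewrite /Rintegral (@continuous_FTC2 _ _ F) ?ltN_pi //=.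
- by rewrite /F mulrN cosN subrr.
- apply: continuous_subspaceT => x; apply: continuous_comp; last exact: continuous_sin.
  by apply: cvgM; [exact: cvg_cst | exact: cvg_id].
- split.
  + by move=> x _; case: (dF x).
  + exact/cvg_at_right_filter/cF.
  + exact/cvg_at_left_filter/cF.
- by move=> x _; rewrite derive1E; case: (dF x).
Qed.

Lemma measurable_boxpi : measurable (@boxpi R : set T2).
Proof. exact: measurableX. Qed.

Lemma leb2_boxpi : leb2 (@boxpi R) = ((2 * pi) ^+ 2)%:E.
Proof.
rewrite product_measure1E; [|exact: measurable_II..].
have -> : ((2 * pi) ^+ 2 : R)%:E = ((2 * pi)%:E * (2 * pi)%:E)%E by rewrite -EFinM expr2.
by congr (_ * _)%E; exact: lebesgue_II.
Qed.

Lemma integrable_boxpi (g : T2 -> R) : bmeas g -> leb2.-integrable boxpi (EFin \o g).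
Proof.
have h : (leb2 (@boxpi R) < +oo)%E by rewrite leb2_boxpi ltry.
by apply: bmeas_integrable; [exact: measurable_boxpi | exact: h].
Qed.

Lemma Ib_prod (u v : T1 -> R) : bmeas u -> bmeas v ->
  \int[leb2]_(x in boxpi) (u x.1 * v x.2) =
  (\int[mu]_(x in II) u x) * \int[mu]_(x in II) v x.
Proof.
move=> mu' mv.
have bu : bmeas (u \o fst : T2 -> R) by apply: bmeas_comp; last exact: measurable_fst.
have bv : bmeas (v \o snd : T2 -> R) by apply: bmeas_comp; last exact: measurable_snd.
have := integrable_boxpi (bmeasM bu bv) => /= Huv.
(* Everything is extended by 0, because Fubini is applied on the whole plane; the indicator of the
   square is the product of those of its sides. *)
rewrite [LHS]Rintegral_mkcond [X in X * _]Rintegral_mkcond [X in _ * X]Rintegral_mkcond.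
have E : EFin \o ((fun x : T2 => u x.1 * v x.2) \_ boxpi) =
   (fun x => ((u \_ II) x.1 * (v \_ II) x.2)%:E).
  apply/funext => -[x y] /=; congr EFin; rewrite !patchE.
  rewrite /boxpi in_setX /=; case: (x \in II); case: (y \in II); by rewrite ?mul0r ?mulr0.
have intE : leb2.-integrable setT (fun x : T2 => ((u \_ II) x.1 * (v \_ II) x.2)%:E).
  rewrite -E -restrict_EFin; apply/integrable_restrict; rewrite ?setTI //; exact: measurable_boxpi.
rewrite {1}/Rintegral [in LHS](_ : (fun x => _) = EFin \o ((fun x : T2 => u x.1 * v x.2) \_ boxpi)) //.
rewrite E -integral12_prod_meas1 // /fubini_F /=.
have iv : mu.-integrable setT (EFin \o (v \_ II)).
  rewrite -restrict_EFin; apply/integrable_restrict; rewrite ?setTI //; exact: integrable_II.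
have iu : mu.-integrable setT (EFin \o (u \_ II)).
  rewrite -restrict_EFin; apply/integrable_restrict; rewrite ?setTI //; exact: integrable_II.
have Hin x : (\int[mu]_y ((u \_ II) x * (v \_ II) y)%:E)%E =
   ((u \_ II) x * \int[mu]_y (v \_ II) y)%:E.
  under eq_integral do rewrite EFinM.
  rewrite integralZl // EFinM; congr (_ * _)%E.
  by rewrite /Rintegral fineK // integrable_fin_num.
under eq_integral do rewrite Hin.
by rewrite -[fine _]/(Rintegral _ _ _) RintegralZr.
Qed.

Local Notation Ib g := (\int[leb2]_(x in boxpi) g x).

Lemma IbD (f g : T2 -> R) : bmeas f -> bmeas g -> Ib (fun x => f x + g x) = Ib f + Ib g.
Proof. by move=> bf bg; apply: RintegralD; [exact: measurable_boxpi | exact: integrable_boxpi..]. Qed.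

Lemma IbZ (c : R) (g : T2 -> R) : bmeas g -> Ib (fun x => c * g x) = c * Ib g.
Proof. by move=> bg; apply: RintegralZl; [exact: measurable_boxpi | exact: integrable_boxpi]. Qed.

Lemma Ib_cst (c : R) : Ib (fun _ => c) = c * (2 * pi) ^+ 2.
Proof. by rewrite Rintegral_cst; [congr (_ * _); rewrite [X in fine X]leb2_boxpi | exact: measurable_boxpi]. Qed.

Lemma Ib_bound (g : T2 -> R) e : bmeas g -> (forall x, `|g x| <= e) -> `|Ib g| <= e * (2 * pi) ^+ 2.
Proof.
move=> bg ge; rewrite -Ib_cst; apply: le_trans (le_normr_Rintegral measurable_boxpi (integrable_boxpi bg)) _.
apply: le_Rintegral; [exact: measurable_boxpi | | | by move=> x _; exact: ge].
- apply: (integrable_boxpi (g := fun x => `|g x|)); case: bg => mg [M gM]; split.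
    exact: measurableT_comp.
  by exists M => x; rewrite normr_id.
- by apply: (integrable_boxpi (g := fun _ => e)); exact: bmeas_cst.
Qed.

Definition coscos (a b : nat) (x : R * R) : R := cos (a%:R * x.1) * cos (b%:R * x.2).

Lemma bmeas_fst (g : T1 -> R) : bmeas g -> bmeas (fun x : T2 => g x.1).
Proof. by move=> bg; apply: (bmeas_comp (f := g) (g := fst)) => //; exact: measurable_fst. Qed.

Lemma bmeas_snd (g : T1 -> R) : bmeas g -> bmeas (fun x : T2 => g x.2).
Proof. by move=> bg; apply: (bmeas_comp (f := g) (g := snd)) => //; exact: measurable_snd. Qed.

Lemma bmeas_coscos a b : @bmeas _ T2 (coscos a b).
Proof.
by apply: bmeasM; [apply: (@bmeas_fst (fun x => cos (_ * x))) |
  apply: (@bmeas_snd (fun x => cos (_ * x)))]; exact: bmeas_cos.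
Qed.

Lemma bmeas_cos2 (a b : R) : @bmeas _ T2 (fun x => cos (a * x.1 + b * x.2)).
Proof.
under [X in bmeas X]eq_fun do rewrite cosD -mulN1r mulrA.
apply: bmeasD; [|apply: bmeasM; [apply: bmeasM; first exact: bmeas_cst|]].
- apply: bmeasM; first by apply: (@bmeas_fst (fun x => cos (_ * x))); exact: bmeas_cos.
  by apply: (@bmeas_snd (fun x => cos (_ * x))); exact: bmeas_cos.
- by apply: (@bmeas_fst (fun x => sin (_ * x))); exact: bmeas_sin.
- by apply: (@bmeas_snd (fun x => sin (_ * x))); exact: bmeas_sin.
Qed.

Lemma bmeas_sin2 (a b : R) : @bmeas _ T2 (fun x => sin (a * x.1 + b * x.2)).
Proof.
under [X in bmeas X]eq_fun do rewrite sinD.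
apply: bmeasD; apply: bmeasM.
- by apply: (@bmeas_fst (fun x => sin (_ * x))); exact: bmeas_sin.
- by apply: (@bmeas_snd (fun x => cos (_ * x))); exact: bmeas_cos.
- by apply: (@bmeas_fst (fun x => cos (_ * x))); exact: bmeas_cos.
- by apply: (@bmeas_snd (fun x => sin (_ * x))); exact: bmeas_sin.
Qed.

Definition fre (g : R * R -> R) (m1 m2 : int) : R :=
  ((2 * pi) ^+ 2)^-1 * Ib (fun x => g x * cos (m1%:~R * x.1 + m2%:~R * x.2)).
Definition fim (g : R * R -> R) (m1 m2 : int) : R :=
  ((2 * pi) ^+ 2)^-1 * Ib (fun x => g x * sin (m1%:~R * x.1 + m2%:~R * x.2)).

Lemma fourierE (g : T2 -> R) m1 m2 : bmeas g ->
  fourier (fun x => (g x)%:C) m1 m2 = fre g m1 m2 -i* fim g m1 m2.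
Proof.
move=> bg; rewrite /fourier /cintegral /fre /fim /expi.
have -> : Ib (fun x => complex.Re ((g x)%:C * (cos (- (m1%:~R * x.1 + m2%:~R * x.2)) +i* sin (- (m1%:~R * x.1 + m2%:~R * x.2))))) =
   Ib (fun x => g x * cos (m1%:~R * x.1 + m2%:~R * x.2)).
  by apply: eq_Rintegral => x _ /=; rewrite mul0r subr0 cosN.
have -> : Ib (fun x => complex.Im ((g x)%:C * (cos (- (m1%:~R * x.1 + m2%:~R * x.2)) +i* sin (- (m1%:~R * x.1 + m2%:~R * x.2))))) =
   - Ib (fun x => g x * sin (m1%:~R * x.1 + m2%:~R * x.2)).
  rewrite -mulN1r -IbZ; last by apply: bmeasM => //; exact: bmeas_sin2.
  by apply: eq_Rintegral => x _ /=; rewrite mul0r addr0 sinN mulrN mulN1r.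
by apply/eqP; rewrite eq_complex /= !mul0r subr0 addr0 mulrN !eqxx.
Qed.

Lemma mean_pi_cst (c : R) : ((2 * pi) ^+ 2)^-1 * (c * (2 * pi) ^+ 2) = c.
Proof. by rewrite mulrCA mulVf ?mulr1 // expf_neq0 // mulf_neq0 // gt_eqF ?pi_gt0. Qed.

Lemma freD f g m1 m2 : @bmeas _ T2 f -> @bmeas _ T2 g ->
  fre (fun x => f x + g x) m1 m2 = fre f m1 m2 + fre g m1 m2.
Proof.
move=> bf bg; rewrite /fre -mulrDr -IbD; first last.
- by apply: bmeasM => //; exact: bmeas_cos2.
- by apply: bmeasM => //; exact: bmeas_cos2.
by congr (_ * _); apply: eq_Rintegral => x _; rewrite mulrDl.
Qed.

Lemma freZ c g m1 m2 : @bmeas _ T2 g -> fre (fun x => c * g x) m1 m2 = c * fre g m1 m2.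
Proof.
move=> bg; rewrite /fre mulrCA -(IbZ c); last by apply: bmeasM => //; exact: bmeas_cos2.
by congr (_ * _); apply: eq_Rintegral => x _; rewrite mulrA.
Qed.

Lemma fimD f g m1 m2 : @bmeas _ T2 f -> @bmeas _ T2 g ->
  fim (fun x => f x + g x) m1 m2 = fim f m1 m2 + fim g m1 m2.
Proof.
move=> bf bg; rewrite /fim -mulrDr -IbD; first last.
- by apply: bmeasM => //; exact: bmeas_sin2.
- by apply: bmeasM => //; exact: bmeas_sin2.
by congr (_ * _); apply: eq_Rintegral => x _; rewrite mulrDl.
Qed.

Lemma fimZ c g m1 m2 : @bmeas _ T2 g -> fim (fun x => c * g x) m1 m2 = c * fim g m1 m2.
Proof.
move=> bg; rewrite /fim mulrCA -(IbZ c); last by apply: bmeasM => //; exact: bmeas_sin2.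
by congr (_ * _); apply: eq_Rintegral => x _; rewrite mulrA.
Qed.

Lemma fre_bound g m1 m2 e : @bmeas _ T2 g -> (forall x, `|g x| <= e) -> `|fre g m1 m2| <= e.
Proof.
move=> bg ge; rewrite /fre normrM ger0_norm ?invr_ge0 ?sqr_ge0 // -[leRHS]mean_pi_cst.
rewrite ler_wpM2l ?invr_ge0 ?sqr_ge0 // Ib_bound //; first by apply: bmeasM => //; exact: bmeas_cos2.
by move=> x; rewrite normrM -[leRHS]mulr1 ler_pM // cos_max.
Qed.

Lemma fim_bound g m1 m2 e : @bmeas _ T2 g -> (forall x, `|g x| <= e) -> `|fim g m1 m2| <= e.
Proof.
move=> bg ge; rewrite /fim normrM ger0_norm ?invr_ge0 ?sqr_ge0 // -[leRHS]mean_pi_cst.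
rewrite ler_wpM2l ?invr_ge0 ?sqr_ge0 // Ib_bound //; first by apply: bmeasM => //; exact: bmeas_sin2.
by move=> x; rewrite normrM -[leRHS]mulr1 ler_pM // sin_max.
Qed.

Local Notation J g := (\int[mu]_(x in II) g x).

Lemma int_coscos (a : nat) (m : int) :
  J (fun x => cos (a%:R * x) * cos (m%:~R * x)) =
  pi * ((a%:Z == m)%:R + (a%:Z == - m)%:R).
Proof.
have E x : cos (a%:R * x) * cos (m%:~R * x) =
  2^-1 * cos ((a%:Z - m)%:~R * x) + 2^-1 * cos ((a%:Z + m)%:~R * x) :> R.
  by rewrite intrB intrD mulrBl mulrDl cosB cosD -[a%:~R]/(a%:R); field.
under eq_Rintegral do rewrite E.
have bc (k : int) : mu.-integrable II (EFin \o (fun x => cos (k%:~R * x))).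
  by apply: (integrable_II (g := fun x => cos (k%:~R * x))); exact: bmeas_cos.
have bcz (k : int) : mu.-integrable II (EFin \o (fun x => 2^-1 * cos (k%:~R * x))).
  apply: (integrable_II (g := fun x => 2^-1 * cos (k%:~R * x))).
  by apply: bmeasM; [exact: bmeas_cst | exact: bmeas_cos].
rewrite RintegralD; [|exact: measurable_II|exact: bcz..].
rewrite !RintegralZl; [|exact: measurable_II|exact: bc|exact: measurable_II|exact: bc].
rewrite !int_cos subr_eq0 addr_eq0.
by case: eqP; case: eqP => _ _ /=; field.
Qed.

Lemma int_cossin (a : nat) (m : int) :
  J (fun x => cos (a%:R * x) * sin (m%:~R * x)) = 0.
Proof.
have E x : cos (a%:R * x) * sin (m%:~R * x) =
  2^-1 * sin ((m - a%:Z)%:~R * x) + 2^-1 * sin ((m + a%:Z)%:~R * x) :> R.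
  by rewrite intrB intrD mulrBl mulrDl sinB sinD -[a%:~R]/(a%:R); field.
under eq_Rintegral do rewrite E.
have bc (k : int) : mu.-integrable II (EFin \o (fun x => sin (k%:~R * x))).
  by apply: (integrable_II (g := fun x => sin (k%:~R * x))); exact: bmeas_sin.
have bcz (k : int) : mu.-integrable II (EFin \o (fun x => 2^-1 * sin (k%:~R * x))).
  apply: (integrable_II (g := fun x => 2^-1 * sin (k%:~R * x))).
  by apply: bmeasM; [exact: bmeas_cst | exact: bmeas_sin].
rewrite RintegralD; [|exact: measurable_II|exact: bcz..].
rewrite !RintegralZl; [|exact: measurable_II|exact: bc|exact: measurable_II|exact: bc].
by rewrite !int_sin !mulr0 addr0.
Qed.

(** The m-th Fourier coefficient of cos (a x) in one variable. Both deltas hold exactly when a = m =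
    0, which gives the value 1 there. *)
Definition half_delta (a : nat) (m : int) : R := 2^-1 * ((a%:Z == m)%:R + (a%:Z == - m)%:R).

Lemma bmeas_cos_cos (a : nat) (m : int) : @bmeas _ T1 (fun x => cos (a%:R * x) * cos (m%:~R * x)).
Proof. by apply: bmeasM; exact: bmeas_cos. Qed.
Lemma bmeas_cos_sin (a : nat) (m : int) : @bmeas _ T1 (fun x => cos (a%:R * x) * sin (m%:~R * x)).
Proof. by apply: bmeasM; [exact: bmeas_cos | exact: bmeas_sin]. Qed.

Lemma fre_coscos a b m1 m2 : fre (coscos a b) m1 m2 = half_delta a m1 * half_delta b m2.
Proof.
rewrite /fre.
have E x : coscos a b x * cos (m1%:~R * x.1 + m2%:~R * x.2) =
  (cos (a%:R * x.1) * cos (m1%:~R * x.1)) * (cos (b%:R * x.2) * cos (m2%:~R * x.2)) +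
  (-1) * ((cos (a%:R * x.1) * sin (m1%:~R * x.1)) * (cos (b%:R * x.2) * sin (m2%:~R * x.2))) :> R.
  by rewrite cosD /coscos; ring.
under eq_Rintegral do rewrite E.
have b1 : bmeas (fun x : T2 => (cos (a%:R * x.1) * cos (m1%:~R * x.1)) * (cos (b%:R * x.2) * cos (m2%:~R * x.2))).
  apply: bmeasM; first exact: (bmeas_fst (bmeas_cos_cos a m1)).
  exact: (bmeas_snd (bmeas_cos_cos b m2)).
have b2 : bmeas (fun x : T2 => (cos (a%:R * x.1) * sin (m1%:~R * x.1)) * (cos (b%:R * x.2) * sin (m2%:~R * x.2))).
  apply: bmeasM; first exact: (bmeas_fst (bmeas_cos_sin a m1)).
  exact: (bmeas_snd (bmeas_cos_sin b m2)).
rewrite IbD //; last by apply: bmeasM => //; exact: bmeas_cst.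
rewrite IbZ // (Ib_prod (bmeas_cos_cos a m1) (bmeas_cos_cos b m2)) (Ib_prod (bmeas_cos_sin a m1) (bmeas_cos_sin b m2)).
rewrite !int_coscos !int_cossin mulr0 mulr0 addr0 /half_delta.
have p0 : (pi : R) != 0 by rewrite gt_eqF ?pi_gt0.
by move: (pi : R) p0 => p p0; field.
Qed.

Lemma fim_coscos a b m1 m2 : fim (coscos a b) m1 m2 = 0.
Proof.
rewrite /fim.
have E x : coscos a b x * sin (m1%:~R * x.1 + m2%:~R * x.2) =
  (cos (a%:R * x.1) * sin (m1%:~R * x.1)) * (cos (b%:R * x.2) * cos (m2%:~R * x.2)) +
  ((cos (a%:R * x.1) * cos (m1%:~R * x.1)) * (cos (b%:R * x.2) * sin (m2%:~R * x.2))) :> R.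
  by rewrite sinD /coscos; ring.
under eq_Rintegral do rewrite E.
rewrite IbD; first last.
- by apply: bmeasM; [exact: (bmeas_fst (bmeas_cos_cos a m1))|exact: (bmeas_snd (bmeas_cos_sin b m2))].
- by apply: bmeasM; [exact: (bmeas_fst (bmeas_cos_sin a m1))|exact: (bmeas_snd (bmeas_cos_cos b m2))].
rewrite (Ib_prod (bmeas_cos_sin a m1) (bmeas_cos_cos b m2)) (Ib_prod (bmeas_cos_cos a m1) (bmeas_cos_sin b m2)).
by rewrite !int_cossin mulr0 mul0r addr0 mulr0.
Qed.

End Integrals.

(** * Partial sums of the binomial series *)

Section Approx.
Context {R : realType}.

Lemma ge0_derive_le (f df : R -> R) (y : R) : 0 <= y ->
  (forall x : R, 0 <= x <= y -> is_derive x 1 f (df x)) ->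
  (forall x, 0 <= x <= y -> 0 <= df x) -> f 0 <= f y.
Proof.
move=> y0 fd d0.
have [||c] := @MVT_segment R f df 0 y y0.
- by move=> x; rewrite in_itv /= => /andP[x0 xy]; apply: fd; rewrite !ltW.
- apply: continuous_in_subspaceT => x; rewrite inE /= in_itv /= => xy.
  by apply: differentiable_continuous; apply/derivable1_diffP; case: (fd x xy).
rewrite in_itv /= => cy; rewrite subr0 => E; rewrite -subr_ge0 E.
by rewrite mulr_ge0 // d0.
Qed.

Context (s : R).
Context (s01 : 2^-1 <= s < 1).

(* (1 - y)^s is the sum 1 - \sum_i bincoef i * y^(i+1), and tailp M is the value at y = 1
   of its partial sum powpoly M. *)
Fixpoint tailp (n : nat) : R := if n is m.+1 then tailp m * (1 - s / n%:R) else 1.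
Definition bincoef (n : nat) : R := tailp n * s / n.+1%:R.

Lemma tailpS n : tailp n.+1 = tailp n - bincoef n.
Proof. by rewrite /= /bincoef mulrBr mulr1 mulrA. Qed.

Lemma tailp_ge0 n : 0 <= tailp n.
Proof.
elim: n => [|n IH] /=; first exact: ler01.
rewrite mulr_ge0 // subr_ge0 ler_pdivrMr ?mul1r ?ltr0Sn //.
have : 1 <= n.+1%:R :> R by rewrite ler1n.
by move: s01; lra.
Qed.

Lemma bincoef_ge0 n : 0 <= bincoef n.
Proof. by rewrite /bincoef !mulr_ge0 ?invr_ge0 ?ler0n ?tailp_ge0 //; move: s01; lra. Qed.

(** The product of the 1 - s / k decays like n^-s, and s >= 1/2. Squaring avoids roots: the
    induction step reduces to (1 - 1 / (2 x))^2 <= x / (x + 1) at x = n + 1. *)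
Lemma tailp_sqr n : tailp n ^+ 2 <= n.+1%:R^-1.
Proof.
elim: n => [|n IH] /=; first by rewrite expr1n invr1.
rewrite exprMn.
have n0 : 0 < n.+1%:R :> R by rewrite ltr0Sn.
have h : (1 - s / n.+1%:R) ^+ 2 <= n.+1%:R / n.+2%:R.
  have a1 : 0 <= 1 - s / n.+1%:R <= 1 - 2^-1 / n.+1%:R.
    case/andP: s01 => sa sb; rewrite subr_ge0 ler_pdivrMr // mul1r lerD2l lerN2 ler_pM2r ?invr_gt0 //.
    have h1 : 1 <= n.+1%:R :> R by rewrite ler1n.
    by rewrite sa andbT (le_trans (ltW sb)).
  apply: (@le_trans _ _ ((1 - 2^-1 / n.+1%:R) ^+ 2)).
    by rewrite ler_sqr ?nnegrE; case/andP: a1 => [u v] //; rewrite (le_trans u v).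
  rewrite ler_pdivlMr ?ltr0Sn // -(natr1 n.+1).
  move: n0; have : 1 <= n.+1%:R :> R by rewrite ler1n.
  move: (n.+1%:R) => x x1 x0.
  have -> : (1 - 2^-1 / x) ^+ 2 * (x + 1) = x - (3 * x - 1) / (4 * x ^+ 2).
    by field; rewrite gt_eqF.
  by rewrite gerBl divr_ge0 //; [lra | rewrite mulr_ge0 ?sqr_ge0].
apply: le_trans (ler_pM (sqr_ge0 _) (sqr_ge0 _) IH h) _.
by rewrite mulrA mulVf ?mul1r ?gt_eqF.
Qed.

Local Arguments tailp : simpl never.

Lemma tailp_cvg e : 0 < e -> exists M, forall n, (M <= n)%N -> tailp n <= e.
Proof.
move=> e0; have e2 : 0 < (e ^+ 2)^-1 by rewrite invr_gt0 exprn_gt0.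
exists (Num.bound ((e ^+ 2)^-1)) => n Mn.
rewrite -ler_sqr ?nnegrE ?tailp_ge0 ?(ltW e0) //.
apply: le_trans (tailp_sqr n) _.
rewrite -[leRHS]invrK lef_pV2 ?posrE ?ltr0Sn //.
apply/ltW/(lt_le_trans (archi_boundP (ltW e2))).
by rewrite ler_nat ltnW.
Qed.

Definition powpoly (M : nat) : {poly R} := 1 - \sum_(i < M) bincoef i *: 'X^(i.+1).

Lemma powpolyS M : powpoly M.+1 = powpoly M - bincoef M *: 'X^(M.+1).
Proof. by rewrite /powpoly big_ord_recr /= opprD addrA. Qed.

(* Up to the remainder on the right, powpoly M solves the equation
   (1 - y) f' + s f = 0 of f = (1 - y)^s. *)
Lemma powpoly_ode M y : (1 - y) * (powpoly M)^`().[y] + s * (powpoly M).[y] = s * tailp M * y ^+ M.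
Proof.
elim: M => [|M IH].
  by rewrite /powpoly big_ord0 subr0 derivC !hornerE; ring.
have bM : s * tailp M = M.+1%:R * bincoef M.
  by rewrite /bincoef; field; rewrite nat1r pnatr_eq0.
rewrite powpolyS tailpS; move: (powpoly M) IH => G IH.
rewrite derivB derivZ derivXn succnK !(hornerD, hornerN, hornerZ, hornerMn, hornerXn).
have -> : (1 - y) * (G^`().[y] - bincoef M * (y ^+ M *+ M.+1)) + s * (G.[y] - bincoef M * y ^+ M.+1)
  = ((1 - y) * G^`().[y] + s * G.[y]) - (1 - y) * (M.+1%:R * bincoef M) * y ^+ M - s * bincoef M * y ^+ M.+1.
  by rewrite -mulr_natr; ring.
by rewrite IH -bM exprS; ring.
Qed.

Lemma powpoly1 M : (powpoly M).[1] = tailp M.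
Proof.
elim: M => [|M IH]; first by rewrite /powpoly big_ord0 subr0 hornerE.
by rewrite powpolyS tailpS -IH; move: (powpoly M) => G; rewrite !hornerE expr1n mulr1.
Qed.

Lemma powpoly0 M : (powpoly M).[0] = 1.
Proof.
elim: M => [|M IH]; first by rewrite /powpoly big_ord0 subr0 hornerE.
by rewrite powpolyS -[RHS]IH; move: (powpoly M) => G; rewrite !hornerE expr0n mulr0 subr0.
Qed.

Lemma is_derive_horner (p : {poly R}) (x : R) :
  is_derive x 1 (fun y => p.[y]) p^`().[x].
Proof.
elim/poly_ind: p => [|p c IH].
  rewrite deriv0 horner0 (_ : (fun y => _) = cst 0); first exact: is_derive_cst.
  by apply/funext => y; rewrite horner0.
rewrite derivD derivM derivX derivC addr0 mulr1 hornerD hornerM hornerX.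
have -> : (fun y => (p * 'X + c%:P).[y]) = (fun y => p.[y]) * id + cst c :> (R -> R).
  by apply/funext => y; rewrite !hornerE.
by apply: is_derive_eq; rewrite /GRing.scale /= addr0 mulr1 addrC mulrC.
Qed.

Lemma is_derive_1my (a x : R) : x < 1 ->
  is_derive x 1 (fun y => (1 - y) `^ a) (- (a * (1 - x) `^ (a - 1))).
Proof.
move=> x1; have x0 : 0 < 1 - x by rewrite subr_gt0.
have d1 := is_derive1_powR a x0.
have d2 : is_derive x 1 (fun y : R => 1 - y) (-1).
  by apply: is_derive_eq; rewrite add0r mul1r.
have := @is_derive1_comp _ (fun u : R => u `^ a) (fun y : R => 1 - y) x _ _ d1 d2.
by rewrite mulrN1.
Qed.

(** After division by (1 - y)^s the polynomial starts from 1 at y = 0, and by [powpoly_ode] its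
    derivative is (1 - x)^(-s-1) s [tailp M] x^M, which is nonnegative. The point y = 1 is treated
    apart, the quotient being singular there. *)
Lemma powpoly_lb M (y : R) : 0 <= y <= 1 -> (1 - y) `^ s <= (powpoly M).[y].
Proof.
move=> /andP[y0]; rewrite le_eqVlt => /predU1P[->|y1].
  by rewrite subrr powR0 ?powpoly1 ?tailp_ge0 //; move: s01; lra.
pose f (x : R) := (powpoly M).[x] * (1 - x) `^ (- s).
have := @ge0_derive_le f (fun x => (1 - x) `^ (- s - 1) * (s * tailp M * x ^+ M)) y y0.
rewrite /f powpoly0 subr0 powR1 mulr1.
have p0 : 0 < (1 - y) `^ s by rewrite powR_gt0 // subr_gt0.
rewrite powRN => H; rewrite -[leLHS]mul1r -ler_pdivlMr //; apply: H.
- move=> x /andP[x0 xy]; have x1 : 1 - x != 0 by rewrite subr_eq0 eq_sym lt_eqF // (le_lt_trans xy).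
  have h1 := is_derive_horner (powpoly M) x.
  have h2 := is_derive_1my (- s) (le_lt_trans xy y1).
  apply: is_derive_eq; rewrite /GRing.scale /= -powpoly_ode.
  rewrite (_ : (1 - x) `^ (- s) = (1 - x) `^ (- s - 1) * (1 - x)); last first.
    by rewrite -{3}[1 - x]powRr1 ?subr_ge0 ?(le_trans xy (ltW y1)) // -powRD ?subrK // x1 implybT.
  by ring.
- move=> x /andP[x0 xy]; rewrite mulr_ge0 ?powR_ge0 // !mulr_ge0 ?tailp_ge0 ?exprn_ge0 //.
  by move: s01; lra.
Qed.

(** The sharper error [tailp M] y^M is what the differential equation yields: the quotient of
    [tailp M] y^M - [powpoly M] by (1 - y)^s is -1 at 0 when M > 0, and has the nonnegative
    derivative (1 - x)^(-s) M [tailp M] x^(M-1). *)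
Lemma powpoly_ub M (y : R) : 0 <= y <= 1 -> (powpoly M).[y] <= (1 - y) `^ s + tailp M.
Proof.
move=> /andP[y0]; rewrite le_eqVlt => /predU1P[->|y1].
  by rewrite powpoly1 lerDr powR_ge0.
suff: (powpoly M).[y] <= (1 - y) `^ s + tailp M * y ^+ M.
  move=> /le_trans; apply; rewrite lerD2l -[leRHS]mulr1 ler_wpM2l ?tailp_ge0 //.
  by rewrite exprn_ile1 // ltW.
case: M => [|M]; first by rewrite /powpoly big_ord0 subr0 hornerE /= mulr1 lerDr powR_ge0.
pose f (x : R) := (tailp M.+1 * x ^+ M.+1 - (powpoly M.+1).[x]) * (1 - x) `^ (- s).
have := @ge0_derive_le f (fun x => (1 - x) `^ (- s) * (M.+1%:R * tailp M.+1 * x ^+ M)) y y0.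
rewrite /f powpoly0 subr0 powR1 mulr1 expr0n mulr0 sub0r.
have p0 : 0 < (1 - y) `^ s by rewrite powR_gt0 // subr_gt0.
rewrite powRN ler_pdivlMr // mulN1r => H; suff: - (1 - y) `^ s <= tailp M.+1 * y ^+ M.+1 - (powpoly M.+1).[y] by lra.
apply: H.
- move=> x /andP[x0 xy]; have x1 : 1 - x != 0 by rewrite subr_eq0 eq_sym lt_eqF // (le_lt_trans xy).
  have h1 := is_derive_horner (tailp M.+1 *: 'X^(M.+1) - powpoly M.+1) x.
  have h2 := is_derive_1my (- s) (le_lt_trans xy y1).
  have -> : (fun x0 : R => (tailp M.+1 * x0 ^+ M.+1 - (powpoly M.+1).[x0]) * (1 - x0) `^ (- s)) =
     (fun x0 => (tailp M.+1 *: 'X^(M.+1) - powpoly M.+1).[x0]) * (fun x0 => (1 - x0) `^ (- s)) :> (R -> R).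
    apply/funext => z; transitivity ((tailp M.+1 *: 'X^(M.+1) - powpoly M.+1).[z] * (1 - z) `^ (- s)) => //.
    by move: (powpoly M.+1) => G; congr (_ * _); rewrite hornerD hornerN hornerZ hornerXn.
  apply: is_derive_eq; rewrite /GRing.scale /=.
  have := powpoly_ode M.+1 x; move: (powpoly M.+1) => G ode.
  rewrite derivB derivZ derivXn succnK !(hornerD, hornerN, hornerZ, hornerMn, hornerXn).
  rewrite (_ : (1 - x) `^ (- s) = (1 - x) `^ (- s - 1) * (1 - x)); last first.
    by rewrite -{3}[1 - x]powRr1 ?subr_ge0 ?(le_trans xy (ltW y1)) // -powRD ?subrK // x1 implybT.
  have E : (1 - x) * G^`().[x] = s * tailp M.+1 * x ^+ M.+1 - s * G.[x] by rewrite -ode; ring.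
  rewrite -mulr_natr; move: (tailp M.+1) E => p E; set w := _ `^ _; set g' := _.[x] in E *.
  transitivity (w * (s * p * x ^+ M.+1 - s * G.[x] - (1 - x) * g') + w * (1 - x) * (M.+1%:R * p * x ^+ M)); first by ring.
  by rewrite E; ring.
- move=> x /andP[x0 xy]; apply: mulr_ge0; first exact: powR_ge0.
  by apply: mulr_ge0; [apply: mulr_ge0; [exact: ler0n | exact: tailp_ge0] | exact: exprn_ge0].
Qed.

End Approx.

(** * Bernstein approximation *)

Section Bernstein.
Context {R : realType}.

(** The Bernstein polynomial with coefficients [a 0], ..., [a N], by de Casteljau's recursion;
    linearity, positivity and the second moment become plain inductions on N. *)
Fixpoint bern (N : nat) (a : nat -> R) : {poly R} :=
  if N is m.+1 then (1 - 'X) * bern m a + 'X * bern m (a \o succn)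
  else (a 0%N)%:P.

Lemma bernE N a (y : R) : (bern N.+1 a).[y] = (1 - y) * (bern N a).[y] + y * (bern N (a \o succn)).[y].
Proof. by rewrite /= hornerD !hornerM hornerD hornerN hornerX hornerC. Qed.

Lemma bern_cst N (c y : R) : (bern N (fun=> c)).[y] = c.
Proof.
elim: N => [|N IH]; first by rewrite hornerC.
by rewrite bernE (_ : _ \o _ = fun=> c) // IH; ring.
Qed.

Lemma bernD N a b (y : R) : (bern N (fun i => a i + b i)).[y] = (bern N a).[y] + (bern N b).[y].
Proof.
elim: N a b => [|N IH] a b; first by rewrite !hornerC.
by rewrite !bernE (_ : _ \o succn = (fun i => (a \o succn) i + (b \o succn) i)) // !IH; ring.
Qed.

Lemma bernZ N c a (y : R) : (bern N (fun i => c * a i)).[y] = c * (bern N a).[y].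
Proof.
elim: N a => [|N IH] a; first by rewrite !hornerC.
by rewrite !bernE (_ : _ \o succn = (fun i => c * (a \o succn) i)) // !IH; ring.
Qed.

Lemma bern_ge0 N a (y : R) : 0 <= y <= 1 -> (forall i, (i <= N)%N -> 0 <= a i) ->
  0 <= (bern N a).[y].
Proof.
move=> /andP[y0 y1]; elim: N a => [|N IH] a a0; first by rewrite hornerC a0.
rewrite bernE addr_ge0 // mulr_ge0 ?subr_ge0 //; apply: IH => i iN; apply: a0 => //.
exact: leqW.
Qed.

(** The second moment about c of a binomial law of parameters N and y: variance plus squared
    bias. *)
Lemma bern_sqr N (c y : R) :
  (bern N (fun i => (i%:R - c) ^+ 2)).[y] = N%:R * y * (1 - y) + (N%:R * y - c) ^+ 2.
Proof.
elim: N c => [|N IH] c; first by rewrite hornerC; ring.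
rewrite bernE IH (_ : _ \o succn = (fun i => (i%:R - (c - 1)) ^+ 2)); last first.
  by apply/funext => i /=; rewrite -natr1; ring.
by rewrite IH -natr1; ring.
Qed.

Lemma bernstein (f : R -> R) (B e d : R) : 0 < e -> 0 < d ->
  (forall x, 0 <= x <= 1 -> `|f x| <= B) ->
  (forall x y, 0 <= x <= 1 -> 0 <= y <= 1 -> `|x - y| < d -> `|f x - f y| <= e) ->
  exists p : {poly R}, forall y, 0 <= y <= 1 -> `|f y - p.[y]| <= 2 * e.
Proof.
move=> e0 d0 fB fd.
have B0 : 0 <= B by apply: le_trans (fB 0 _); rewrite ?lexx ?ler01.
(* Chosen so that 2 B <= K (x - y)^2 as soon as |x - y| >= d, as in Chebyshev's inequality; N then
   makes the variance term K y (1 - y) / N at most e. *)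
pose K := 2 * B / d ^+ 2.
have K0 : 0 <= K by rewrite divr_ge0 ?sqr_ge0 // mulr_ge0.
pose N := (Num.bound (K / e)).+1.
have N0 : 0 < N%:R :> R by rewrite ltr0Sn.
have KN : K / N%:R <= e.
  rewrite ler_pdivrMr // -ler_pdivrMl // mulrC; apply/ltW.
  apply: lt_le_trans (archi_boundP _) _; first by rewrite divr_ge0 // ltW.
  by rewrite ler_nat leqnSn.
exists (bern N (fun i => f (i%:R / N%:R))) => y y01.
have key x : 0 <= x <= 1 -> `|f x - f y| <= e + K * (x - y) ^+ 2.
  move=> x01; have [xy|xy] := ltP `|x - y| d.
    by apply: le_trans (fd _ _ x01 y01 xy) _; rewrite lerDl mulr_ge0 ?sqr_ge0.
  apply: (@le_trans _ _ (2 * B)).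
    apply: le_trans (ler_normB _ _) _; rewrite mulr2n mulrDl mul1r.
    by rewrite lerD ?fB.
  apply: (@le_trans _ _ (K * (x - y) ^+ 2)); last by rewrite lerDr ltW.
  rewrite -[X in _ <= _ * X]real_normK ?num_real // /K mulrAC ler_pdivlMr ?exprn_gt0 //.
  by rewrite ler_wpM2l ?mulr_ge0 // ler_sqr ?nnegrE ?(ltW d0) ?normr_ge0.
pose E := (bern N (fun i => e + K / N%:R ^+ 2 * (i%:R - N%:R * y) ^+ 2)).[y].
have EE : E <= 2 * e.
  rewrite /E bernD bern_cst bernZ bern_sqr subrr expr0n addr0.
  have -> : K / N%:R ^+ 2 * (N%:R * y * (1 - y)) = (K / N%:R) * (y * (1 - y)).
    by field; rewrite gt_eqF.
  rewrite mulr2n mulrDl mul1r lerD2l; apply: le_trans KN.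
  by rewrite ler_piMr ?divr_ge0 ?ler0n //; move: y01; nra.
have kN i : (i <= N)%N -> `|f (i%:R / N%:R) - f y| <= e + K / N%:R ^+ 2 * (i%:R - N%:R * y) ^+ 2.
  move=> iN; apply: le_trans (key _ _) _.
    by rewrite divr_ge0 ?ler0n //= ler_pdivrMr // mul1r ler_nat.
  rewrite lerD2l le_eqVlt; apply/orP; left; apply/eqP.
  by field; rewrite gt_eqF.
apply: le_trans EE; rewrite ler_norml.
(* Positivity of the Bernstein operator is applied to the majorant plus and minus the difference,
   one sign in [g1] and the other in [g2]. *)
have g1 : 0 <= (bern N (fun i => (e + K / N%:R ^+ 2 * (i%:R - N%:R * y) ^+ 2) + ((-1) * f y + f (i%:R / N%:R)))).[y].
  apply: bern_ge0 => // i /kN; move: (f (_ / _)) (f y) (K / _ * _) => u v w; rewrite ler_norml => /andP[]; lra.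
have g2 : 0 <= (bern N (fun i => (e + K / N%:R ^+ 2 * (i%:R - N%:R * y) ^+ 2) + (f y + (-1) * f (i%:R / N%:R)))).[y].
  apply: bern_ge0 => // i /kN; move: (f (_ / _)) (f y) (K / _ * _) => u v w; rewrite ler_norml => /andP[]; lra.
pose b := bern N (fun i => f (i%:R / N%:R)).
have g1' : 0 <= E + (-1 * f y + b.[y]) by move: g1; rewrite bernD -/E bernD bern_cst.
have g2' : 0 <= E + (f y + -1 * b.[y]) by move: g2; rewrite bernD -/E bernD bern_cst bernZ.
rewrite -/b; clearbody E b; apply/andP; split; lra.
Qed.

(** Heine-Cantor with only one of the two points in the compact set. The other ranges over the whole
    space, which later lets complex eigenvalues be compared with real samples. *)
Lemma unif_cont_on (K : numFieldType) (U V : pseudoMetricType K) (f : U -> V) (A : set U) (e : K) :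
  continuous f -> compact A -> 0 < e ->
  exists2 d : K, 0 < d & forall x y, A x -> ball x d y -> ball (f x) e (f y).
Proof.
move=> fc /compact_near_coveringP Ac e0.
have e2 : 0 < e / 2 by rewrite divr_gt0.
suff : \forall d \near (0 : K)^'+, A `<=` (fun x => forall y, ball x d y -> ball (f x) e (f y)).
  move=> H; have H0 : \forall d \near (0 : K)^'+, 0 < d by exact: nbhs_right_gt.
  have [d [dP d0]] := @filter_ex _ _ _ _ (filterI H H0).
  by exists d => // x y Ax; exact: dP.
apply: Ac => x Ax.
have /cvg_ballP /(_ _ e2) := fc x.
move=> /nbhs_ballP [r /= r0 rP].
have r2 : 0 < r / 2 by rewrite divr_gt0.
exists (ball x (r / 2), [set d | d <= r / 2]) => /=.
  split; first by exact: nbhsx_ballx.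
  by apply: nbhs_right_le.
move=> [x' d] /= [xx' dr] y x'y.
rewrite [e]splitr; apply: (@ball_triangle _ _ (f x)).
  by apply/ball_sym/rP => /=; apply: le_ball xx'; rewrite ler_piMr // ?invf_le1 ?ler1n // ltW.
apply: rP; rewrite /= [r]splitr; apply: ball_triangle xx' _.
exact: le_ball x'y.
Qed.

End Bernstein.

(** * The discrete sine transform *)

Section Sine.
Context {R : realType}.
Local Notation C := R[i].

Definition node (n j : nat) : R := j.+1%:R * pi / n.+1%:R.

Lemma sin_npi (n : nat) : sin (n%:R * pi) = 0 :> R.
Proof.
elim: n => [|n IH]; first by rewrite mul0r sin0.
by rewrite -addn1 natrD mulrDl mul1r sinDpi IH oppr0.
Qed.

Lemma cos_npi (n : nat) : cos (n%:R * pi) = (-1) ^+ n :> R.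
Proof.
elim: n => [|n IH]; first by rewrite mul0r cos0.
by rewrite -addn1 natrD mulrDl mul1r cosDpi IH addn1 exprS mulN1r.
Qed.

Lemma sum_cos_tele (p : R) n :
  2 * sin (p / 2) * \sum_(j < n) cos (j.+1%:R * p) = sin (n%:R * p + p / 2) - sin (p / 2).
Proof.
elim: n => [|n IH]; first by rewrite big_ord0 mulr0 mul0r add0r subrr.
rewrite big_ord_recr /= mulrDr IH.
have -> : n%:R * p + p / 2 = n.+1%:R * p - p / 2 by rewrite -natr1; field.
by rewrite sinB sinD; ring.
Qed.

(** The Dirichlet kernel at p = k pi / (n + 1): the telescoped sum is sin (k pi - p / 2) - sin (p /
    2) = - (1 + (-1)^k) sin (p / 2), and sin (p / 2) is nonzero because 0 < p / 2 < pi. *)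
Lemma sum_cos_grid n k : (0 < k < 2 * n.+1)%N ->
  \sum_(j < n) cos (k%:R * node n j) = - ((1 + (-1) ^+ k) / 2).
Proof.
move=> /andP[k0 kn]; pose p : R := k%:R * pi / n.+1%:R.
have n0 : n.+1%:R != 0 :> R by rewrite pnatr_eq0.
have -> : \sum_(j < n) cos (k%:R * node n j) = \sum_(j < n) cos (j.+1%:R * p).
  by apply: eq_bigr => j _; congr cos; rewrite /node /p; ring.
have sp : sin (p / 2) != 0.
  rewrite gt_eqF // sin_gt0_pi //; apply/andP; split.
    by rewrite !divr_gt0 ?mulr_gt0 ?pi_gt0 ?ltr0n.
  rewrite /p -mulrA -invfM ltr_pdivrMr ?mulr_gt0 ?ltr0Sn // mulrC ltr_pM2l ?pi_gt0 //.
  by rewrite -natrM ltr_nat mulnC.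
have := sum_cos_tele p n.
have -> : n%:R * p + p / 2 = k%:R * pi - p / 2.
  rewrite /p; have -> : n%:R = n.+1%:R - 1 :> R by rewrite -natr1 addrK.
  by move: n0; set x := n.+1%:R; move: (pi : R) => q n0; field.
rewrite sinB sin_npi cos_npi mul0r sub0r => E.
apply: (mulfI sp); apply: (mulfI (_ : 2 != 0 :> R)); first by rewrite pnatr_eq0.
by rewrite mulrA E; field.
Qed.

(** Products of sines become cosines of frequencies b - a and a + b + 2. These have the same parity,
    so their sums over the grid cancel unless a = b, where the first frequency is 0 and contributes
    n. *)
Lemma sin_orth n (i l : 'I_n) :
  \sum_(j < n) sin (i.+1%:R * node n j) * sin (l.+1%:R * node n j) = (i == l)%:R * (n.+1%:R / 2).
Proof.
have main (a b : nat) : (a <= b < n)%N ->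
  \sum_(j < n) sin (a.+1%:R * node n j) * sin (b.+1%:R * node n j) = (a == b)%:R * (n.+1%:R / 2) :> R.
  move=> /andP[ab bn].
  have E (j : 'I_n) : sin (a.+1%:R * node n j) * sin (b.+1%:R * node n j) =
    2^-1 * (cos ((b - a)%N%:R * node n j) - cos ((a.+1 + b.+1)%N%:R * node n j)) :> R.
    have -> : (b - a)%N%:R = b.+1%:R - a.+1%:R :> R by rewrite -natrB // subSS.
    by rewrite natrD mulrBl mulrDl cosB cosD; field.
  under eq_bigr do rewrite E; rewrite -mulr_sumr sumrB.
  rewrite (sum_cos_grid (k := a.+1 + b.+1)); last by lia.
  have [<-|ne] := eqVneq a b.
    rewrite subnn; under eq_bigr do rewrite mul0r cos0.
    by rewrite sumr_const card_ord addnn -mul2n exprM sqrrN expr1n expr1n -[n.+1%:R]natr1 /= mul1r; field.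
  rewrite (@sum_cos_grid n (b - a)%N); last by lia.
  have -> : (-1) ^+ (a.+1 + b.+1) = (-1) ^+ (b - a) :> R.
    have -> : (a.+1 + b.+1 = (b - a) + 2 * a.+1)%N by lia.
    by rewrite exprD exprM sqrrN !expr1n mulr1.
  by rewrite mul0r subrr mulr0.
have [il|li] := leqP i l; first by rewrite main ?il //=.
under eq_bigr do rewrite mulrC.
by rewrite main ?(ltnW li) //= eq_sym.
Qed.

(** The discrete sine transform of type I, normalized to be symmetric and its own inverse. *)
Definition sine_mx (n : nat) : 'M[C]_n :=
  \matrix_(i, j) (Num.sqrt (2 / n.+1%:R) * sin (i.+1%:R * node n j))%:C.

Lemma sine_mx_sym n : (sine_mx n)^T = sine_mx n.
Proof. by apply/matrixP => i j; rewrite !mxE /node; congr (_ * sin _)%:C; ring. Qed.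

Lemma sine_mx_sqr n : sine_mx n *m sine_mx n = 1%:M.
Proof.
rewrite -{2}sine_mx_sym; apply/matrixP => i l; rewrite !mxE.
under eq_bigr do rewrite !mxE -rmorphM /=.
rewrite -rmorph_sum /= -[RHS](rmorph_nat (real_complex R)); congr (_ %:C).
transitivity ((2 / n.+1%:R) * \sum_(j < n) sin (i.+1%:R * node n j) * sin (l.+1%:R * node n j) : R).
  rewrite mulr_sumr; apply: eq_bigr => j _.
  have := @sqr_sqrtr R (2 / n.+1%:R); rewrite divr_ge0 // => /(_ isT) E.
  by rewrite -[in RHS]E; ring.
rewrite sin_orth; have [_|_] := eqVneq i l; rewrite /= ?mul0r ?mulr0 // mul1r ?mulr1n.
by field; rewrite ?nat1r ?natr1 pnatr_eq0.
Qed.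

Lemma sum_pick n (P : nat -> bool) (F : nat -> C) m :
  (forall l, (l < n)%N -> P l = (l == m)) ->
  \sum_(l < n) (P l)%:R * F l = if (m < n)%N then F m else 0.
Proof.
move=> Pm; case: ifP => mn.
  rewrite (bigD1 (Ordinal mn)) //= Pm // eqxx mul1r big1 ?addr0 // => l.
  by rewrite -val_eqE /= => lm; rewrite Pm // (negPf lm) mul0r.
rewrite big1 // => l _; rewrite Pm //; case: eqP => [E|_]; last by rewrite mul0r.
by rewrite -E ltn_ord in mn.
Qed.

Lemma sum_none n (P : nat -> bool) (F : nat -> C) :
  (forall l, (l < n)%N -> ~~ P l) -> \sum_(l < n) (P l)%:R * F l = 0.
Proof. by move=> Pm; rewrite big1 // => l _; rewrite (negPf (Pm _ _)) // mul0r. Qed.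

(** Two diagonals minus two antidiagonals, written as separate indicators so that each of the four
    sums over l picks at most one term. For k = 0 the two diagonals would coincide. *)
Lemma tauSE n k (i l : 'I_n) : (0 < k < n)%N ->
  tauS n k i l = ((l + k == i)%N%:R + (i + k == l)%N%:R - (i + l + 2 == k)%N%:R - (i + l + k == 2 * n)%N%:R) :> C.
Proof.
move=> /andP[k0 kn]; rewrite !mxE; have := ltn_ord i; have := ltn_ord l.
move: (i : nat) (l : nat) => {}i {}l ln iN.
have -> : ((`|i%:Z - l%:Z|%N == k)%:R : C) = (l + k == i)%N%:R + (i + k == l)%N%:R.
  have -> : (`|i%:Z - l%:Z|%N == k) = (l + k == i) || (i + k == l) by lia.
  have : ~~ ((l + k == i) && (i + k == l)) by lia.
  by case: (l + k == i); case: (i + k == l) => //= _; rewrite ?addr0 ?add0r.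
rewrite -[RHS]addrA -opprD; congr (_ - _).
case: ifP => h1.
  have -> : (i + l + k == 2 * n)%N = false by lia.
  by rewrite addr0.
have -> : (i + l + 2 == k)%N = false by lia.
case: ifP => h2; rewrite add0r.
  by congr (_ %:R); congr nat_of_bool; lia.
by have -> : (i + l + k == 2 * n)%N = false by lia.
Qed.

Lemma tauS0 n : tauS n 0 = 1%:M :> 'M[C]_n.
Proof.
apply/matrixP => i l; rewrite !mxE; have := ltn_ord i; have := ltn_ord l.
rewrite -val_eqE /=; move: (i : nat) (l : nat) => {}i {}l ln iN.
have -> : (`|i%:Z - l%:Z|%N == 0%N) = (i == l) by lia.
case: ifP => h1; first by rewrite addn2 subr0.
case: ifP => h2; last by rewrite subr0.
have -> : (2 * n - (i + l) == 0)%N = false by lia.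
by rewrite subr0.
Qed.

Definition cosw (k : nat) (t : R) : R := if k == 0%N then 1 else 2 * cos (k%:R * t).

(** The sine vector extends oddly through the indices 0 and n + 1, the latter because (n + 1) t is a
    multiple of pi. The Toeplitz part misses those terms of sin ((i + 1 - k) t) + sin ((i + 1 + k)
    t) whose index leaves 1, ..., n, and the Hankel correction supplies them by reflection: [lower]
    deals with the end 0, and [upper], through [odd2], with the end n + 1. *)
Lemma tauS_eig n k (i j : 'I_n) : (k < n)%N ->
  \sum_(l < n) tauS n k i l * (sin (l.+1%:R * node n j))%:C =
  (cosw k (node n j) * sin (i.+1%:R * node n j))%:C.
Proof.
move=> kn; have [->|k0] := posnP k.
  rewrite tauS0 /cosw eqxx mul1r (bigD1 i) //= mxE eqxx mul1r big1 ?addr0 // => l li.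
  by rewrite mxE eq_sym (negPf li) mul0r.
rewrite /cosw (gtn_eqF k0); set t := node n j.
pose F (l : nat) := (sin (l.+1%:R * t))%:C.
transitivity (\sum_(l < n) ((l + k == i)%N%:R * F l + (i + k == l)%N%:R * F l - (i + l + 2 == k)%N%:R * F l - (i + l + k == 2 * n)%N%:R * F l)).
  by apply: eq_bigr => l _; rewrite tauSE ?k0 // !mulrBl mulrDl.
rewrite !sumrB big_split /=.
have nt : n.+1%:R * t = j.+1%:R * pi.
  by rewrite /t /node mulrC divfK // pnatr_eq0.
have odd2 (m m' : nat) : (m + m' = 2 * n.+1)%N -> sin (m%:R * t) = - sin (m'%:R * t).
  move=> mm; have -> : m%:R * t = (j.+1 * 2)%N%:R * pi - m'%:R * t.
    have -> : m%:R = 2 * n.+1%:R - m'%:R :> R by rewrite -natrM -mm natrD addrK.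
    by rewrite mulrBl -mulrA nt natrM; ring.
  by rewrite sinB sin_npi cos_npi mul0r sub0r mulnC exprM sqrrN !expr1n mul1r.
have iN := ltn_ord i.
have lower : \sum_(l < n) (l + k == i)%N%:R * F l - \sum_(l < n) (i + l + 2 == k)%N%:R * F l
   = (sin (i.+1%:R * t - k%:R * t))%:C.
  have [ki|ik] := leqP k i.
    rewrite (@sum_pick n (fun l => l + k == i)%N F (i - k)%N); last by move=> l ln; lia.
    rewrite (@sum_none n (fun l => i + l + 2 == k)%N F); last by move=> l ln; lia.
    have -> : (i - k < n)%N by lia.
    by rewrite subr0 /F -mulrBl -natrB ?subSn // leqW.
  rewrite (@sum_none n (fun l => l + k == i)%N F); last by move=> l ln; lia.
  have [ki|ki] := eqVneq k i.+1.
    rewrite (@sum_none n (fun l => i + l + 2 == k)%N F); last by move=> l ln; lia.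
    by rewrite ki !subrr sin0.
  rewrite (@sum_pick n (fun l => i + l + 2 == k)%N F (k - i - 2)%N); last by move=> l ln; lia.
  have -> : (k - i - 2 < n)%N by lia.
  rewrite /F; have -> : ((k - i - 2).+1 = k - i.+1)%N by lia.
  by rewrite sub0r -rmorphN /= -sinN natrB // mulrBl opprB.
have upper : \sum_(l < n) (i + k == l)%N%:R * F l - \sum_(l < n) (i + l + k == 2 * n)%N%:R * F l
   = (sin (i.+1%:R * t + k%:R * t))%:C.
  have [ikn|ikn] := ltnP (i + k) n.
    rewrite (@sum_pick n (fun l => i + k == l)%N F (i + k)%N); last by move=> l ln; lia.
    rewrite (@sum_none n (fun l => i + l + k == 2 * n)%N F); last by move=> l ln; lia.
    by rewrite ikn subr0 /F -mulrDl -natrD addSn.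
  rewrite (@sum_none n (fun l => i + k == l)%N F); last by move=> l ln; lia.
  have [ikE|ikE] := eqVneq (i + k)%N n.
    rewrite (@sum_none n (fun l => i + l + k == 2 * n)%N F); last by move=> l ln; lia.
    by rewrite subrr -mulrDl -natrD addSn ikE nt sin_npi.
  rewrite (@sum_pick n (fun l => i + l + k == 2 * n)%N F (2 * n - i - k)%N); last by move=> l ln; lia.
  have -> : (2 * n - i - k < n)%N by lia.
  rewrite sub0r /F -rmorphN /= -mulrDl -natrD; congr (_ %:C).
  by rewrite (@odd2 (i.+1 + k)%N (2 * n - i - k).+1) //; lia.
have -> : forall a b c d : C, a + b - c - d = (a - c) + (b - d) by move=> *; ring.
rewrite lower upper -rmorphD /= sinB sinD; congr (_ %:C); ring.
Qed.

Lemma tauS_Q n k : (k < n)%N ->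
  tauS n k = sine_mx n *m diag_mx (\row_j (cosw k (node n j))%:C) *m sine_mx n.
Proof.
move=> kn; rewrite -[LHS]mulmx1 -sine_mx_sqr mulmxA; congr (_ *m _).
apply/matrixP => i j; rewrite mul_mx_diag !mxE.
under eq_bigr do rewrite !mxE rmorphM mulrCA.
rewrite -mulr_sumr.
have -> : \sum_(i0 < n) ((`|i%:Z - i0%:Z|%N == k)%:R -
   (if (i + i0 + 2 < n)%N then (i + i0 + 2 == k)%N%:R else if (n < i + i0)%N then (2 * n - (i + i0) == k)%N%:R else 0)) *
   (sin (i0.+1%:R * node n j))%:C = \sum_(l < n) tauS n k i l * (sin (l.+1%:R * node n j))%:C.
  by apply: eq_bigr => l _; rewrite !mxE.
rewrite tauS_eig // -!rmorphM /=; congr (_ %:C); ring.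
Qed.

End Sine.

(** * Two-level Toeplitz and tau matrices *)

Section TwoLevel.
Local Open Scope sesquilinear_scope.
Context {R : realType}.
Local Notation C := R[i].
Implicit Types c : nat -> nat -> R.

Definition sine2 n : 'M[C]_(n * n) := sine_mx n *t sine_mx n.

Lemma sine2_sym n : (sine2 n)^T = sine2 n.
Proof. by rewrite trmx_tens sine_mx_sym. Qed.

Lemma tens1 n : (1%:M : 'M[C]_n) *t (1%:M : 'M[C]_n) = 1%:M.
Proof.
apply/matrixP => i j; case: (mxtens_indexP i) => i1 i2; case: (mxtens_indexP j) => j1 j2.
rewrite tensmxE !mxE (inj_eq (can_inj (@mxtens_indexK _ _))) xpair_eqE -natrM.
by rewrite mulnb.
Qed.

Lemma sine2_sqr n : sine2 n *m sine2 n = 1%:M.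
Proof. by rewrite /sine2 tensmx_mul !sine_mx_sqr tens1. Qed.

Lemma sine2_real n : map_mx Num.conj (sine2 n) = sine2 n.
Proof. by apply/matrixP => i j; rewrite !mxE -rmorphM; exact: conjc_real. Qed.

Lemma sine2_adj n : (sine2 n)^t* = sine2 n.
Proof. by rewrite sine2_sym sine2_real. Qed.

Lemma sine2_unitary n : sine2 n \is unitarymx.
Proof. by apply/unitarymxP; rewrite sine2_adj sine2_sqr. Qed.

Lemma inv_sine2 n : invmx (sine2 n) = sine2 n.
Proof. by rewrite invmx_unitary ?sine2_unitary // sine2_adj. Qed.

Lemma diag_tens n (a b : 'I_n -> C) :
  diag_mx (\row_j a j) *t diag_mx (\row_j b j) =
  diag_mx (\row_k (a (mxtens_unindex k).1 * b (mxtens_unindex k).2)).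
Proof.
apply/matrixP => i j; case: (mxtens_indexP i) => i1 i2; case: (mxtens_indexP j) => j1 j2.
rewrite tensmxE !mxE (inj_eq (can_inj (@mxtens_indexK _ _))) xpair_eqE !mxtens_indexK /=.
by case: (i1 == j1); case: (i2 == j2); rewrite ?mulr1n ?mulr0n ?mul0r ?mulr0.
Qed.

(** The square partial sum of the Fourier series with even coefficients [c]; each [cosw] merges the
    frequencies k and -k. *)
Definition taueig n c (x1 x2 : R) : R :=
  \sum_(k1 < n) \sum_(k2 < n) c k1 k2 * (cosw k1 x1 * cosw k2 x2).

Definition grid n (j : 'I_(n * n)) : R * R :=
  (node n (mxtens_unindex j).1, node n (mxtens_unindex j).2).

Definition diagR n (d : 'I_n -> R) : 'M[C]_n := diag_mx (\row_j (d j)%:C).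

(** Defined by its sine diagonalization; [tauc_sum] identifies it with the level by level
    construction. *)
Definition tauc n c : 'M[C]_(n * n) :=
  sine2 n *m diagR (fun j => taueig n c (grid j).1 (grid j).2) *m sine2 n.

Definition toep n c : 'M[C]_(n * n) :=
  \matrix_(i, j) (c `|(mxtens_unindex i).1%:Z - (mxtens_unindex j).1%:Z|%N
                    `|(mxtens_unindex i).2%:Z - (mxtens_unindex j).2%:Z|%N)%:C.

Definition has_coefs (f : R * R -> C) c :=
  forall m1 m2 : int, fourier f m1 m2 = (c `|m1|%N `|m2|%N)%:C.

Lemma toeplitz2_toep n f c : has_coefs f c -> toeplitz2 n f = toep n c.
Proof. by move=> fc; apply/matrixP => i j; rewrite !mxE fc. Qed.

Lemma tauc_sum n c :
  \sum_(k1 < n) \sum_(k2 < n) (c k1 k2)%:C *: (tauS n k1 *t tauS n k2) = tauc n c.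
Proof.
rewrite /tauc /diagR.
have -> : diag_mx (\row_j (taueig n c (grid j).1 (grid j).2)%:C) = 
  \sum_(k1 < n) \sum_(k2 < n) (c k1 k2)%:C *: diag_mx (\row_(j < n * n) (cosw k1 (grid j).1 * cosw k2 (grid j).2)%:C).
  apply/matrixP => i j; rewrite summxE !mxE rmorph_sum -sumrMnl; apply: eq_bigr => k1 _.
  rewrite summxE rmorph_sum -sumrMnl; apply: eq_bigr => k2 _.
  by rewrite !mxE rmorphM mulrnAr.
rewrite mulmx_sumr mulmx_suml; apply: eq_bigr => k1 _.
rewrite mulmx_sumr mulmx_suml; apply: eq_bigr => k2 _.
rewrite -scalemxAr -scalemxAl; congr (_ *: _).
rewrite !tauS_Q // -!tensmx_mul; congr (_ *m _ *m _).
by rewrite diag_tens; congr diag_mx; apply/rowP => j; rewrite !mxE -rmorphM.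
Qed.

Lemma tau2_tauc n f c : has_coefs f c -> tau2 n f = tauc n c.
Proof.
move=> fc; rewrite -tauc_sum; apply: eq_bigr => k1 _; apply: eq_bigr => k2 _.
by rewrite fc.
Qed.

Definition sub_coefs c c' := fun k1 k2 => c k1 k2 - c' k1 k2 : R.

Lemma toepB n c c' : toep n (sub_coefs c c') = toep n c - toep n c'.
Proof. by apply/matrixP => i j; rewrite !mxE /sub_coefs rmorphB. Qed.

Lemma taueigB n c c' x1 x2 : taueig n (sub_coefs c c') x1 x2 = taueig n c x1 x2 - taueig n c' x1 x2.
Proof.
rewrite /taueig -sumrB; apply: eq_bigr => k1 _; rewrite -sumrB; apply: eq_bigr => k2 _.
by rewrite mulrBl.
Qed.

Lemma taucB n c c' : tauc n (sub_coefs c c') = tauc n c - tauc n c'.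
Proof.
rewrite /tauc -mulmxBl -mulmxBr; congr (_ *m _ *m _); rewrite /diagR -raddfB /=.
by congr diag_mx; apply/rowP => j; rewrite !mxE taueigB rmorphB.
Qed.

Definition weight (k : nat) : R := if k == 0%N then 1 else 2.

Lemma weight_ge1 k : 1 <= weight k.
Proof. by rewrite /weight; case: ifP => // _; lra. Qed.

Lemma cosw_weight k x : `|cosw k x| <= weight k.
Proof.
rewrite /cosw /weight; case: ifP => _; first by rewrite normr1.
by rewrite normrM ger0_norm // ler_piMr // cos_max.
Qed.

(** The l1 norm over all integer frequency pairs of modulus below n, where [weight] counts the
    signs. It controls the tau eigenvalues uniformly and the Frobenius norms of both the tau and the
    Toeplitz matrix. *)
Definition l1 n c : R := \sum_(k1 < n) \sum_(k2 < n) `|c k1 k2| * (weight k1 * weight k2).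

Lemma l1_ge0 n c : 0 <= l1 n c.
Proof.
apply: sumr_ge0 => k1 _; apply: sumr_ge0 => k2 _.
by rewrite !mulr_ge0 // (le_trans ler01) // weight_ge1.
Qed.

Lemma taueig_l1 n c x1 x2 : `|taueig n c x1 x2| <= l1 n c.
Proof.
apply: le_trans (ler_norm_sum _ _ _) _; apply: ler_sum => k1 _.
apply: le_trans (ler_norm_sum _ _ _) _; apply: ler_sum => k2 _.
by rewrite !normrM ler_wpM2l // ler_pM ?cosw_weight.
Qed.

Lemma frob2_sine2_diag n (d : 'I_(n * n) -> C) :
  frob2 (sine2 n *m diag_mx (\row_j d j) *m sine2 n) = \sum_j nrm2 (d j).
Proof.
rewrite frob2_unitaryr ?sine2_unitary // (frob2_unitaryl _ (erefl _)) ?sine2_unitary //.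
by rewrite frob2_diag; apply: eq_bigr => j _; rewrite mxE.
Qed.

Lemma frob2_tauc n c : frob2 (tauc n c) <= (l1 n c) ^+ 2 * (n * n)%:R.
Proof.
rewrite /tauc /diagR frob2_sine2_diag; apply: (@le_trans _ _ (\sum_(j < n * n) (l1 n c) ^+ 2)).
  apply: ler_sum => j _; rewrite nrm2_real -real_normK ?num_real //.
  by rewrite ler_sqr ?nnegrE ?l1_ge0 // taueig_l1.
by rewrite sumr_const card_ord mulr_natr.
Qed.

Lemma sum_le1 n (P : pred nat) :
  (forall j l, P j -> P l -> j = l) -> \sum_(j < n) (P j)%:R <= 1 :> R.
Proof.
move=> Pu; case: (pickP (fun j : 'I_n => P j)) => [j Pj|P0]; last first.
  by rewrite big1 ?ler01 // => j _; rewrite P0.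
rewrite (bigD1 j) //= Pj big1 ?addr0 // => l lj.
case Pl : (P l) => //; move: lj; rewrite -val_eqE /= (Pu _ _ Pl Pj).
by rewrite eqxx.
Qed.

Lemma sum_dist n (i : 'I_n) (g : nat -> R) : (forall k, 0 <= g k) ->
  \sum_(j < n) g `|i%:Z - j%:Z|%N <= 2 * \sum_(k < n) g k.
Proof.
move=> g0.
have E (j : 'I_n) : g `|i%:Z - j%:Z|%N = \sum_(k < n) (`|i%:Z - j%:Z|%N == k)%:R * g k.
  have h : (`|i%:Z - j%:Z| < n)%N by have := ltn_ord i; have := ltn_ord j; lia.
  rewrite (bigD1 (Ordinal h)) //= eqxx mul1r big1 ?addr0 // => k.
  by rewrite -val_eqE /= eq_sym => /negPf->; rewrite mul0r.
under eq_bigr do rewrite E; rewrite exchange_big mulr_sumr /=.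
apply: ler_sum => k _; rewrite -mulr_suml ler_wpM2r //.
apply: (@le_trans _ _ (\sum_(j < n) ((j + k == i)%N%:R + (i + k == j)%N%:R))).
  apply: ler_sum => j _; rewrite -natrD ler_nat.
  have -> : (`|i%:Z - j%:Z|%N == k) = ((j + k == i) || (i + k == j))%N by lia.
  by case: (_ == _); case: (_ == _).
rewrite big_split mulr2n /= lerD //.
  by apply: (@sum_le1 n (fun j => j + k == i)%N) => j l; lia.
by apply: (@sum_le1 n (fun j => i + k == j)%N) => j l; lia.
Qed.

Lemma sum_unindex n (g : 'I_n -> 'I_n -> R) :
  \sum_(j < n * n) g (mxtens_unindex j).1 (mxtens_unindex j).2 = \sum_(j1 < n) \sum_(j2 < n) g j1 j2.
Proof.
rewrite pair_big /= (reindex (@mxtens_unindex n n)) /=; last first.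
  exists (@mxtens_index n n) => x _; [exact: mxtens_unindexK | exact: mxtens_indexK].
by [].
Qed.

Lemma coef_le_l1 n c k1 k2 : (k1 < n)%N -> (k2 < n)%N -> `|c k1 k2| <= l1 n c.
Proof.
move=> h1 h2; rewrite /l1 (bigD1 (Ordinal h1)) //= (bigD1 (Ordinal h2)) //=.
rewrite -addrA -[leLHS]addr0 lerD ?addr_ge0 //.
- by rewrite ler_peMr // -[1]mulr1 ler_pM ?weight_ge1.
- by apply: sumr_ge0 => j _; rewrite !mulr_ge0 // (le_trans ler01) // weight_ge1.
- apply: sumr_ge0 => i _; apply: sumr_ge0 => j _.
  by rewrite !mulr_ge0 // (le_trans ler01) // weight_ge1.
Qed.

(** In each row a squared entry is at most [l1 n c] times its modulus, and a given pair of distances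
    occurs at most four times, twice per level. *)
Lemma frob2_toep n c : frob2 (toep n c) <= 4 * (l1 n c) ^+ 2 * (n * n)%:R.
Proof.
have -> : 4 * (l1 n c) ^+ 2 * (n * n)%:R = \sum_(i < n * n) (4 * (l1 n c) ^+ 2).
  by rewrite sumr_const card_ord mulr_natr.
apply: ler_sum => i _; case: (mxtens_indexP i) => i1 i2.
apply: (@le_trans _ _ (\sum_(j < n * n) l1 n c * `|c `|i1%:Z - (mxtens_unindex j).1%:Z|%N `|i2%:Z - (mxtens_unindex j).2%:Z|%N |)).
  apply: ler_sum => j _; rewrite mxE mxtens_indexK nrm2_real /= -real_normK ?num_real // expr2.
  rewrite ler_wpM2r //; have /= l1j := ltn_ord (mxtens_unindex j).1.
  have /= l2j := ltn_ord (mxtens_unindex j).2.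
  move: (j %/ n)%N (j %% n)%N l1j l2j => a b la lb; have := ltn_ord i1; have := ltn_ord i2 => h1 h2.
  by apply: coef_le_l1; lia.
rewrite -mulr_sumr expr2 mulrCA ler_wpM2l ?l1_ge0 //.
rewrite (sum_unindex (fun j1 j2 : 'I_n => `|c `|i1%:Z - j1%:Z|%N `|i2%:Z - j2%:Z|%N |)).
apply: (@le_trans _ _ (2 * \sum_(k1 < n) \sum_(j2 < n) `|c k1 `|i2%:Z - j2%:Z|%N |)).
  apply: (@sum_dist n i1 (fun k => \sum_(j2 < n) `|c k `|i2%:Z - j2%:Z|%N |)) => k.
  exact: sumr_ge0.
have -> : 4 * l1 n c = 2 * (2 * l1 n c) by ring.
rewrite ler_wpM2l // /l1 mulr_sumr; apply: ler_sum => k1 _.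
apply: le_trans (@sum_dist n i2 (fun k => `|c k1 k|) _) _; first by [].
rewrite ler_wpM2l //; apply: ler_sum => k2 _.
by rewrite ler_peMr // -[1]mulr1 ler_pM ?weight_ge1.
Qed.

(** A squared norm O(n) is negligible against the n^2 allowed by the dimension. *)
Definition frob_linear (A : forall n, 'M[C]_(n * n)) := exists K : R, forall n, frob2 (A n) <= K * n%:R.

Lemma frob_linearD A B : frob_linear A -> frob_linear B -> frob_linear (fun n => A n + B n).
Proof.
move=> [K AK] [L BL]; exists (2 * (K + L)) => n; apply: le_trans (frob2D _ _) _.
by rewrite -mulrA ler_wpM2l // mulrDl lerD.
Qed.

Lemma frob_linearZ a A : frob_linear A -> frob_linear (fun n => a *: A n).
Proof.
move=> [K AK]; exists (nrm2 a * K) => n; rewrite frob2Z -mulrA ler_wpM2l ?nrm2_ge0 //.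
Qed.

Lemma frob_linear_sum d (A : nat -> forall n, 'M[C]_(n * n)) :
  (forall k, frob_linear (A k)) -> frob_linear (fun n => \sum_(k < d) A k n).
Proof.
move=> OA; elim: d => [|d [K IH]].
  exists 0 => n; rewrite big_ord0 mul0r /frob2 big1 // => i _; rewrite big1 // => j _.
  by rewrite mxE nrm20.
have [L AL] := frob_linearD (ex_intro _ K IH) (OA d); exists L => n.
by rewrite big_ord_recr.
Qed.

Lemma frob2_tens m n p q (A : 'M[C]_(m, n)) (B : 'M[C]_(p, q)) :
  frob2 (A *t B) = frob2 A * frob2 B.
Proof.
rewrite /frob2 mulr_sum; apply: eq_bigr => i _; rewrite mulr_sum.
by apply: eq_bigr => j _; rewrite mxE nrm2M.
Qed.

Definition toepS (n k : nat) : 'M[C]_n := sym_toeplitz n (fun l => (l == k)%:R).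
Definition hankelS (n k : nat) : 'M[C]_n := tau_hankel n (fun l => (l == k)%:R).

Lemma frob2_toepS n k : frob2 (toepS n k) <= 2 * n%:R.
Proof.
have -> : 2 * n%:R = \sum_(i < n) 2 :> R by rewrite sumr_const card_ord mulr_natr.
apply: ler_sum => i _.
apply: (@le_trans _ _ (\sum_(j < n) ((j + k == i)%N%:R + (i + k == j)%N%:R))).
  apply: ler_sum => j _; rewrite mxE.
  have -> : (`|i%:Z - j%:Z|%N == k) = ((j + k == i) || (i + k == j))%N by lia.
  by case: (_ == _); case: (_ == _); rewrite /= ?nrm20 ?(nrm2_real 1) ?expr1n ?addr0 ?add0r ?lexx // lerDl.
rewrite big_split mulr2n /= lerD //.
  by apply: (@sum_le1 n (fun j => j + k == i)%N) => j l; lia.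
by apply: (@sum_le1 n (fun j => i + k == j)%N) => j l; lia.
Qed.

(** All the ones lie on two short antidiagonals in opposite corners, whose lengths depend on k and
    not on n. *)
Lemma frob2_hankelS n k : frob2 (hankelS n k) <= 2 * k%:R.
Proof.
have cnt m : \sum_(i < n) \sum_(l < k) (i + l == m)%N%:R <= k%:R :> R.
  rewrite exchange_big /= -[leRHS]mulr1 -[k in leRHS]card_ord mulr_natl -sumr_const.
  by apply: ler_sum => l _; apply: (@sum_le1 n (fun i => i + l == m)%N) => i j; lia.
have cnt' : \sum_(i < n) \sum_(l < k) (i == l :> nat)%:R <= k%:R :> R.
  rewrite exchange_big /= -[leRHS]mulr1 -[k in leRHS]card_ord mulr_natl -sumr_const.
  by apply: ler_sum => l _; apply: (@sum_le1 n (fun i => i == l)%N) => i j; lia.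
(* Row i can meet the first antidiagonal only if i < k, and the second only if i > n - k; the inner
   sums over l encode these two conditions. *)
apply: (@le_trans _ _ (\sum_(i < n) (\sum_(l < k) (i == l :> nat)%:R + \sum_(l < k) (i + l == n)%N%:R))); last first.
  by rewrite big_split /= mulr2n mulrDl mul1r lerD.
apply: ler_sum => i _.
apply: (@le_trans _ _ (\sum_(j < n) ((i + j + 2 == k)%N%:R + (i + j + k == 2 * n)%N%:R))).
  apply: ler_sum => j _; rewrite mxE; have := ltn_ord i; have := ltn_ord j => jn iN.
  case: ifP => h1.
    by case: (_ == k); rewrite ?nrm20 ?(nrm2_real 1) ?expr1n ?addr_ge0 ?ler0n // lerDl.
  case: ifP => h2; last by rewrite nrm20 addr_ge0.
  have -> : (2 * n - (i + j) == k)%N = (i + j + k == 2 * n)%N by lia.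
  by case: (_ == 2 * n)%N; rewrite ?nrm20 ?(nrm2_real 1) ?expr1n ?addr_ge0 ?ler0n // lerDr.
rewrite big_split lerD //=.
  have [ik|ki] := ltnP i k.
    apply: (@le_trans _ _ 1); first by apply: (@sum_le1 n (fun j => i + j + 2 == k)%N) => j l; lia.
    by rewrite (bigD1 (Ordinal ik)) //= eqxx lerDl sumr_ge0.
  rewrite big1 ?sumr_ge0 // => j _; have -> // : (i + j + 2 == k)%N = false by lia.
have [ik|ki] := ltnP n (i + k).
  apply: (@le_trans _ _ 1); first by apply: (@sum_le1 n (fun j => i + j + k == 2 * n)%N) => j l; lia.
  have h : (n - i < k)%N by have := ltn_ord i; lia.
  rewrite (bigD1 (Ordinal h)) //= subnKC; last by have := ltn_ord i; lia.
  by rewrite eqxx lerDl sumr_ge0.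
rewrite big1 ?sumr_ge0 // => j _.
have -> // : (i + j + k == 2 * n)%N = false by have := ltn_ord i; have := ltn_ord j; lia.
Qed.

Lemma frob2_tauS n k : frob2 (tauS n k : 'M[C]_n) <= 4 * (n + k)%:R.
Proof.
apply: le_trans (frob2D (toepS n k) (- hankelS n k)) _; rewrite frob2N natrD.
by have := frob2_toepS n k; have := frob2_hankelS n k; lra.
Qed.

(** With T = tau + H at each level the difference is T tensor H plus H tensor tau. Squared Frobenius
    norms multiply over tensor products, and each product has a factor O(1) from H and a factor
    O(n). *)
Lemma frob_linear_tens k l : frob_linear (fun n => toepS n k *t toepS n l - tauS n k *t tauS n l).
Proof.
exists (4 * l%:R * 2 + (k%:R * 2) * (8 * (1 + l)%:R)) => n.
have [->|n0] := posnP n.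
  by rewrite mulr0 /frob2 big1 // => i; have := ltn_ord i.
have -> : toepS n k *t toepS n l - tauS n k *t tauS n l = toepS n k *t hankelS n l + hankelS n k *t tauS n l.
  apply/matrixP => i j; rewrite !mxE.
  set x := _%:R; set y := _%:R; set u := (if _ then _ else _); set v := (if _ then _ else _).
  by ring.
apply: le_trans (frob2D _ _) _; rewrite !frob2_tens.
have a1 : frob2 (toepS n k) * frob2 (hankelS n l) <= (2 * n%:R) * (2 * l%:R).
  by rewrite ler_pM ?frob2_ge0 ?frob2_toepS ?frob2_hankelS.
have a2 : frob2 (hankelS n k) * frob2 (tauS n l) <= (2 * k%:R) * (4 * (n + l)%:R).
  by rewrite ler_pM ?frob2_ge0 ?frob2_tauS ?frob2_hankelS.
have a3 : (n + l)%:R <= (1 + l)%:R * n%:R :> R by rewrite -natrM ler_nat; nia.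
have a4 : (2 * k%:R) * (4 * (n + l)%:R) <= (2 * k%:R) * (4 * ((1 + l)%:R * n%:R)) :> R.
  by rewrite !ler_wpM2l ?mulr_ge0.
move: a1 a2 a4; move: (frob2 _ * _) (frob2 _ * _) ((1 + l)%:R) ((n + l)%:R) => p q r t.
by move=> *; lra.
Qed.

Definition coefs_supp d c := forall k1 k2, (d <= k1)%N || (d <= k2)%N -> c k1 k2 = 0.

Lemma sum_supp (V : nmodType) d n (F : nat -> nat -> V) : (d <= n)%N ->
  (forall k1 k2, (d <= k1)%N || (d <= k2)%N -> F k1 k2 = 0) ->
  \sum_(k1 < n) \sum_(k2 < n) F k1 k2 = \sum_(k1 < d) \sum_(k2 < d) F k1 k2.
Proof.
move=> dn F0.
have aux (G : nat -> V) : (forall k, (d <= k)%N -> G k = 0) -> \sum_(k < n) G k = \sum_(k < d) G k.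
  move=> G0; rewrite (big_ord_widen n G dn) [LHS](bigID (fun i : 'I_n => (i < d)%N)) /=.
  by rewrite [X in _ + X]big1 ?addr0 // => i; rewrite -leqNgt => /G0.
rewrite (aux (fun k1 => \sum_(k2 < n) F k1 k2)); last first.
  by move=> k dk; rewrite big1 // => j _; rewrite F0 // dk.
by apply: eq_bigr => k1 _; rewrite (aux (F k1)) // => k dk; rewrite F0 // dk orbT.
Qed.

Lemma sum_delta n (a : nat) (F : nat -> C) : (a < n)%N ->
  \sum_(k < n) F k * (a == k)%:R = F a.
Proof.
move=> h; rewrite (bigD1 (Ordinal h)) //= eqxx mulr1 big1 ?addr0 // => k.
by rewrite -val_eqE /= eq_sym => /negPf->; rewrite mulr0.
Qed.

Lemma toep_sum n c : toep n c = \sum_(k1 < n) \sum_(k2 < n) (c k1 k2)%:C *: (toepS n k1 *t toepS n k2).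
Proof.
apply/matrixP => i j; case: (mxtens_indexP i) => i1 i2; case: (mxtens_indexP j) => j1 j2.
have h1 : (`|i1%:Z - j1%:Z| < n)%N by have := ltn_ord i1; have := ltn_ord j1; lia.
have h2 : (`|i2%:Z - j2%:Z| < n)%N by have := ltn_ord i2; have := ltn_ord j2; lia.
transitivity (\sum_(k1 < n) (\sum_(k2 < n) (c k1 k2)%:C * (`|i2%:Z - j2%:Z|%N == k2)%:R) * (`|i1%:Z - j1%:Z|%N == k1)%:R).
  rewrite mxE !mxtens_indexK.
  rewrite (@sum_delta n _ (fun k1 => \sum_(k2 < n) (c k1 k2)%:C * (`|i2%:Z - j2%:Z|%N == k2)%:R)) //.
  by rewrite (@sum_delta n _ (fun k2 => (c `|i1%:Z - j1%:Z|%N k2)%:C)).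
rewrite summxE; apply: eq_bigr => k1 _; rewrite summxE mulr_suml; apply: eq_bigr => k2 _.
by rewrite mxE tensmxE !mxE; ring.
Qed.

(** Only the d^2 terms of the support enter, each with an O(n) difference; d <= n keeps the
    truncation at n from cutting the support. *)
Lemma toep_tauc_finsupp d c : coefs_supp d c ->
  exists K : R, forall n, (d <= n)%N -> frob2 (toep n c - tauc n c) <= K * n%:R.
Proof.
move=> cd.
have [K HK] : frob_linear (fun n => \sum_(k1 < d) \sum_(k2 < d) (c k1 k2)%:C *: (toepS n k1 *t toepS n k2 - tauS n k1 *t tauS n k2)).
  apply: (@frob_linear_sum d (fun k1 n => \sum_(k2 < d) (c k1 k2)%:C *: (toepS n k1 *t toepS n k2 - tauS n k1 *t tauS n k2))) => k1.
  apply: (@frob_linear_sum d (fun k2 n => (c k1 k2)%:C *: (toepS n k1 *t toepS n k2 - tauS n k1 *t tauS n k2))) => k2.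
  exact: frob_linearZ (frob_linear_tens k1 k2).
exists K => n dn; suff -> : toep n c - tauc n c = \sum_(k1 < d) \sum_(k2 < d) (c k1 k2)%:C *: (toepS n k1 *t toepS n k2 - tauS n k1 *t tauS n k2) by exact: HK.
rewrite toep_sum -tauc_sum -sumrB.
rewrite -(@sum_supp _ d n (fun k1 k2 => (c k1 k2)%:C *: (toepS n k1 *t toepS n k2 - tauS n k1 *t tauS n k2))) //; last first.
  by move=> k1 k2 /cd->; rewrite scale0r.
apply: eq_bigr => k1 _; rewrite -sumrB; apply: eq_bigr => k2 _.
by rewrite scalerBr.
Qed.

Definition l1approx c := forall e, 0 < e -> exists d c', coefs_supp d c' /\ forall n, l1 n (sub_coefs c c') <= e.

Lemma bound_nat (x : R) : exists n0, forall n, (n0 <= n)%N -> x <= n%:R.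
Proof.
exists (Num.bound `|x|) => n xn; apply: (@le_trans _ _ `|x|); first exact: ler_norm.
by apply/ltW/(lt_le_trans (archi_boundP (normr_ge0 _))); rewrite ler_nat.
Qed.

Lemma linear_le_square (K e : R) : 0 < e -> exists n0, forall n, (n0 <= n)%N -> K * n%:R <= e * (n * n)%:R.
Proof.
move=> e0; have [n0 Hn] := bound_nat (K / e); exists n0 => n /Hn.
by rewrite ler_pdivrMr // natrM mulrA (mulrC e) => h; rewrite ler_wpM2r.
Qed.

Lemma toep_tauc_small c : l1approx c -> forall e, 0 < e ->
  exists n0, forall n, (n0 <= n)%N -> frob2 (toep n c - tauc n c) <= e * (n * n)%:R.
Proof.
(* The budget: the finitely supported part gets e / 4, the remainder 2 (4 + 1) l1^2 <= 10 e / 40 = e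
   / 4, and the outer [frob2D] doubles the sum. The minimum with 1 turns l1 <= e' into l1^2 <= e /
   40. *)
move=> ca e e0; pose e' := Num.min 1 (e / 40).
have e'0 : 0 < e' by rewrite lt_min ltr01 divr_gt0.
have e'2 : e' ^+ 2 <= e / 40.
  apply: (@le_trans _ _ e'); last by rewrite ge_min lexx orbT.
  by rewrite expr2 ler_piMr ?(ltW e'0) // ge_min lexx.
have [d [c' [cd cc']]] := ca _ e'0.
have [K HK] := toep_tauc_finsupp cd.
have e40 : 0 < e / 4 by rewrite divr_gt0.
have [n0 Hn0] := linear_le_square K e40.
exists (maxn d n0) => n; rewrite geq_max => /andP[dn n0n].
have -> : toep n c - tauc n c = (toep n c' - tauc n c') + (toep n (sub_coefs c c') - tauc n (sub_coefs c c')).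
  rewrite toepB taucB; move: (toep n c) (toep n c') (tauc n c) (tauc n c') => A1 A2 A3 A4.
  by apply/matrixP => i j; rewrite !mxE; ring.
apply: le_trans (frob2D _ _) _.
have h1 := le_trans (HK n dn) (Hn0 n n0n).
have h2 := frob2D (toep n (sub_coefs c c')) (- tauc n (sub_coefs c c')).
rewrite frob2N in h2.
have h3 := frob2_toep n (sub_coefs c c'); have h4 := frob2_tauc n (sub_coefs c c').
have h5 : l1 n (sub_coefs c c') ^+ 2 <= e / 40.
  by apply: le_trans e'2; rewrite ler_sqr ?nnegrE ?l1_ge0 ?(ltW e'0).
have h6 : l1 n (sub_coefs c c') ^+ 2 * (n * n)%:R <= e / 40 * (n * n)%:R by rewrite ler_wpM2r.
have h7 : 2 * (4 * l1 n (sub_coefs c c') ^+ 2 * (n * n)%:R + l1 n (sub_coefs c c') ^+ 2 * (n * n)%:R) <=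
    e / 4 * (n * n)%:R by move: h6; lra.
have h8 := le_trans h2 (le_trans (ler_wpM2l (ler0n R 2) (lerD h3 h4)) h7).
apply: le_trans (ler_wpM2l (ler0n R 2) (lerD h1 h8)) _.
by rewrite (_ : 2 * _ = e * (n * n)%:R) //; field.
Qed.

End TwoLevel.

(** * Cosine polynomials *)

Section CosinePolynomials.
Context {R : realType}.
Local Notation C := R[i].
Local Notation T2 := (measurableTypeR R * measurableTypeR R)%type.

(* Chosen so that 4 sin^2 (x1 / 2) + 4 sin^2 (x2 / 2) = 8 (1 - yv x). *)
Definition yv (x : R * R) : R := 2^-1 + (cos x.1 + cos x.2) / 4.

Lemma yv01 x : 0 <= yv x <= 1.
Proof.
rewrite /yv; have := cos_geN1 x.1; have := cos_geN1 x.2; have := cos_le1 x.1; have := cos_le1 x.2.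
by move=> *; apply/andP; split; lra.
Qed.

Definition cospoly d (f : R * R -> R) := exists Y : nat -> nat -> R,
  (forall k1 k2, 0 <= Y k1 k2) /\ forall x, f x = \sum_(k1 < d) \sum_(k2 < d) Y k1 k2 * coscos k1 k2 x.

Lemma cospoly_eq d f g : f =1 g -> cospoly d f -> cospoly d g.
Proof. by move=> fg [Y [Y0 E]]; exists Y; split=> // x; rewrite -fg. Qed.

Lemma CP_coscos d a b : (a < d)%N -> (b < d)%N -> cospoly d (coscos a b).
Proof.
move=> ad bd; exists (fun k1 k2 => (a == k1)%:R * (b == k2)%:R); split.
  by move=> k1 k2; rewrite mulr_ge0.
move=> x; rewrite (bigD1 (Ordinal ad)) //= (bigD1 (Ordinal bd)) //= !eqxx !mul1r.
rewrite [X in _ + X + _]big1 ?addr0; last first.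
  by move=> k; rewrite -val_eqE /= eq_sym => /negPf->; rewrite mulr0 mul0r.
rewrite big1 ?addr0 // => k; rewrite -val_eqE /= eq_sym => /negPf->.
by rewrite big1 // => l _; rewrite !mul0r.
Qed.

Lemma cospolyD d f g : cospoly d f -> cospoly d g -> cospoly d (fun x => f x + g x).
Proof.
move=> [Y [Y0 EY]] [Z [Z0 EZ]]; exists (fun k1 k2 => Y k1 k2 + Z k1 k2); split.
  by move=> k1 k2; rewrite addr_ge0.
move=> x; rewrite EY EZ -big_split; apply: eq_bigr => k1 _ /=.
by rewrite -big_split; apply: eq_bigr => k2 _ /=; rewrite mulrDl.
Qed.

Lemma cospolyZ d c f : 0 <= c -> cospoly d f -> cospoly d (fun x => c * f x).
Proof.
move=> c0 [Y [Y0 EY]]; exists (fun k1 k2 => c * Y k1 k2); split.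
  by move=> k1 k2; rewrite mulr_ge0.
move=> x; rewrite EY mulr_sumr; apply: eq_bigr => k1 _.
by rewrite mulr_sumr; apply: eq_bigr => k2 _; rewrite mulrA.
Qed.

Lemma cospoly0 d : cospoly d (fun=> 0).
Proof.
exists (fun _ _ => 0); split=> // x; rewrite big1 // => k1 _; rewrite big1 // => k2 _.
by rewrite mul0r.
Qed.

Lemma cospoly_sum d m (F : nat -> R * R -> R) : (forall k, (k < m)%N -> cospoly d (F k)) ->
  cospoly d (fun x => \sum_(k < m) F k x).
Proof.
elim: m => [|m IH] FC; first by apply: cospoly_eq (cospoly0 d) => x; rewrite big_ord0.
apply: (cospoly_eq (f := fun x => \sum_(k < m) F k x + F m x)).
  by move=> x; rewrite big_ord_recr.
by apply: cospolyD; [apply: IH => k km; apply: FC; exact: ltnW | exact: FC].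
Qed.

Lemma cos_mul1 (k : nat) (x : R) :
  cos (k%:R * x) * cos x = 2^-1 * (cos (k.+1%:R * x) + cos (`|k%:Z - 1|%N%:R * x)).
Proof.
have -> : cos (`|k%:Z - 1|%N%:R * x) = cos (k%:R * x - x).
  case: k => [|k].
    by have -> : `|0%:Z - 1|%N = 1%N by []; rewrite mul0r sub0r cosN mul1r.
  have -> : `|k.+1%:Z - 1|%N = k by lia.
  by rewrite -natr1 mulrDl mul1r addrK.
by rewrite -[k.+1%:R]natr1 mulrDl mul1r cosB cosD; field.
Qed.

(** [yv] itself has nonnegative cosine coefficients, and cos (k x) cos x is half the sum of the
    cosines of frequencies k + 1 and k - 1. The absolute value folds the frequency -1 met at k =
    0. *)
Lemma cospoly_mulyv d f : cospoly d f -> cospoly d.+1 (fun x => f x * yv x).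
Proof.
move=> [Y [Y0 EY]].
pose G k1 k2 (x : R * R) := 2^-1 * coscos k1 k2 x +
  8^-1 * (coscos k1.+1 k2 x + coscos `|k1%:Z - 1|%N k2 x + (coscos k1 k2.+1 x + coscos k1 `|k2%:Z - 1|%N x)).
apply: (cospoly_eq (f := fun x => \sum_(k1 < d) \sum_(k2 < d) Y k1 k2 * G k1 k2 x)).
  move=> x; rewrite EY mulr_suml; apply: eq_bigr => k1 _.
  rewrite mulr_suml; apply: eq_bigr => k2 _; rewrite -mulrA; congr (_ * _).
  rewrite /G /coscos /yv.
  have e1 := cos_mul1 k1 x.1; have e2 := cos_mul1 k2 x.2.
  transitivity (2^-1 * (cos (k1%:R * x.1) * cos (k2%:R * x.2)) +
    4^-1 * ((cos (k1%:R * x.1) * cos x.1) * cos (k2%:R * x.2) + cos (k1%:R * x.1) * (cos (k2%:R * x.2) * cos x.2))); last by field.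
  by rewrite e1 e2; field.
apply: (@cospoly_sum _ _ (fun k1 x => \sum_(k2 < d) Y k1 k2 * G k1 k2 x)) => k1 h1.
apply: (@cospoly_sum _ _ (fun k2 x => Y k1 k2 * G k1 k2 x)) => k2 h2.
apply: cospolyZ => //; apply: cospolyD; first by apply: cospolyZ; rewrite ?invr_ge0 //; apply: CP_coscos; lia.
apply: cospolyZ; first by rewrite invr_ge0.
by apply: cospolyD; apply: cospolyD; apply: CP_coscos; lia.
Qed.

Lemma cospoly_exp i : cospoly i.+1 (fun x => yv x ^+ i).
Proof.
elim: i => [|i IH].
  by apply: cospoly_eq (@CP_coscos 1 0 0 isT isT) => x; rewrite /coscos !mul0r cos0 mulr1 expr0.
by apply: cospoly_eq (cospoly_mulyv IH) => x; rewrite exprSr.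
Qed.

Lemma cosw_coscos k1 k2 (x : R * R) : cosw k1 x.1 * cosw k2 x.2 = (weight k1 * weight k2) * coscos k1 k2 x.
Proof.
by rewrite /cosw /weight /coscos; case: (eqVneq k1 0%N) => [->|_]; case: (eqVneq k2 0%N) => [->|_];
  rewrite ?mul0r ?cos0; ring.
Qed.

Lemma fre_sum m (F : nat -> R * R -> R) m1 m2 : (forall k, @bmeas _ _ T2 (F k)) ->
  fre (fun x => \sum_(k < m) F k x) m1 m2 = \sum_(k < m) fre (F k) m1 m2
  /\ @bmeas _ _ T2 (fun x => \sum_(k < m) F k x).
Proof.
move=> bF; elim: m => [|m [IH1 IH2]].
  have E : (fun x : T2 => \sum_(k < 0) F k x) = fun=> 0 * 1 by apply/funext => x; rewrite big_ord0 mul0r.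
  rewrite [X in fre X]E [X in bmeas X]E big_ord0; split; last exact: bmeas_cst.
  by rewrite freZ ?mul0r //; exact: bmeas_cst.
have E : (fun x : T2 => \sum_(k < m.+1) F k x) = (fun x => \sum_(k < m) F k x + F m x).
  by apply/funext => x; rewrite big_ord_recr.
rewrite [X in fre X]E [X in bmeas X]E big_ord_recr -IH1; split; last exact: bmeasD.
by rewrite freD.
Qed.

Lemma fim_sum m (F : nat -> R * R -> R) m1 m2 : (forall k, @bmeas _ _ T2 (F k)) ->
  fim (fun x => \sum_(k < m) F k x) m1 m2 = \sum_(k < m) fim (F k) m1 m2.
Proof.
move=> bF; elim: m => [|m IH].
  have E : (fun x : T2 => \sum_(k < 0) F k x) = fun=> 0 * 1 by apply/funext => x; rewrite big_ord0 mul0r.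
  rewrite [X in fim X]E big_ord0.
  by rewrite fimZ ?mul0r //; exact: bmeas_cst.
have E : (fun x : T2 => \sum_(k < m.+1) F k x) = (fun x => \sum_(k < m) F k x + F m x).
  by apply/funext => x; rewrite big_ord_recr.
rewrite [X in fim X]E big_ord_recr -IH.
by rewrite fimD //; exact: (fre_sum m 0 0 bF).2.
Qed.

Lemma half_deltaE (a : nat) (m : int) : half_delta a m = (a == `|m|%N)%:R / weight `|m|%N :> R.
Proof.
rewrite /half_delta /weight; have [->|m0] := eqVneq m 0.
  by rewrite oppr0 /=; case: (a) => [|n] /=; field.
have -> : (`|m|%N == 0%N) = false by lia.
have -> : (a == `|m|%N) = (a%:Z == m) || (a%:Z == - m) by lia.
have : ~~ ((a%:Z == m) && (a%:Z == - m)) by lia.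
by case: (a%:Z == m); case: (a%:Z == - m) => //= _; field.
Qed.

(** Orthogonality isolates one cosine coefficient; dividing by the weights shares it among the
    frequencies of either sign. *)
Lemma fre_exp i m1 m2 (Y : nat -> nat -> R) :
  (forall x, yv x ^+ i = \sum_(k1 < i.+1) \sum_(k2 < i.+1) Y k1 k2 * coscos k1 k2 x) ->
  fre (fun x => yv x ^+ i) m1 m2 =
  if (`|m1| < i.+1)%N && (`|m2| < i.+1)%N then Y `|m1|%N `|m2|%N / (weight `|m1|%N * weight `|m2|%N) else 0.
Proof.
move=> EY; have -> : (fun x => yv x ^+ i) = (fun x => \sum_(k1 < i.+1) \sum_(k2 < i.+1) Y k1 k2 * coscos k1 k2 x).
  exact/funext.
have b2 k1 k2 : @bmeas _ _ T2 (fun x => Y k1 k2 * coscos k1 k2 x).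
  by apply: bmeasM; [exact: bmeas_cst | exact: bmeas_coscos].
have b1 k1 : @bmeas _ _ T2 (fun x => \sum_(k2 < i.+1) Y k1 k2 * coscos k1 k2 x).
  exact: (fre_sum i.+1 0 0 (b2 k1)).2.
rewrite (fre_sum i.+1 m1 m2 b1).1.
have E (k1 : 'I_i.+1) : fre (fun x => \sum_(k2 < i.+1) Y k1 k2 * coscos k1 k2 x) m1 m2 =
  \sum_(k2 < i.+1) Y k1 k2 * (((k1 == `|m1|%N :> nat)%:R / weight `|m1|%N) * ((k2 == `|m2|%N :> nat)%:R / weight `|m2|%N)).
  rewrite (fre_sum i.+1 m1 m2 (b2 k1)).1; apply: eq_bigr => k2 _.
  by rewrite freZ ?fre_coscos ?half_deltaE //; exact: bmeas_coscos.
under eq_bigr do rewrite E.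
case: ifP => [/andP[h1 h2]|h].
  rewrite (bigD1 (Ordinal h1)) //= [X in _ + X]big1 ?addr0; last first.
    move=> k; rewrite -val_eqE /= => /negPf h; rewrite big1 // => l _.
    by rewrite h !mul0r mulr0.
  rewrite (bigD1 (Ordinal h2)) //= [X in _ + X]big1 ?addr0; last first.
    by move=> k; rewrite -val_eqE /= => /negPf h; rewrite h mul0r !mulr0.
  by rewrite !eqxx invfM !mul1r.
rewrite big1 // => k1 _; rewrite big1 // => k2 _.
case: eqP => [e1|_]; last by rewrite !mul0r mulr0.
case: eqP => [e2|_]; last by rewrite mul0r !mulr0.
by move: h; rewrite -e1 -e2 !ltn_ord.
Qed.

Definition pcoef (p : {poly R}) (k1 k2 : nat) : R := fre (fun x => p.[yv x]) k1%:Z k2%:Z.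

Lemma bmeas_exp i : @bmeas _ _ T2 (fun x => yv x ^+ i).
Proof.
have by0 : @bmeas _ _ T2 yv.
  have E : yv = (fun x : T2 => 2^-1 * coscos 0 0 x + 4^-1 * (coscos 1 0 x + coscos 0 1 x)).
    by apply/funext => x; rewrite /yv /coscos !mul0r !mul1r cos0; field.
  rewrite E; apply: bmeasD; first by apply: bmeasM; [exact: bmeas_cst | exact: bmeas_coscos].
  apply: bmeasM; first exact: bmeas_cst.
  by apply: bmeasD; exact: bmeas_coscos.
elim: i => [|i IH]; first exact: bmeas_cst.
have -> : (fun x => yv x ^+ i.+1) = (fun x => yv x * yv x ^+ i) by apply/funext => x; rewrite exprS.
exact: bmeasM.
Qed.

Lemma bmeas_poly p : @bmeas _ _ T2 (fun x => p.[yv x]).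
Proof.
have -> : (fun x => p.[yv x]) = (fun x => \sum_(i < size p) p`_i * yv x ^+ i).
  by apply/funext => x; rewrite horner_coef.
apply: (fre_sum (size p) 0 0 (F := fun i x => p`_i * yv x ^+ i) _).2 => i.
by apply: bmeasM; [exact: bmeas_cst | exact: bmeas_exp].
Qed.

Lemma fre_poly p m1 m2 : fre (fun x => p.[yv x]) m1 m2 = \sum_(i < size p) p`_i * fre (fun x => yv x ^+ i) m1 m2.
Proof.
have -> : (fun x => p.[yv x]) = (fun x => \sum_(i < size p) p`_i * yv x ^+ i).
  by apply/funext => x; rewrite horner_coef.
rewrite (fre_sum (size p) m1 m2 (F := fun i x => p`_i * yv x ^+ i) _).1.
  by apply: eq_bigr => i _; rewrite freZ //; exact: bmeas_exp.
by move=> i; apply: bmeasM; [exact: bmeas_cst | exact: bmeas_exp].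
Qed.

Lemma fim_poly p m1 m2 : fim (fun x => p.[yv x]) m1 m2 = 0.
Proof.
have -> : (fun x => p.[yv x]) = (fun x => \sum_(i < size p) p`_i * yv x ^+ i).
  by apply/funext => x; rewrite horner_coef.
rewrite (fim_sum (size p) m1 m2 (F := fun i x => p`_i * yv x ^+ i)); last first.
  by move=> i; apply: bmeasM; [exact: bmeas_cst | exact: bmeas_exp].
rewrite big1 // => i _; rewrite fimZ; last exact: bmeas_exp.
have [Y [_ EY]] := cospoly_exp i.
have -> : (fun x => yv x ^+ i) = (fun x => \sum_(k1 < i.+1) \sum_(k2 < i.+1) Y k1 k2 * coscos k1 k2 x).
  exact/funext.
have b2 k1 k2 : @bmeas _ _ T2 (fun x => Y k1 k2 * coscos k1 k2 x).
  by apply: bmeasM; [exact: bmeas_cst | exact: bmeas_coscos].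
have b1 k1 : @bmeas _ _ T2 (fun x => \sum_(k2 < i.+1) Y k1 k2 * coscos k1 k2 x).
  exact: (fre_sum i.+1 0 0 (b2 k1)).2.
rewrite (fim_sum i.+1 m1 m2 b1) big1 ?mulr0 // => k1 _.
rewrite (fim_sum i.+1 m1 m2 (b2 k1)) big1 // => k2 _.
by rewrite fimZ ?fim_coscos ?mulr0 //; exact: bmeas_coscos.
Qed.

Lemma fre_poly_abs p m1 m2 : fre (fun x => p.[yv x]) m1 m2 = pcoef p `|m1|%N `|m2|%N.
Proof.
rewrite /pcoef !fre_poly; apply: eq_bigr => i _; congr (_ * _).
by have [Y [_ EY]] := cospoly_exp i; rewrite !(fre_exp _ _ EY) !absz_nat.
Qed.

Lemma has_coefs_poly p : has_coefs (fun x => (p.[yv x])%:C) (pcoef p).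
Proof.
move=> m1 m2; rewrite fourierE; last exact: bmeas_poly.
by rewrite fim_poly fre_poly_abs oppr0.
Qed.

Lemma pcoef_supp (p : {poly R}) : coefs_supp (size p) (pcoef p).
Proof.
move=> k1 k2 h; rewrite /pcoef fre_poly big1 // => i _.
have [Y [_ EY]] := cospoly_exp i; rewrite (fre_exp _ _ EY) !absz_nat.
by case: ifP => [|_]; [have := ltn_ord i; lia | rewrite mulr0].
Qed.

Lemma pcoef_ge0 (p : {poly R}) : (forall i, 0 <= p`_i) -> forall k1 k2, 0 <= pcoef p k1 k2.
Proof.
move=> p0 k1 k2; rewrite /pcoef fre_poly sumr_ge0 // => i _; rewrite mulr_ge0 //.
have [Y [Y0 EY]] := cospoly_exp i; rewrite (fre_exp _ _ EY) !absz_nat.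
by case: ifP => // _; rewrite divr_ge0 // mulr_ge0 // (le_trans ler01) ?weight_ge1.
Qed.

Lemma pcoefB p q k1 k2 : pcoef (p - q) k1 k2 = pcoef p k1 k2 - pcoef q k1 k2.
Proof.
rewrite /pcoef; have -> : (fun x => (p - q).[yv x]) = (fun x => p.[yv x] + (-1) * q.[yv x]).
  by apply/funext => x; rewrite hornerD hornerN mulN1r.
rewrite freD ?freZ ?mulN1r //; try exact: bmeas_poly.
by apply: bmeasM; [exact: bmeas_cst | exact: bmeas_poly].
Qed.

Lemma taueig_poly (p : {poly R}) n x : (size p <= n)%N -> taueig n (pcoef p) x.1 x.2 = p.[yv x].
Proof.
move=> pn; rewrite horner_coef.
have wn0 k : weight k != 0 :> R by rewrite gt_eqF // (lt_le_trans ltr01) // weight_ge1.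
transitivity (\sum_(k1 < n) \sum_(k2 < n) \sum_(i < size p) p`_i * (fre (fun x => yv x ^+ i) k1%:Z k2%:Z * (cosw k1 x.1 * cosw k2 x.2))).
  apply: eq_bigr => k1 _; apply: eq_bigr => k2 _; rewrite /pcoef fre_poly mulr_suml.
  by apply: eq_bigr => i _; rewrite -mulrA.
under eq_bigr do rewrite exchange_big /=; rewrite exchange_big /=.
apply: eq_bigr => i _; have [Y [_ EY]] := cospoly_exp i.
under eq_bigr do rewrite -mulr_sumr; rewrite -mulr_sumr EY; congr (_ * _).
rewrite (@sum_supp _ i.+1 n (fun k1 k2 => fre (fun x => yv x ^+ i) k1%:Z k2%:Z * (cosw k1 x.1 * cosw k2 x.2))) //; last 2 first.
- exact: leq_trans (ltn_ord i) pn.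
- move=> k1 k2 h; rewrite (fre_exp _ _ EY) !absz_nat; case: ifP => [|_]; [lia | by rewrite mul0r].
apply: eq_bigr => k1 _; apply: eq_bigr => k2 _.
rewrite (fre_exp _ _ EY) !absz_nat !ltn_ord /= cosw_coscos.
by rewrite mulrA divfK // mulf_neq0.
Qed.

(** For nonnegative coefficients the l1 norm is the value of the series at the origin, where every
    cosine and [yv] equal 1. The sum is first enlarged to [N], so that no frequency of [p] is
    cut. *)
Lemma l1_poly (p : {poly R}) n : (forall i, 0 <= p`_i) -> l1 n (pcoef p) <= p.[1].
Proof.
move=> p0; have c0 := pcoef_ge0 p0.
have E0 : yv (0, 0) = 1 by rewrite /yv /= cos0; field.
have w0 k : 0 <= weight k :> R by rewrite (le_trans ler01) // weight_ge1.
have cw0 k : cosw k 0 = weight k :> R by rewrite /cosw /weight mulr0 cos0 mulr1.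
pose N := maxn n (size p).
rewrite -E0 -(@taueig_poly p N (0, 0)) ?leq_maxr // /taueig /l1.
have aux (F : nat -> R) : (forall k, 0 <= F k) -> \sum_(k < n) F k <= \sum_(k < N) F k.
  move=> F0; rewrite (big_ord_widen N F) ?leq_maxl // [leRHS](bigID (fun i : 'I_N => (i < n)%N)) /=.
  by rewrite lerDl sumr_ge0.
apply: (@le_trans _ _ (\sum_(k1 < n) \sum_(k2 < N) pcoef p k1 k2 * (cosw k1 0 * cosw k2 0))).
  apply: ler_sum => k1 _.
  apply: le_trans (aux (fun k2 => pcoef p k1 k2 * (cosw k1 0 * cosw k2 0)) _); last first.
    by move=> k; rewrite !cw0; apply: mulr_ge0; [exact: c0 | apply: mulr_ge0; exact: w0].
  by apply: ler_sum => k2 _; rewrite ger0_norm ?c0 // !cw0.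
apply: (aux (fun k1 => \sum_(k2 < N) pcoef p k1 k2 * (cosw k1 0 * cosw k2 0))) => k.
by apply: sumr_ge0 => l _; rewrite !cw0; apply: mulr_ge0; [exact: c0 | apply: mulr_ge0; exact: w0].
Qed.

End CosinePolynomials.

(** * The symbol *)

Section TAlpha.
Context {R : realType}.
Local Notation C := R[i].
Local Notation T2 := (measurableTypeR R * measurableTypeR R)%type.
Context (alpha : R).
Context (ha : 1 < alpha < 2).

Let s := alpha / 2.
Let s01 : 2^-1 <= s < 1.
Proof. by rewrite /s; case/andP: ha => h1 h2; apply/andP; split; lra. Qed.
Let s0 : s != 0. Proof. by case/andP: s01 => h _; rewrite gt_eqF //; lra. Qed.

Definition talpha (x : R * R) : R :=
  (4 * sin (x.1 / 2) ^+ 2 + 4 * sin (x.2 / 2) ^+ 2) `^ (alpha / 2).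

Lemma t_alpha_talpha : t_alpha alpha = fun x => (talpha x)%:C.
Proof. by []. Qed.

Definition tmax : R := 8 `^ (alpha / 2).
Lemma tmax_gt0 : 0 < tmax. Proof. exact: powR_gt0. Qed.

Lemma cos_half (t : R) : cos t = 1 - 2 * sin (t / 2) ^+ 2.
Proof.
have {1}-> : t = t / 2 + t / 2 by field.
by rewrite cosD -!expr2 cos2sin2; ring.
Qed.

Lemma talphaE x : talpha x = tmax * (1 - yv x) `^ s.
Proof.
have /andP[y0 y1] := yv01 x.
rewrite /tmax -powRM ?subr_ge0 //; congr (_ `^ _).
by rewrite /yv !cos_half; field.
Qed.

Definition tpoly M : {poly R} := tmax *: powpoly s M.
Definition terr M : R := tmax * tailp s M.

Lemma terr_ge0 M : 0 <= terr M.
Proof. by rewrite mulr_ge0 ?tailp_ge0 ?(ltW tmax_gt0). Qed.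

Lemma terr_cvg e : 0 < e -> exists M0, forall M, (M0 <= M)%N -> terr M <= e.
Proof.
move=> e0; have [M0 H] := tailp_cvg s01 (divr_gt0 e0 tmax_gt0).
by exists M0 => M /H; rewrite ler_pdivlMr ?tmax_gt0 // mulrC.
Qed.

Lemma talpha_le_tpoly M x : talpha x <= (tpoly M).[yv x].
Proof. by rewrite talphaE hornerZ ler_wpM2l ?(ltW tmax_gt0) // powpoly_lb ?yv01. Qed.

Lemma tpoly_le_talpha M x : (tpoly M).[yv x] <= talpha x + terr M.
Proof. by rewrite talphaE hornerZ -mulrDr ler_wpM2l ?(ltW tmax_gt0) // powpoly_ub ?yv01. Qed.

Lemma talpha_tpoly M x : `|talpha x - (tpoly M).[yv x]| <= terr M.
Proof.
by rewrite ler_norml; have := talpha_le_tpoly M x; have := tpoly_le_talpha M x; have := terr_ge0 M => *; apply/andP; split; lra.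
Qed.

Lemma talpha_ge0 x : 0 <= talpha x. Proof. exact: powR_ge0. Qed.
Lemma talpha_le x : talpha x <= tmax.
Proof.
by apply: le_trans (talpha_le_tpoly 0 x) _; rewrite /tpoly /powpoly big_ord0 subr0 hornerZ hornerC mulr1.
Qed.

Lemma bmeas_talpha : @bmeas _ _ T2 talpha.
Proof.
have -> : talpha = (fun x => tmax * (1 - yv x) `^ s) by apply/funext => x; exact: talphaE.
apply: bmeasM; first exact: bmeas_cst.
split; last first.
  exists 1 => x; have /andP[y0 y1] := yv01 x.
  have e1 : 1 `^ s = 1 by rewrite powR1.
  rewrite ger0_norm ?powR_ge0 // -[leRHS]e1 ge0_ler_powR ?nnegrE ?subr_ge0 ?lerBlDr ?lerDl //.
  by case/andP: s01; lra.
apply: (measurableT_comp (measurable_powR s)).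
apply: measurable_funB; first exact: measurable_cst.
have [+ _] := @bmeas_poly R 'X.
by under [X in measurable_fun _ X -> _]eq_fun do rewrite hornerX.
Qed.

Definition tcoef (k1 k2 : nat) : R := fre talpha k1%:Z k2%:Z.

Lemma fre_close M m1 m2 : `|fre talpha m1 m2 - fre (fun x => (tpoly M).[yv x]) m1 m2| <= terr M.
Proof.
have bp := @bmeas_poly R (tpoly M); have bt := bmeas_talpha.
have bp' : @bmeas _ _ T2 (fun x => (-1) * (tpoly M).[yv x]) by apply: bmeasM => //; exact: bmeas_cst.
rewrite -[X in _ - X]mul1r -mulNr -freZ // -freD //.
apply: fre_bound; first exact: bmeasD.
by move=> x; rewrite mulN1r talpha_tpoly.
Qed.

Lemma fim_close M m1 m2 : `|fim talpha m1 m2| <= terr M.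
Proof.
have bp := @bmeas_poly R (tpoly M); have bt := bmeas_talpha.
have bp' : @bmeas _ _ T2 (fun x => (-1) * (tpoly M).[yv x]) by apply: bmeasM => //; exact: bmeas_cst.
rewrite -[fim talpha _ _]addr0 -[X in _ + X](mulr0 (-1)) -(fim_poly (tpoly M) m1 m2) -fimZ // -fimD //.
apply: fim_bound; first exact: bmeasD.
by move=> x; rewrite mulN1r talpha_tpoly.
Qed.

(** Stands in for passages to the limit: an inequality valid up to a multiple of every late [terr]
    holds exactly. *)
Lemma terr_small M0 (x c : R) : 0 <= c -> (forall k, x <= c * terr (M0 + k)) -> x <= 0.
Proof.
move=> c0 xM; apply/ler_addgt0Pl => e e0; rewrite addr0.
have c1 : 0 < c + 1 by rewrite ltr_wpDl.
have [M HM] := terr_cvg (divr_gt0 e0 c1); apply: le_trans (xM M) _.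
apply: (@le_trans _ _ ((c + 1) * terr (M0 + M))); first by rewrite ler_wpM2r ?terr_ge0 // lerDl.
by rewrite mulrC -ler_pdivlMr // HM // leq_addl.
Qed.

Lemma fre_talpha_abs m1 m2 : fre talpha m1 m2 = tcoef `|m1|%N `|m2|%N.
Proof.
apply/eqP; rewrite -subr_eq0 -normr_le0; apply: (@terr_small 0 _ 2) => // M; rewrite add0n.
have h1 := fre_close M m1 m2; have h2 := fre_close M `|m1|%N%:Z `|m2|%N%:Z.
rewrite fre_poly_abs in h1; rewrite fre_poly_abs !absz_nat in h2.
rewrite -/(tcoef _ _) in h2.
set u := pcoef _ _ _ in h1 h2; set v := fre _ _ _ in h1 *; set w := tcoef _ _ in h2 *.
have -> : v - w = (v - u) - (w - u) by ring.
by apply: le_trans (ler_normB _ _) _; lra.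
Qed.

Lemma has_coefs_talpha : has_coefs (t_alpha alpha) tcoef.
Proof.
move=> m1 m2; rewrite t_alpha_talpha fourierE ?fre_talpha_abs; last exact: bmeas_talpha.
have -> : fim talpha m1 m2 = 0.
  apply/eqP; rewrite -normr_le0; apply: (@terr_small 0 _ 1) => // M.
  by rewrite add0n mul1r fim_close.
by rewrite oppr0.
Qed.

Lemma powpolyB_coef M k i : 0 <= (powpoly s M - powpoly s (M + k))`_i.
Proof.
elim: k => [|k IH]; first by rewrite addn0 subrr coef0.
rewrite addnS powpolyS opprB addrCA coefD addr_ge0 // ?IH //.
by rewrite coefZ coefXn mulr_ge0 ?bincoef_ge0.
Qed.

Lemma tpolyB_coef M k i : 0 <= (tpoly M - tpoly (M + k))`_i.
Proof. by rewrite -scalerBr coefZ mulr_ge0 ?(ltW tmax_gt0) ?powpolyB_coef. Qed.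

Lemma tpoly1 M : (tpoly M).[1] = terr M.
Proof. by rewrite hornerZ powpoly1. Qed.

(** For fixed n, [tcoef] is compared with [tpoly (M + k)] for large k: the n^2 coefficients differ
    by at most [terr (M + k)] each, with weight at most 4, and this disappears as k grows. What is
    left, [tpoly M - tpoly (M + k)], has nonnegative coefficients, so by [l1_poly] its l1 norm is at
    most its value at 1, below [terr M] independently of n and k. *)
Lemma l1_tcoef M n : l1 n (sub_coefs tcoef (pcoef (tpoly M))) <= terr M.
Proof.
rewrite -subr_le0; apply: (@terr_small M _ ((n * n)%:R * 4)); first by rewrite mulr_ge0.
move=> k; rewrite lerBlDr.
have w0 i : 0 <= weight i :> R by rewrite (le_trans ler01) // weight_ge1.
have w2 i : weight i <= 2 :> R by rewrite /weight; case: ifP => _; rewrite ?lexx ?ler1n.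
have h1 : l1 n (pcoef (tpoly M - tpoly (M + k))) <= terr M.
  apply: le_trans (l1_poly _ (tpolyB_coef M k)) _.
  by rewrite hornerD hornerN !tpoly1 gerBl terr_ge0.
apply: (@le_trans _ _ (\sum_(k1 < n) \sum_(k2 < n) (4 * terr (M + k) + `|pcoef (tpoly M - tpoly (M + k)) k1 k2| * (weight k1 * weight k2)))).
  apply: ler_sum => k1 _; apply: ler_sum => k2 _.
  rewrite pcoefB /sub_coefs.
  have -> : tcoef k1 k2 - pcoef (tpoly M) k1 k2 = (tcoef k1 k2 - pcoef (tpoly (M + k)) k1 k2) - (pcoef (tpoly M) k1 k2 - pcoef (tpoly (M + k)) k1 k2) by ring.
  apply: (@le_trans _ _ ((`|tcoef k1 k2 - pcoef (tpoly (M + k)) k1 k2| + `|pcoef (tpoly M) k1 k2 - pcoef (tpoly (M + k)) k1 k2|) * (weight k1 * weight k2))).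
    by rewrite ler_wpM2r ?ler_normB //; apply: mulr_ge0; exact: w0.
  rewrite mulrDl lerD2r mulrC ler_pM //.
  - by apply: mulr_ge0; exact: w0.
  - have -> : 4 = 2 * 2 :> R by ring.
    by rewrite ler_pM.
  - exact: fre_close.
under eq_bigr do rewrite big_split /= sumr_const card_ord.
rewrite big_split /= sumr_const card_ord -mulrnA -[X in X + _]mulr_natl mulrA lerD2l.
exact: h1.
Qed.

Lemma taueig_tcoef M n x : (size (tpoly M) <= n)%N -> `|taueig n tcoef x.1 x.2 - (tpoly M).[yv x]| <= terr M.
Proof.
move=> h; rewrite -(taueig_poly x h) -taueigB.
by apply: le_trans (taueig_l1 _ _ _ _) _; exact: l1_tcoef.
Qed.

Lemma l1approx_tcoef : l1approx tcoef.
Proof.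
move=> e /terr_cvg [M HM]; exists (size (tpoly M)), (pcoef (tpoly M)); split; first exact: pcoef_supp.
by move=> n; apply: le_trans (l1_tcoef _ _) (HM M _).
Qed.

(** Coefficients are attached to list entries and not to frequencies, so that sums are
    concatenations; [trig_sum_trig_poly] regroups equal frequencies at the end. *)
Definition trig_sum (f : R * R -> C) := exists l : seq ((int * int) * C), forall t,
  f t = \sum_(p <- l) p.2 * expi (p.1.1%:~R * t.1 + p.1.2%:~R * t.2).

Lemma trig_sum_eq f g : f =1 g -> trig_sum f -> trig_sum g.
Proof. by move=> fg [l E]; exists l => t; rewrite -fg. Qed.

Lemma trig_sumD f g : trig_sum f -> trig_sum g -> trig_sum (fun x => f x + g x).
Proof. by move=> [l El] [m Em]; exists (l ++ m) => t; rewrite El Em big_cat. Qed.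

Lemma trig_sumZ c f : trig_sum f -> trig_sum (fun x => c * f x).
Proof.
move=> [l El]; exists [seq (p.1, c * p.2) | p <- l] => t.
by rewrite El big_map mulr_sumr; apply: eq_bigr => p _; rewrite mulrA.
Qed.

Lemma trig_sum_sum m (F : nat -> R * R -> C) : (forall k, trig_sum (F k)) -> trig_sum (fun x => \sum_(k < m) F k x).
Proof.
move=> FT; elim: m => [|m IH].
  by exists [::] => t; rewrite !big_ord0 big_nil.
apply: trig_sum_eq (trig_sumD IH (FT m)) => t; by rewrite big_ord_recr.
Qed.

Lemma TP_coscos a b : trig_sum (fun x => (coscos a b x)%:C).
Proof.
exists [:: ((a%:Z, b%:Z), (4^-1)%:C); ((a%:Z, - b%:Z), (4^-1)%:C);
           ((- a%:Z, b%:Z), (4^-1)%:C); ((- a%:Z, - b%:Z), (4^-1)%:C)] => t.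
rewrite !big_cons big_nil addr0 /= /coscos /expi !mulrNz !mulNr -[a%:~R]/(a%:R) -[b%:~R]/(b%:R).
move: (a%:R * t.1) (b%:R * t.2) => u v.
apply/eqP; rewrite eq_complex /= !mul0r !subr0 !addr0.
rewrite !cosD !sinD !cosN !sinN; apply/andP; split; apply/eqP; by field.
Qed.

Lemma trig_sum_trig_poly f : trig_sum f -> trig_poly f.
Proof.
move=> [l El]; exists (undup [seq p.1 | p <- l]), (fun k => \sum_(p <- l | p.1 == k) p.2) => t.
rewrite El; under [RHS]eq_bigr do rewrite mulr_suml.
rewrite (exchange_big_dep xpredT) //=; rewrite big_seq [RHS]big_seq; apply: eq_bigr => p pl.
rewrite (eq_bigl (pred1 p.1)); last by move=> k; rewrite eq_sym.
rewrite -big_filter filter_pred1_uniq ?undup_uniq ?big_seq1 // mem_undup.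
by apply/mapP; exists p.
Qed.

Lemma trig_poly_poly (p : {poly R}) : trig_poly (fun x => (p.[yv x])%:C).
Proof.
apply: trig_sum_trig_poly; pose n := size p.
apply: (trig_sum_eq (f := fun x => \sum_(k1 < n) \sum_(k2 < n) (pcoef p k1 k2 * (weight k1 * weight k2))%:C * (coscos k1 k2 x)%:C)).
  move=> x; rewrite -(taueig_poly x (leqnn _)) rmorph_sum; apply: eq_bigr => k1 _.
  rewrite rmorph_sum; apply: eq_bigr => k2 _; rewrite -rmorphM cosw_coscos.
  by congr (_%:C); rewrite [RHS]mulrA.
apply: (@trig_sum_sum n (fun k1 x => \sum_(k2 < n) (pcoef p k1 k2 * (weight k1 * weight k2))%:C * (coscos k1 k2 x)%:C)) => k1.
apply: (@trig_sum_sum n (fun k2 x => (pcoef p k1 k2 * (weight k1 * weight k2))%:C * (coscos k1 k2 x)%:C)) => k2.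
exact: trig_sumZ (TP_coscos _ _).
Qed.

End TAlpha.

(** * Lower bound for the eigenvalues of the tau matrix *)

Section LowerBound.
Context {R : realType}.

Lemma sin_le (t : R) : 0 <= t -> sin t <= t.
Proof.
move=> t0; have H := @ge0_derive_le R (fun x => x - sin x) (fun x => 1 - cos x) t t0.
rewrite sin0 subr0 subr_ge0 in H; apply: H => x _.
by rewrite subr_ge0 cos_le1.
Qed.

Lemma abs_sin_le (t : R) : `|sin t| <= `|t|.
Proof.
have main (u : R) : 0 <= u -> `|sin u| <= u.
  move=> u0; rewrite ler_norml sin_le // andbT.
  have H := @ge0_derive_le R (fun x => x + sin x) (fun x => 1 + cos x) u u0.
  rewrite sin0 addr0 in H; suff : 0 <= u + sin u by lra.
  apply: H => x _.
  by have := cos_geN1 x; lra.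
have [t0|t0] := leP 0 t; first by rewrite [leRHS]ger0_norm // main.
by rewrite [leRHS]ltr0_norm // -normrN -sinN main // oppr_ge0 ltW.
Qed.

Lemma sin_ge_half (t : R) : 0 <= t <= 1 -> t / 2 <= sin t.
Proof.
move=> /andP[t0 t1]; have H := @ge0_derive_le R (fun x => sin x - x / 2) (fun x => cos x - 2^-1) t t0.
rewrite sin0 mul0r subr0 subr_ge0 in H; apply: H => x.
- move=> _; have h := is_derive_sin x.
  have h2 : is_derive x 1 (fun y : R => y / 2) 2^-1.
    by apply: is_derive_eq; rewrite /GRing.scale /= ?mulr0 ?add0r ?addr0 ?mulr1 ?mul1r.
  exact: is_deriveB.
- move=> /andP[x0 xt]; rewrite subr_ge0 cos_half.
  have h := abs_sin_le (x / 2); have x2 : 0 <= x / 2 by rewrite divr_ge0.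
  rewrite [leRHS]ger0_norm // in h.
  have : sin (x / 2) ^+ 2 <= (x / 2) ^+ 2.
    by rewrite -[leLHS]real_normK ?num_real // ler_sqr ?nnegrE.
  have : (x / 2) ^+ 2 <= 4^-1.
    have -> : 4^-1 = (2^-1) ^+ 2 :> R by field.
    by rewrite ler_sqr ?nnegrE ?invr_ge0 // ler_pdivrMr // mulVf // (le_trans xt).
  by lra.
Qed.

Context (alpha : R).
Context (ha : 1 < alpha < 2).
Local Notation talpha := (talpha alpha).
Local Notation tcoef := (tcoef alpha).
Local Notation tmax := (tmax alpha).
Local Notation tpoly := (tpoly alpha).
Local Notation terr := (terr alpha).

Lemma sqr_powR (x : R) : 0 <= x -> (x ^+ 2) `^ (alpha / 2) = x `^ alpha.
Proof.
by move=> x0; rewrite -powR_mulrn // -powRrM; congr (_ `^ _); field.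
Qed.

Lemma talpha_axis_ub x : 0 <= x -> talpha (x, 0) <= x `^ alpha.
Proof.
move=> x0; rewrite /talpha /= mul0r sin0 expr0n mulr0 addr0 -sqr_powR //.
have h4 : 0 <= 4 * sin (x / 2) ^+ 2 by apply: mulr_ge0 => //; exact: sqr_ge0.
apply: ge0_ler_powR => //; [by case/andP: ha; lra | by rewrite nnegrE sqr_ge0 | ].
have h := abs_sin_le (x / 2); have x2 : 0 <= x / 2 by rewrite divr_ge0.
have : sin (x / 2) ^+ 2 <= (x / 2) ^+ 2.
  by rewrite -[leLHS]real_normK ?num_real // -[leRHS]real_normK ?num_real // ler_sqr ?nnegrE.
have -> : (x / 2) ^+ 2 = x ^+ 2 / 4 by field.
lra.
Qed.

Lemma talpha_axis_lb x : 0 <= x <= 2 -> (x / 2) `^ alpha <= talpha (x, 0).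
Proof.
move=> /andP[x0 xx]; have x2 : 0 <= x / 2 by rewrite divr_ge0.
rewrite /talpha /= mul0r sin0 expr0n mulr0 addr0 -sqr_powR //.
have h4 : 0 <= 4 * sin (x / 2) ^+ 2 by apply: mulr_ge0 => //; exact: sqr_ge0.
apply: ge0_ler_powR => //; [by case/andP: ha; lra | by rewrite nnegrE sqr_ge0 | ].
have h : x / 2 / 2 <= sin (x / 2) by apply: sin_ge_half; rewrite x2 ler_pdivrMr // mul1r.
have : (x / 2 / 2) ^+ 2 <= sin (x / 2) ^+ 2.
  by rewrite ler_sqr ?nnegrE ?divr_ge0 // (le_trans _ h) // divr_ge0.
have -> : (x / 2 / 2) ^+ 2 = (x / 2) ^+ 2 / 4 by field.
lra.
Qed.

(* Small enough for eta^2 to be negligible against eta^alpha: eta^2 = eta^alpha / 32. *)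
Definition eta : R := 32^-1 `^ (2 - alpha)^-1.
Definition kap : R := eta `^ alpha / 16.

Lemma eta01 : 0 < eta <= 1.
Proof.
rewrite powR_gt0 ?invr_gt0 //=.
have e1 : 1 `^ (2 - alpha)^-1 = 1 :> R by rewrite powR1.
rewrite -e1 ge0_ler_powR ?nnegrE ?invr_ge0 ?invf_le1 ?ler1n //.
by case/andP: ha => _ h; rewrite subr_ge0 ltW.
Qed.

Lemma kap_gt0 : 0 < kap.
Proof. by rewrite divr_gt0 // powR_gt0 //; case/andP: eta01. Qed.

(** Since eta^2 = eta^alpha / 32 and 2^alpha <= 4, the right side is at least eta^alpha (1/4 - 1/8),
    which is exactly 2 [kap]. *)
Lemma eta_ineq : 2 * kap <= (eta / 2) `^ alpha - 4 * eta ^+ 2.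
Proof.
case/andP: ha => h1 h2; case/andP: eta01 => e0 e1.
have E2 : eta ^+ 2 = eta `^ alpha / 32.
  rewrite -powR_mulrn ?(ltW e0) // (_ : 2%:R = alpha + (2 - alpha)); last by ring.
  rewrite powRD; last by rewrite (gt_eqF e0) implybT.
  congr (_ * _); rewrite /eta -powRrM mulVf ?powRr1 ?invr_ge0 //.
  by rewrite gt_eqF // subr_gt0.
have Eh : eta `^ alpha / 4 <= (eta / 2) `^ alpha.
  rewrite powRM ?(ltW e0) ?invr_ge0 // ler_wpM2l ?powR_ge0 //.
  have -> : 4^-1 = 2^-1 `^ 2 :> R by rewrite powR_mulrn ?invr_ge0 //; field.
  apply: ger_powR; last exact: ltW.
  by rewrite invr_gt0 ltr0n invf_le1 ?ler1n.
have := powR_ge0 eta alpha.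
by move: Eh; rewrite E2 /kap; move: (_ `^ _) (_ `^ _) => u v; lra.
Qed.

(* Let r_k be the coefficients along one axis, so that g t = \sum_k r_k (1 - cos (k t))
   is close to |t|^alpha.  Then g h bounds the second moment of the r_k with k < n,
   so that g (eta h) bounds the tail \sum_(k >= n) r_k from below; and this tail is a
   lower bound for the eigenvalues. *)
Lemma taueig_lb_approx M n x : (0 < n)%N -> kap * hstep n `^ alpha - terr M / 2 <= taueig n tcoef x.1 x.2.
Proof.
move=> n0; set h := hstep n.
have h0 : 0 < h by rewrite invr_gt0 ltr0Sn.
have h1 : h <= 1 by rewrite invf_le1 ?ltr0Sn // ler1n.
have [e0 e1] := andP eta01.
(* [tpoly 0] is the constant [tmax], so [q] gathers the subtracted terms of the binomial series and
   has nonnegative coefficients. *)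
pose q := tpoly 0 - tpoly M.
have q0 i : 0 <= q`_i by have := tpolyB_coef ha 0 M i; rewrite add0n.
have c0 := pcoef_ge0 q0.
pose d := maxn n (size q).
have w0 i : 0 <= weight i :> R by rewrite (le_trans ler01) // weight_ge1.
pose r k1 := \sum_(k2 < d) pcoef q k1 k2 * (weight k1 * weight k2).
have r0 k : 0 <= r k.
  by apply: sumr_ge0 => l _; apply: mulr_ge0; [exact: c0 | apply: mulr_ge0; exact: w0].
have p00 y : (tpoly 0).[y] = tmax by rewrite /tpoly /powpoly big_ord0 subr0 hornerZ hornerC mulr1.
have qE y : q.[y] = tmax - (tpoly M).[y] by rewrite hornerD hornerN p00.
have Lx t : \sum_(k < d) r k * cos (k%:R * t) = q.[yv (t, 0)].
  rewrite -(@taueig_poly _ q d (t, 0)) ?leq_maxr //; apply: eq_bigr => k1 _.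
  rewrite mulr_suml; apply: eq_bigr => k2 _; rewrite cosw_coscos /coscos /= mulr0 cos0 mulr1.
  by rewrite !mulrA.
have y1 : yv (0, 0) = 1 :> R by rewrite /yv /= cos0; field.
have S1 : \sum_(k < d) r k = tmax - terr M.
  transitivity (\sum_(k < d) r k * cos (k%:R * 0)).
    by apply: eq_bigr => k _; rewrite mulr0 cos0 mulr1.
  by rewrite Lx y1 qE tpoly1.
pose g t := \sum_(k < d) r k * (1 - cos (k%:R * t)).
have gE t : g t = (tpoly M).[yv (t, 0)] - terr M.
  rewrite /g; under eq_bigr do rewrite mulrBr mulr1.
  by rewrite sumrB S1 Lx qE; ring.
pose Tail := \sum_(k < d | (n <= k)%N) r k.
(* Up to [terr M] the eigenvalue is [tmax] minus the truncated series of [q]. That series is at most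
   its l1 norm, hence at most the mass of [r] below n, while the total mass is [tmax - terr M]: the
   difference is the tail. *)
have lamT : Tail <= taueig n tcoef x.1 x.2.
  have hl := taueig_l1 n (pcoef q) x.1 x.2.
  have hS : l1 n (pcoef q) <= \sum_(k < d | (k < n)%N) r k.
    rewrite /l1 -(big_ord_widen d r) ?leq_maxl //; apply: ler_sum => k1 _.
    rewrite /r (big_ord_widen d (fun k2 => `|pcoef q k1 k2| * (weight k1 * weight k2))) ?leq_maxl //.
    rewrite [leRHS](bigID (fun i : 'I_d => (i < n)%N)) /= -[leLHS]addr0 lerD //.
      by apply: ler_sum => k2 _; rewrite ger0_norm ?c0.
    by apply: sumr_ge0 => l _; apply: mulr_ge0; [exact: c0 | apply: mulr_ge0; exact: w0].
  have hT : \sum_(k < d | (k < n)%N) r k + Tail = tmax - terr M.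
    rewrite -S1 [RHS](bigID (fun i : 'I_d => (i < n)%N)) /=; congr (_ + _).
    by apply: eq_bigl => i; rewrite -leqNgt.
  have hp : taueig n (pcoef (tpoly M)) x.1 x.2 = tmax - taueig n (pcoef q) x.1 x.2.
    have -> : taueig n (pcoef q) x.1 x.2 = taueig n (pcoef (tpoly 0)) x.1 x.2 - taueig n (pcoef (tpoly M)) x.1 x.2.
      rewrite -taueigB; apply: eq_bigr => k1 _; apply: eq_bigr => k2 _.
      by rewrite /q pcoefB.
    have sz : (size (tpoly 0) <= n)%N.
      apply: leq_trans n0; rewrite /tpoly /powpoly big_ord0 subr0.
      by apply: leq_trans (size_scale_leq _ _) _; rewrite size_poly1.
    have E0 := taueig_poly x sz; rewrite p00 in E0.
    by rewrite E0; ring.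
  have hc := le_trans (taueig_l1 n (sub_coefs tcoef (pcoef (tpoly M))) x.1 x.2) (l1_tcoef ha M n).
  rewrite taueigB hp in hc.
  have := ler_norm (taueig n (pcoef q) x.1 x.2); move: hc; rewrite ler_norml => /andP[hc _].
  by move: hc hl hS hT; lra.
have g1 : g h <= h `^ alpha.
  rewrite gE lerBlDr; apply: le_trans (tpoly_le_talpha ha M _) _.
  by rewrite lerD2r talpha_axis_ub // ltW.
pose Q := \sum_(k < d | (k < n)%N) r k * (k%:R * h) ^+ 2.
(* For k < n the angle u = k h is at most 1, so 1 - cos u = 2 sin (u / 2)^2 >= u^2 / 8. *)
have Qle : Q <= 8 * h `^ alpha.
  rewrite -ler_pdivrMl //; apply: le_trans g1; rewrite /Q mulr_sumr.
  rewrite /g [leRHS](bigID (fun i : 'I_d => (i < n)%N)) /= -[leLHS]addr0 lerD //; last first.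
    by apply: sumr_ge0 => k _; rewrite mulr_ge0 ?r0 // subr_ge0 cos_le1.
  apply: ler_sum => k kn; rewrite mulrCA ler_wpM2l ?r0 //.
  rewrite cos_half; set u := k%:R * h.
  have u0 : 0 <= u by rewrite mulr_ge0 // ltW.
  have u1 : u <= 1.
    by rewrite /u /h /hstep ler_pdivrMr ?ltr0Sn // mul1r ler_nat; lia.
  have hs : u / 2 / 2 <= sin (u / 2).
    by apply: sin_ge_half; rewrite divr_ge0 //= ler_pdivrMr //; lra.
  have : (u / 2 / 2) ^+ 2 <= sin (u / 2) ^+ 2.
    by rewrite ler_sqr ?nnegrE ?divr_ge0 // (le_trans _ hs) // !divr_ge0.
  have -> : (u / 2 / 2) ^+ 2 = u ^+ 2 / 16 by field.
  by lra.
(* Here 1 - cos u <= u^2 / 2 serves for k < n, and 1 - cos u <= 2 for the tail. *)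
have g2 : g (eta * h) <= eta ^+ 2 / 2 * Q + 2 * Tail.
  rewrite /g [leLHS](bigID (fun i : 'I_d => (i < n)%N)) /= lerD //.
    rewrite /Q mulr_sumr; apply: ler_sum => k _; rewrite [leRHS]mulrCA ler_wpM2l ?r0 //.
    rewrite cos_half; set u := k%:R * (eta * h).
    have hs := abs_sin_le (u / 2).
    have : sin (u / 2) ^+ 2 <= (u / 2) ^+ 2.
      by rewrite -[leLHS]real_normK ?num_real // -[leRHS]real_normK ?num_real // ler_sqr ?nnegrE.
    have -> : eta ^+ 2 / 2 * (k%:R * h) ^+ 2 = 2 * (u / 2) ^+ 2 by rewrite /u; field.
    by lra.
  rewrite /Tail mulr_sumr [leRHS](eq_bigl (fun i : 'I_d => ~~ (i < n)%N)); last first.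
    by move=> i; rewrite -leqNgt.
  apply: ler_sum => k _; rewrite mulrC ler_wpM2r ?r0 //.
  by have := cos_geN1 (k%:R * (eta * h)); lra.
have g3 : (eta / 2) `^ alpha * h `^ alpha - terr M <= g (eta * h).
  rewrite gE lerD2r; apply: le_trans (talpha_le_tpoly ha M _).
  rewrite -powRM ?(ltW h0) ?divr_ge0 ?(ltW e0) // mulrAC; apply: talpha_axis_lb.
  rewrite mulr_ge0 ?(ltW h0) ?(ltW e0) //=.
  by apply: (@le_trans _ _ (1 * 1)); [rewrite ler_pM // ltW | lra].
have g4 : 2 * kap * h `^ alpha <= ((eta / 2) `^ alpha - 4 * eta ^+ 2) * h `^ alpha.
  by rewrite ler_wpM2r ?powR_ge0 // eta_ineq.
have g5 : eta ^+ 2 / 2 * Q <= eta ^+ 2 / 2 * (8 * h `^ alpha).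
  by rewrite ler_wpM2l // divr_ge0 ?sqr_ge0.
(* Together: 2 [Tail] >= ((eta / 2)^alpha - 4 eta^2) h^alpha - [terr M] >= 2 [kap] h^alpha -
   [terr M]. *)
move: lamT g2 g3 g4 g5; move: (h `^ alpha) ((eta / 2) `^ alpha) (g _) (taueig _ _ _ _) => H E G L.
rewrite mulrBl; lra.
Qed.

Lemma taueig_lb n x : (0 < n)%N -> kap * hstep n `^ alpha <= taueig n tcoef x.1 x.2.
Proof.
move=> n0; rewrite -subr_le0; apply: (@terr_small _ _ ha 0 _ 2^-1); first by rewrite invr_ge0.
move=> M; rewrite add0n; have := taueig_lb_approx M x n0; lra.
Qed.

End LowerBound.

(** * Means over the grid *)

Section Mean.
Context {R : realType}.
Local Notation C := R[i].
Local Notation T2 := (measurableTypeR R * measurableTypeR R)%type.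
Local Notation Ib g := (\int[leb2]_(x in boxpi) g x).

Lemma cvg_le_eps (u : nat -> R) (l : R) :
  (forall e, 0 < e -> exists n0, forall n, (n0 <= n)%N -> `|l - u n| <= e) ->
  u n @[n --> \oo] --> l.
Proof.
move=> H; apply/cvgrPdist_le => e e0; have [n0 Hn] := H e e0.
by exists n0 => // n /= ; exact: Hn.
Qed.

Lemma cvg_eps (u : nat -> R) (l : R) : u n @[n --> \oo] --> l ->
  forall e, 0 < e -> exists n0, forall n, (n0 <= n)%N -> `|l - u n| <= e.
Proof.
by move=> /cvgrPdist_le H e /H [n0 _ Hn]; exists n0 => n /Hn.
Qed.

(** By [sum_cos_grid] the sum is 0 or -1 for k > 0 and n large, so the mean is at most 1 / n in
    modulus. *)
Lemma grid_mean_cos k : (n%:R^-1 * \sum_(j < n) cos (k%:R * node n j) : R) @[n --> \oo] --> ((k == 0%N)%:R : R).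
Proof.
apply: cvg_le_eps => e e0; have [->|k0] := posnP k.
  exists 1%N => n n1; under eq_bigr do rewrite mul0r cos0.
  by rewrite sumr_const card_ord mulVf ?subrr ?normr0 ?(ltW e0) // pnatr_eq0 -lt0n.
have [n0 Hn] := bound_nat e^-1.
exists (maxn n0 k.+1) => n; rewrite geq_max => /andP[/Hn h1 h2].
rewrite [X in X - _](_ : _ = 0) // sub0r normrN sum_cos_grid; last by lia.
have nn : 0 < n%:R :> R by rewrite ltr0n; lia.
rewrite normrM ger0_norm ?invr_ge0 // mulrC ler_pdivrMr //.
apply: (@le_trans _ _ 1); last by rewrite -ler_pdivrMl // mulr1.
rewrite normrN -signr_odd; case: (odd k); rewrite /= ?expr1 ?expr0 ?subrr ?mul0r ?normr0 ?ler01 //.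
by rewrite divff // normr1.
Qed.

Lemma coscos_mean k1 k2 : ((n * n)%:R^-1 * \sum_(j < n * n) coscos k1 k2 (grid j) : R) @[n --> \oo] -->
  ((k1 == 0%N)%:R * (k2 == 0%N)%:R : R).
Proof.
have E : (fun n => (n * n)%:R^-1 * \sum_(j < n * n) coscos k1 k2 (grid j) : R) =
  (fun n => (n%:R^-1 * \sum_(j < n) cos (k1%:R * node n j)) * (n%:R^-1 * \sum_(j < n) cos (k2%:R * node n j))).
  apply/funext => n; rewrite natrM invfM.
  rewrite (sum_unindex (fun j1 j2 : 'I_n => cos (k1%:R * node n j1) * cos (k2%:R * node n j2))).
  rewrite mulrACA; congr (_ * _); rewrite mulr_suml; apply: eq_bigr => j _.
  by rewrite mulr_sumr.
rewrite E; apply: cvgM; exact: grid_mean_cos.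
Qed.

Lemma cvg_sumP m (u : nat -> nat -> R) (l : nat -> R) :
  (forall k, u k n @[n --> \oo] --> l k) ->
  \sum_(k < m) u k n @[n --> \oo] --> \sum_(k < m) l k.
Proof.
move=> H; elim: m => [|m IH].
  by rewrite big_ord0; under eq_fun do rewrite big_ord0; exact: cvg_cst.
by rewrite big_ord_recr; under eq_fun do rewrite big_ord_recr; exact: cvgD.
Qed.

(** The nodes lie in the quarter (0, pi)^2 of the domain. Evenness accounts for the other quarters:
    the mean over the nodes and the mean over the whole square both retain only the constant cosine
    coefficient. *)
Lemma grid_mean_poly (p : {poly R}) :
  ((n * n)%:R^-1 * \sum_(j < n * n) p.[yv (grid j)] : R) @[n --> \oo] --> pcoef p 0 0.
Proof.
pose N := (size p).+1.
have E : (fun n => (n * n)%:R^-1 * \sum_(j < n * n) p.[yv (grid j)] : R) =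
  (fun n => \sum_(k1 < N) \sum_(k2 < N) (pcoef p k1 k2 * (weight k1 * weight k2)) * ((n * n)%:R^-1 * \sum_(j < n * n) coscos k1 k2 (grid j))).
  apply/funext => n.
  under eq_bigr do rewrite -(@taueig_poly _ p N) ?leqnSn //.
  rewrite /taueig exchange_big mulr_sumr; apply: eq_bigr => k1 _ /=.
  rewrite exchange_big mulr_sumr; apply: eq_bigr => k2 _ /=.
  rewrite mulrCA; congr (_ * _); rewrite mulr_sumr; apply: eq_bigr => j _.
  by have := cosw_coscos k1 k2 (grid j); rewrite /= => ->; rewrite mulrA.
have L : pcoef p 0 0 = \sum_(k1 < N) \sum_(k2 < N) (pcoef p k1 k2 * (weight k1 * weight k2)) * ((k1 == 0%N :> nat)%:R * (k2 == 0%N :> nat)%:R).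
  rewrite big_ord_recl [X in _ + X]big1 ?addr0; last first.
    by move=> k1 _; rewrite big1 // => k2 _; rewrite /= mul0r mulr0.
  rewrite big_ord_recl [X in _ + X]big1 ?addr0; last first.
    by move=> k2 _; rewrite /= !mulr0.
  by rewrite /= /weight /= !mulr1.
rewrite E L.
apply: (@cvg_sumP N (fun k1 n => \sum_(k2 < N) (pcoef p k1 k2 * (weight k1 * weight k2)) * ((n * n)%:R^-1 * \sum_(j < n * n) coscos k1 k2 (grid j)))
  (fun k1 => \sum_(k2 < N) (pcoef p k1 k2 * (weight k1 * weight k2)) * ((k1 == 0%N :> nat)%:R * (k2 == 0%N :> nat)%:R))) => k1.
apply: (@cvg_sumP N (fun k2 n => (pcoef p k1 k2 * (weight k1 * weight k2)) * ((n * n)%:R^-1 * \sum_(j < n * n) coscos k1 k2 (grid j)))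
  (fun k2 => (pcoef p k1 k2 * (weight k1 * weight k2)) * ((k1 == 0%N :> nat)%:R * (k2 == 0%N :> nat)%:R))) => k2.
by apply: cvgM; [exact: cvg_cst | exact: coscos_mean].
Qed.

Lemma Ib_poly (p : {poly R}) : Ib (fun x => p.[yv x]) = (2 * pi) ^+ 2 * pcoef p 0 0.
Proof.
rewrite /pcoef /fre mulVKf; last by rewrite expf_neq0 // mulf_neq0 // gt_eqF ?pi_gt0.
by apply: eq_Rintegral => x _; rewrite !mul0r addr0 cos0 mulr1.
Qed.

Context (alpha : R).
Context (ha : 1 < alpha < 2).
Local Notation talpha := (talpha alpha).
Local Notation tmax := (tmax alpha).
Local Notation tpoly := (tpoly alpha).
Local Notation terr := (terr alpha).

Lemma unif_contR (g : R -> R) a b e : continuous g -> 0 < e ->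
  exists2 d : R, 0 < d & forall x y, a <= x <= b -> `|x - y| < d -> `|g x - g y| < e.
Proof.
move=> gc e0; have [d d0 H] := @unif_cont_on _ R R g [set` `[a, b]] e gc (@segment_compact _ a b) e0.
by exists d => // x y xab xy; apply: H => //=; rewrite in_itv.
Qed.

(** Two approximations: [tpoly M] replaces the symbol inside [g], then Bernstein's theorem on [0, 1]
    replaces the resulting continuous function of y by a polynomial. *)
Lemma talpha_poly_approx (g : R -> R) e : continuous g -> 0 < e ->
  exists p : {poly R}, forall x, `|g (talpha x) - p.[yv x]| <= e.
Proof.
move=> gc e0; have e4 : 0 < e / 4 by rewrite divr_gt0.
have [d d0 Hd] := @unif_contR g 0 tmax _ gc e4.
have [M HM] : exists M, terr M <= d / 2.
  by have [M HM] := @terr_cvg R alpha ha _ (divr_gt0 d0 (ltr0Sn R 1)); exists M; exact: HM.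
pose f y := g (tpoly M).[y].
have fc : continuous f.
  move=> y; apply: continuous_comp; last exact: gc.
  exact: continuous_horner.
have [d' d'0 Hd'] := @unif_contR f 0 1 _ fc e4.
have [B HB] : exists B, forall x, 0 <= x <= 1 -> `|f x| <= B.
  have [|c _ Hc] := @EVT_max R (fun x => `|f x|) 0 1 ler01.
    apply: continuous_subspaceT => x; apply: (continuous_comp (fc x)); exact: norm_continuous.
  by exists `|f c| => x x01; apply: Hc; rewrite in_itv.
have [p Hp] := @bernstein R f B (e / 4) d' e4 d'0 HB (fun x y x01 y01 xy => ltW (Hd' x y x01 xy)).
exists p => x; have h1 := Hp _ (yv01 x).
have h2 : `|g (talpha x) - f (yv x)| < e / 4.
  apply: Hd; first by rewrite talpha_ge0 talpha_le.
  apply: le_lt_trans (talpha_tpoly ha M x) _; apply: le_lt_trans HM _.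
  by rewrite ltr_pdivrMr // ltr_pMr // ltr1n.
have -> : g (talpha x) - p.[yv x] = (g (talpha x) - f (yv x)) + (f (yv x) - p.[yv x]) by ring.
by apply: le_trans (ler_normD _ _) _; move: h1 h2; lra.
Qed.

Lemma bmeas_comp_talpha (g : R -> R) : continuous g -> @bmeas _ _ T2 (fun x => g (talpha x)).
Proof.
move=> gc; have [mt _] := bmeas_talpha ha; split.
  by apply: (measurableT_comp (f := g)) => //; exact: continuous_measurable_fun.
have [p Hp] := @talpha_poly_approx g 1 gc ltr01.
have [_ [B HB]] := @bmeas_poly R p.
exists (1 + B) => x; rewrite -[g _](subrK p.[yv x]).
by apply: le_trans (ler_normD _ _) _; rewrite lerD.
Qed.

Lemma grid_mean_continuous (g : R -> R) : continuous g ->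
  ((n * n)%:R^-1 * \sum_(j < n * n) g (talpha (grid j)) : R) @[n --> \oo] -->
  ((2 * pi) ^+ 2)^-1 * Ib (fun x => g (talpha x)).
Proof.
move=> gc; apply: cvg_le_eps => e e0.
have e4 : 0 < e / 4 by rewrite divr_gt0.
have [p Hp] := talpha_poly_approx gc e4.
have [n0 Hn] := cvg_eps (@grid_mean_poly p) e4.
exists n0.+1 => n h; have {}Hn := Hn n (ltnW h).
have n1 : 0 < (n * n)%:R :> R by rewrite ltr0n muln_gt0; lia.
have h1 : `|((2 * pi) ^+ 2)^-1 * Ib (fun x => g (talpha x)) - pcoef p 0 0| <= e / 4.
  have -> : pcoef p 0 0 = ((2 * pi) ^+ 2)^-1 * Ib (fun x => p.[yv x]).
    by rewrite Ib_poly mulKf // expf_neq0 // mulf_neq0 // gt_eqF ?pi_gt0.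
  have bp := @bmeas_poly R p; have bg := bmeas_comp_talpha gc.
  have bp' : @bmeas _ _ T2 (fun x => (-1) * p.[yv x]) by apply: bmeasM => //; exact: bmeas_cst.
  rewrite -mulrBr -[Ib (fun x => p.[yv x])]mul1r -mulNr -IbZ // -IbD //.
  rewrite normrM ger0_norm ?invr_ge0 ?sqr_ge0 // -[leRHS]mean_pi_cst.
  rewrite ler_wpM2l ?invr_ge0 ?sqr_ge0 // Ib_bound //; first exact: bmeasD.
  by move=> x; rewrite mulN1r.
have h2 : `|(n * n)%:R^-1 * \sum_(j < n * n) p.[yv (grid j)] - (n * n)%:R^-1 * \sum_(j < n * n) g (talpha (grid j))| <= e / 4.
  rewrite -mulrBr -sumrB normrM ger0_norm ?invr_ge0 // mulrC ler_pdivrMr //.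
  apply: le_trans (ler_norm_sum _ _ _) _.
  apply: (@le_trans _ _ (\sum_(j < n * n) e / 4)).
    by apply: ler_sum => j _; rewrite distrC.
  by rewrite sumr_const card_ord mulr_natr.
apply: le_trans (ler_distD (pcoef p 0 0) _ _) _.
have := ler_distD ((n * n)%:R^-1 * \sum_(j < n * n) p.[yv (grid j)]) (pcoef p 0 0)
  ((n * n)%:R^-1 * \sum_(j < n * n) g (talpha (grid j))).
by move: h1 h2 Hn; move: `|_| `|_| `|_| `|_| => u v w t; lra.
Qed.

End Mean.

(** * Low rank plus small Frobenius norm *)

Section LowRank.
Local Open Scope sesquilinear_scope.
Context {R : realType}.
Local Notation C := R[i].
Implicit Types A B Y Z : mxseq R.

Definition lowsum n (Z : 'M[C]_(n * n)) (r k : R) := exists Rk K : 'M[C]_(n * n),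
  [/\ Z = Rk + K, (\rank Rk)%:R <= r * (n * n)%:R & frob2 K <= k * (n * n)%:R].

(** The zero-distributed sequences of GLT theory, with the squared Frobenius norm in place of the
    spectral norm; [lowsum_specnorm] translates between the two. *)
Definition acs_null Z := forall e, 0 < e -> exists n0, forall n, (n0 <= n)%N -> lowsum (Z n) e e.

Lemma lowsumD n (Y Z : 'M[C]_(n * n)) r k r' k' : lowsum Y r k -> lowsum Z r' k' ->
  lowsum (Y + Z) (r + r') (2 * (k + k')).
Proof.
move=> [R1 [K1 [-> r1 k1]]] [R2 [K2 [-> r2 k2]]].
exists (R1 + R2), (K1 + K2); split; first by rewrite addrACA.
  rewrite mulrDl; apply: le_trans (lerD r1 r2); rewrite -natrD ler_nat.
  exact: mxrank_add.
by apply: le_trans (frob2D _ _) _; rewrite -mulrA ler_wpM2l // mulrDl lerD.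
Qed.

Lemma lowsum_le n (Z : 'M[C]_(n * n)) r k r' k' : r <= r' -> k <= k' -> lowsum Z r k -> lowsum Z r' k'.
Proof.
move=> rr kk [R1 [K1 [-> r1 k1]]]; exists R1, K1; split => //.
  by apply: le_trans r1 _; rewrite ler_wpM2r.
by apply: le_trans k1 _; rewrite ler_wpM2r.
Qed.

Lemma acs_nullD Y Z : acs_null Y -> acs_null Z -> acs_null (fun n => Y n + Z n).
Proof.
move=> nY nZ e e0; have e4 : 0 < e / 4 by rewrite divr_gt0.
have [n1 H1] := nY _ e4; have [n2 H2] := nZ _ e4.
exists (maxn n1 n2) => n; rewrite geq_max => /andP[/H1 h1 /H2 h2].
by apply: lowsum_le (lowsumD h1 h2); lra.
Qed.

Lemma lowsum_frob n (Z : 'M[C]_(n * n)) e : 0 <= e -> frob2 Z <= e * (n * n)%:R -> lowsum Z e e.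
Proof.
move=> e0 h; exists 0, Z; split; rewrite ?add0r // mxrank0.
by rewrite mulr_ge0.
Qed.

Lemma acs_null_frob Z : (forall e, 0 < e -> exists n0, forall n, (n0 <= n)%N -> frob2 (Z n) <= e * (n * n)%:R) ->
  acs_null Z.
Proof.
move=> H e e0; have [n0 Hn] := H e e0; exists n0 => n /Hn.
by apply: lowsum_frob; exact: ltW.
Qed.

Lemma rank_adj n (A : 'M[C]_n) : \rank (A^t*) = \rank A.
Proof. by rewrite mxrank_map mxrank_tr. Qed.

Lemma lowsum_adj n (Z : 'M[C]_(n * n)) r k : lowsum Z r k -> lowsum (Z^t*) r k.
Proof.
move=> [R1 [K1 [-> r1 k1]]]; exists (R1^t*), (K1^t*); split.
- by rewrite adjD.
- by rewrite rank_adj.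
- by rewrite frob2_adj.
Qed.

Lemma rankM_le n (A B D : 'M[C]_n) : (\rank (A *m B *m D) <= \rank B)%N.
Proof. by apply: leq_trans (mxrankM_maxl _ _) _; exact: mxrankM_maxr. Qed.

Lemma lowsum_unitary n (U V Z : 'M[C]_(n * n)) r k : U \is unitarymx -> V \is unitarymx ->
  lowsum Z r k -> lowsum (U *m Z *m V) r k.
Proof.
move=> Uu Vu [R1 [K1 [-> r1 k1]]]; exists (U *m R1 *m V), (U *m K1 *m V); split.
- by rewrite mulmxDr mulmxDl.
- by apply: le_trans r1; rewrite ler_nat rankM_le.
- by rewrite (frob2_unitaryr _ Vu) (frob2_unitaryl _ (erefl _) Uu).
Qed.

(** In the Gram matrix of R1 + K1 every product except that of K1 with itself contains R1 and costs
    only rank; the remaining one is split by [gram_low_rank]. *)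
Lemma lowsum_gram n (Z : 'M[C]_(n * n)) r k : lowsum Z r k ->
  lowsum (Z^t* *m Z) (r + r + k) k.
Proof.
move=> [R1 [K1 [-> r1 k1]]].
have [R2 [K2 [E r2 k2]]] := gram_low_rank K1.
exists ((R1^t*) *m (R1 + K1) + (K1^t*) *m R1 + R2), K2; split.
- by rewrite adjD mulmxDl (mulmxDr (K1^t*)) E !addrA.
- apply: (@le_trans _ _ ((\rank R1)%:R + (\rank R1)%:R + (\rank R2)%:R)).
    rewrite -!natrD ler_nat; apply: leq_trans (mxrank_add _ _) _; rewrite leq_add2r.
    apply: leq_trans (mxrank_add _ _) _; apply: leq_add; last exact: mxrankM_maxr.
    by apply: leq_trans (mxrankM_maxl _ _) _; rewrite rank_adj.
  by rewrite !mulrDl !lerD // (le_trans r2).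
- exact: le_trans k2 k1.
Qed.

Lemma eigvals_perm n (A : 'M[C]_n) (z : 'I_n -> C) :
  char_poly A = \prod_i ('X - (z i)%:P) -> perm_eq (eigvals A) [seq z i | i : 'I_n].
Proof.
by move=> h; apply: charpoly_roots h; exact: (svalP (closed_field_poly_normal (char_poly A))).
Qed.

Lemma sum_eigvals (V : nmodType) n (A : 'M[C]_n) (z : 'I_n -> C) (F : C -> V) :
  char_poly A = \prod_i ('X - (z i)%:P) -> \sum_(x <- eigvals A) F x = \sum_i F (z i).
Proof. by move=> /eigvals_perm h; rewrite (perm_big _ h) /= big_map big_enum. Qed.

Lemma singvals_perm n (A : 'M[C]_n) (d : 'I_n -> R) :
  char_poly (A^t* *m A) = \prod_i ('X - ((d i)%:C)%:P) ->
  perm_eq (singvals A) [seq Num.sqrt (d i) | i : 'I_n].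
Proof.
rewrite -map_trmx => /eigvals_perm /(perm_map (fun z => Num.sqrt (complex.Re z))).
by rewrite /singvals -[X in perm_eq _ X]map_comp.
Qed.

Lemma sum_singvals (V : nmodType) n (A : 'M[C]_n) (d : 'I_n -> R) (F : R -> V) :
  char_poly (A^t* *m A) = \prod_i ('X - ((d i)%:C)%:P) ->
  \sum_(x <- singvals A) F x = \sum_i F (Num.sqrt (d i)).
Proof. by move=> /singvals_perm h; rewrite (perm_big _ h) /= big_map big_enum. Qed.

Lemma specnorm_le n (A : 'M[C]_n) (d : 'I_n -> R) t : 0 <= t ->
  char_poly (A^t* *m A) = \prod_i ('X - ((d i)%:C)%:P) ->
  (forall i, 0 <= d i <= t ^+ 2) -> specnorm A <= t.
Proof.
move=> t0 h dt; rewrite /specnorm (perm_big _ (singvals_perm h)) /= big_map.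
apply: (big_ind (fun x => x <= t)) => //; first by move=> x y; rewrite ge_max => -> ->.
by move=> i _; rewrite -(ger0_norm t0) -sqrtr_sqr ler_wsqrtr //; case/andP: (dt i).
Qed.

(** Singular values above a are moved into the rank, that is, Gram eigenvalues above a^2. A squared
    norm of a^3 n^2 allows at most a n^2 of them, which explains the cube and the factor 2. *)
Lemma lowsum_specnorm n (Z : 'M[C]_(n * n)) a : 0 < a -> lowsum Z a (a ^+ 3) ->
  exists Rk N : 'M[C]_(n * n), [/\ Z = Rk + N, (\rank Rk)%:R <= 2 * a * (n * n)%:R & specnorm N <= a].
Proof.
move=> a0 [R1 [K1 [-> r1 k1]]].
have a2 : 0 < a ^+ 2 by rewrite exprn_gt0.
have [R2 [N [d [KE r2 hN dN]]]] := low_rank_small_norm K1 a2.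
exists (R1 + R2), N; split; first by rewrite KE addrA.
  apply: (@le_trans _ _ ((\rank R1)%:R + (\rank R2)%:R)); first by rewrite -natrD ler_nat mxrank_add.
  rewrite -mulrA mulr2n mulrDl !mul1r; apply: lerD r1 _.
  by have := le_trans r2 k1; rewrite (exprSr a 2) -(mulrA (a ^+ 2)) ler_pM2l.
exact: specnorm_le (ltW a0) hN dN.
Qed.

Lemma harmonic_scale_cvg (c : R) : (fun m => c * m.+1%:R^-1) @ \oo --> (0 : R).
Proof.
rewrite -(mulr0 c); apply: cvgM; first exact: cvg_cst.
exact: cvg_harmonic.
Qed.

(** The rates are those of [lowsum_specnorm] at a = 1 / (m + 1). *)
Lemma acsP (B : forall n : nat, nat -> 'M[C]_(n * n)) A :
  (forall m, exists n0, forall n, (n0 <= n)%N ->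
     lowsum (A n - B n m) (m.+1%:R^-1) (m.+1%:R^-1 ^+ 3)) -> acs B A.
Proof.
move=> H; have [n_ Hn] := choice H.
exists n_, (fun m => 2 * m.+1%:R^-1), (fun m => m.+1%:R^-1); split.
- exact: harmonic_scale_cvg.
- have := harmonic_scale_cvg 1; by under eq_fun do rewrite mul1r.
- move=> m n /Hn h.
  have m0 : 0 < m.+1%:R^-1 :> R by rewrite invr_gt0 ltr0Sn.
  have [Rk [N [E r1 n1]]] := lowsum_specnorm m0 h.
  by exists Rk, N; split => //; rewrite -addrA -E addrC subrK.
Qed.

Definition bad n (z : 'I_n -> C) (l : C) (e : R) := #|[pred i | e < nrm2 (z i - l)]|.

Lemma count_lowsum n (z : 'I_(n * n) -> C) e r k : 0 < e ->
  lowsum (diag_mx (\row_i z i)) r k ->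
  (bad z 0 e)%:R <= (r + e^-1 * k) * (n * n)%:R.
Proof.
move=> e0 [R1 [K1 [E r1 k1]]].
have -> : bad z 0 e = #|[pred i | e < nrm2 (z i)]|.
  by apply: eq_card => i; rewrite !inE subr0.
apply: le_trans (count_low_rank e0 E) _.
by rewrite mulrDl -mulrA lerD // ler_wpM2l ?invr_ge0 // ltW.
Qed.

Definition clustered (z : forall n, 'I_(n * n) -> C) (l : C) :=
  forall e r : R, 0 < e -> 0 < r -> exists n0, forall n, (n0 <= n)%N ->
    (bad (z n) l e)%:R <= r * (n * n)%:R.

Lemma acs_null_clustered (z : forall n, 'I_(n * n) -> C) (l : C) :
  acs_null (fun n => diag_mx (\row_i (z n i - l))) -> clustered z l.
Proof.
move=> nz e r e0 r0.
have q0 : 0 < r / (1 + e^-1) by rewrite divr_gt0 // addr_gt0 // invr_gt0.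
have [n0 Hn] := nz _ q0; exists n0 => n /Hn h.
have := count_lowsum e0 h.
have -> : bad (fun i => z n i - l) 0 e = bad (z n) l e.
  by apply: eq_card => i; rewrite !inE subr0.
move=> /le_trans; apply.
have -> : r / (1 + e^-1) + e^-1 * (r / (1 + e^-1)) = r.
  by field; rewrite ?gt_eqF ?addr_gt0 ?e0.
by [].
Qed.

End LowRank.

(** * Continuous functions of a complex variable *)

Section ComplexTests.
Local Open Scope sesquilinear_scope.
Context {R : realType}.
Local Notation C := R[i].
Local Notation T2 := (measurableTypeR R * measurableTypeR R)%type.

Lemma lmeasurable_measurable (d : measure_display) (T : measurableType d) (mu : set T -> \bar R) (D : set T) (f : T -> R) :
  mu set0 = 0%E -> measurable D -> measurable_fun setT f -> lmeasurable_fun mu D f.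
Proof.
move=> mu0 mD mf Y mY; exists (D `&` f @^-1` Y) => /=; last first.
  exists set0; last by rewrite setU0.
  by exists set0; split.
by apply: measurableI => //; rewrite -[_ @^-1` _]setTI; exact: mf.
Qed.

Lemma normcE2 (z : C) : cabs z ^+ 2 = nrm2 z.
Proof. by case: z => a b; rewrite /nrm2 /= sqr_sqrtr // addr_ge0 ?sqr_ge0. Qed.

Lemma cabs_ge0 (z : C) : 0 <= cabs z.
Proof. by case: z => a b; exact: sqrtr_ge0. Qed.

Lemma normC_cabs (z : C) : `|z| = (cabs z)%:C.
Proof. by case: z. Qed.

Lemma cabs_lt (z : C) e : 0 < e -> (nrm2 z < e ^+ 2) = (cabs z < e).
Proof. by move=> e0; rewrite -normcE2 ltr_sqr ?nnegrE ?cabs_ge0 // ltW. Qed.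

Lemma cabs_le (z : C) e : 0 <= e -> (nrm2 z <= e ^+ 2) = (cabs z <= e).
Proof. by move=> e0; rewrite -normcE2 ler_sqr ?nnegrE ?cabs_ge0. Qed.

Lemma cabs_real (x : R) : cabs x%:C = `|x|.
Proof. by rewrite /= expr0n addr0 sqrtr_sqr. Qed.

Lemma cabs_ReIm (z : C) : cabs z <= `|complex.Re z| + `|complex.Im z|.
Proof.
rewrite -cabs_le ?addr_ge0 // /nrm2 -[complex.Re z ^+ 2]real_normK ?num_real //.
rewrite -[complex.Im z ^+ 2]real_normK ?num_real //.
have := normr_ge0 (complex.Re z); have := normr_ge0 (complex.Im z).
by move: `|_| `|_| => u v; nra.
Qed.

Lemma Re_cabs (z : C) : `|complex.Re z| <= cabs z.
Proof. by rewrite -ler_sqr ?nnegrE ?cabs_ge0 // normcE2 real_normK ?num_real // lerDl sqr_ge0. Qed.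
Lemma Im_cabs (z : C) : `|complex.Im z| <= cabs z.
Proof. by rewrite -ler_sqr ?nnegrE ?cabs_ge0 // normcE2 real_normK ?num_real // lerDr sqr_ge0. Qed.

Lemma complex_cvg (u : nat -> C) (l : C) :
  (forall e : R, 0 < e -> exists n0, forall n, (n0 <= n)%N -> cabs (l - u n) <= e) ->
  u n @[n --> \oo] --> l.
Proof.
move=> H; apply/cvgrPdist_le => e e0.
have [ei er] : complex.Im e = 0 /\ 0 < complex.Re e by move: e0; rewrite ltcE => /andP[/eqP].
have [n0 Hn] := H _ er.
exists n0 => // n /= /Hn; rewrite normC_cabs.
have {2}-> : e = (complex.Re e)%:C by case: (e) ei => a b /= ->.
by rewrite lecR.
Qed.

Lemma real_complex_cont : continuous (fun x : R => x%:C).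
Proof.
move=> x; apply/cvgrPdist_lt => e e0.
have [ei er] : complex.Im e = 0 /\ 0 < complex.Re e by move: e0; rewrite ltcE => /andP[/eqP].
near=> y; have : `|x - y| < complex.Re e.
  by near: y; apply: cvgr_dist_lt.
rewrite -rmorphB /= normC_cabs cabs_real => h.
have -> : e = (complex.Re e)%:C by case: (e) ei => a b /= ->.
by rewrite ltcR.
Unshelve. all: by end_near. Qed.

Lemma continuous_lip (g : C -> R) : (forall z w, `|g z - g w| <= cabs (z - w)) -> continuous g.
Proof.
move=> gL z A /nbhs_ballP [e e0 eA]; apply/nbhs_ballP; exists e%:C; first by rewrite /= ltcR.
move=> w; rewrite -ball_normE /= => h; apply: eA; rewrite -ball_normE /=.
by apply: le_lt_trans (gL z w) _; move: h; rewrite normC_cabs ltcR.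
Qed.

Lemma cabs_lip (z w : C) : `|cabs z - cabs w| <= cabs (z - w).
Proof. by rewrite -lecR -!normC_cabs -cabs_real -normC_cabs rmorphB /= -!normC_cabs ler_dist_dist. Qed.

Lemma cabs_cont : continuous (fun z : C => cabs z).
Proof. exact: continuous_lip cabs_lip. Qed.
Lemma Re_cont : continuous (fun z : C => complex.Re z).
Proof. by apply: continuous_lip => z w; rewrite -raddfB; exact: Re_cabs. Qed.
Lemma Im_cont : continuous (fun z : C => complex.Im z).
Proof. by apply: continuous_lip => z w; rewrite -raddfB; exact: Im_cabs. Qed.

Lemma complex_unif_cont (F : C -> C) (b e : R) : continuous F -> 0 < e ->
  exists2 d : R, 0 < d & forall (x : R) z, 0 <= x <= b -> nrm2 (z - x%:C) < d -> cabs (F z - F x%:C) < e.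
Proof.
move=> Fc e0; have eC : 0 < e%:C :> C by rewrite ltcR.
have Kc : compact ((fun x : R => x%:C) @` [set` `[0, b]]).
  apply: continuous_compact; last exact: segment_compact.
  by apply: continuous_subspaceT; exact: real_complex_cont.
have [d d0 H] := @unif_cont_on _ C C F _ _ Fc Kc eC.
have [di dr] : complex.Im d = 0 /\ 0 < complex.Re d by move: d0; rewrite ltcE => /andP[/eqP].
exists (complex.Re d ^+ 2); first by rewrite exprn_gt0.
move=> x z xb; rewrite cabs_lt // => h.
have : ball (F x%:C) e%:C (F z).
  apply: H; first by exists x => //=; rewrite in_itv.
  have -> : d = (complex.Re d)%:C by case: (d) di => a b' /= ->.
  by rewrite -ball_normE /= normC_cabs ltcR -opprB normcN.
by rewrite -ball_normE /= normC_cabs ltcR -opprB normcN.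
Qed.

Lemma bounded_cs (V : topologicalType) (F : V -> C) : continuous F -> compact_support F -> exists B, forall z, cabs (F z) <= B.
Proof.
move=> Fc Fs.
have [B HB] : exists B : R, forall z, closure [set x | F x != 0] z -> cabs (F z) <= B.
  have Ic : compact ((fun z => cabs (F z)) @` closure [set x | F x != 0]).
    apply: continuous_compact => //; apply: continuous_subspaceT => z.
    by apply: (continuous_comp (Fc z)); exact: cabs_cont.
  have [B [_ HB]] := compact_bounded Ic.
  exists (B + 1) => z hz; have := HB (B + 1); rewrite ltrDl ltr01 => /(_ isT) /(_ (cabs (F z))).
  by move=> /(_ (ex_intro2 _ _ z hz erefl)) /=; rewrite ger0_norm ?cabs_ge0.
exists (Num.max B 0) => z; have [->|Fz] := eqVneq (F z) 0.
  by rewrite Normc.normc0 le_max lexx orbT.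
by rewrite le_max HB //; exact: subset_closure.
Qed.

(** Boundedness of [F] tames the outliers: each costs at most 2 B however large it is, and their
    share tends to 0. *)
Lemma cluster_limit (z : forall n, 'I_(n * n) -> C) (l : C) (F : C -> C) (B : R) :
  clustered z l -> (forall w, cabs (F w) <= B) ->
  (forall e : R, 0 < e -> exists2 d : R, 0 < d & forall w, nrm2 (w - l) <= d -> cabs (F w - F l) <= e) ->
  ((n * n)%:R^-1 * \sum_j F (z n j)) @[n --> \oo] --> F l.
Proof.
move=> zc FB Fl; apply: complex_cvg => e e0.
have B0 : 0 <= B by apply: le_trans (FB 0); exact: cabs_ge0.
have e2 : 0 < e / 2 by rewrite divr_gt0.
have [d d0 Hd] := Fl _ e2.
have r0 : 0 < e / 2 / (2 * B + 1) by rewrite divr_gt0 // ltr_wpDl // mulr_ge0.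
have [n0 Hn] := zc d _ d0 r0.
exists n0.+1 => n h; have {}Hn := Hn n (ltnW h).
have n_gt0 : (0 < n)%N by exact: leq_ltn_trans (leq0n _) h.
have n1 : 0 < (n * n)%:R :> R by rewrite ltr0n muln_gt0 n_gt0.
have n1C : (n * n)%:R != 0 :> C by rewrite pnatr_eq0 muln_eq0 orbb -lt0n.
have -> : F l - (n * n)%:R^-1 * \sum_j F (z n j) = (n * n)%:R^-1 * \sum_j (F l - F (z n j)).
  by rewrite sumrB sumr_const card_ord mulrBr -[X in _ * X - _]mulr_natl mulKf.
rewrite Normc.normcM.
have -> : cabs ((n * n)%:R^-1 : C) = (n * n)%:R^-1.
  by rewrite -[(n * n)%:R]/((n * n)%:R) -(rmorph_nat (real_complex R)) -fmorphV cabs_real ger0_norm // invr_ge0.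
rewrite mulrC ler_pdivrMr //.
apply: (@le_trans _ _ (\sum_j cabs (F l - F (z n j)))).
  elim/big_ind2: _ => // [|x a y b ha hb]; first by rewrite Normc.normc0.
  by apply: le_trans (le_normcD _ _) _; rewrite lerD.
apply: (@le_trans _ _ (\sum_(j < n * n) (e / 2 + (2 * B) * (d < nrm2 (z n j - l))%R%:R))).
  apply: ler_sum => j _; have [hd|hd] := ltP d (nrm2 (z n j - l)).
    rewrite mulr1; apply: le_trans (le_normcD _ _) _; rewrite normcN.
    by have := FB l; have := FB (z n j); lra.
  by rewrite mulr0 addr0 -opprB normcN Hd.
rewrite big_split /= sumr_const card_ord -mulr_natr -mulr_sumr.
have -> : \sum_(j < n * n) (d < nrm2 (z n j - l))%R%:R = (bad (z n) l d)%:R :> R.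
  rewrite /bad -sum1_card natr_sum [RHS]big_mkcond /=.
  by apply: eq_bigr => j _; rewrite inE; case: (d < _)%R.
have : 2 * B * (bad (z n) l d)%:R <= e / 2 * (n * n)%:R.
  apply: (@le_trans _ _ (2 * B * (e / 2 / (2 * B + 1) * (n * n)%:R))).
    by rewrite ler_wpM2l // mulr_ge0.
  rewrite mulrA ler_wpM2r // mulrCA -[leRHS]mulr1 ler_wpM2l ?(ltW e2) //.
  by rewrite ler_pdivrMr ?mul1r ?lerDl // ltr_wpDl // mulr_ge0.
by lra.
Qed.

End ComplexTests.

(** * GLT sequences *)

Section GltTheta.
Local Open Scope sesquilinear_scope.
Context {R : realType}.
Local Notation C := R[i].
Local Notation T1 := (measurableTypeR R).
Local Notation T2 := (T1 * T1)%type.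

Lemma smooth_cst (k : R) : smooth (fun _ : R * R => k).
Proof.
have E (s : seq bool) : exists k', iter_partial s (fun _ : R * R => k) = (fun _ => k').
  elim: s => [|b s [k' IH]]; first by exists k.
  by exists 0; rewrite /= IH; apply/funext => x; exact: derive_cst.
move=> s; have [k' ->] := E s; split; first exact: cst_continuous.
by move=> x b; exact: derivable_cst.
Qed.

Lemma diag_sample1 n s : diag_sample n s (fun _ : R * R => 1) = 1%:M.
Proof. by apply/matrixP => i j; rewrite !mxE. Qed.

Lemma leb2_0 : leb2 (set0 : set T2) = 0%E.
Proof. exact: measure0. Qed.

Lemma leb4_0 : leb4 (set0 : set (T2 * T2)) = 0%E.
Proof.
apply: (@integral0_eq _ _ R (leb2 : {measure set T2 -> \bar R}) setT) => x _ /=.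
by rewrite xsection0 leb2_0.
Qed.

Lemma leb4_ext0 : (leb4^*)%mu (set0 : set (T2 * T2)) = 0%E.
Proof. by apply: mu_ext0; [exact: leb4_0 | move=> X; exact: integral_ge0]. Qed.

Lemma measurable_box4 : measurable ((@box01 R `*` @boxpi R) : set (T2 * T2)).
Proof. by apply: measurableX; [apply: measurableX; exact: measurable_itv | exact: measurable_boxpi]. Qed.

(** The single spatial factor is the constant 1, whose sampling matrix is the identity. Uniform
    approximation gives convergence in measure: the exceptional set is empty once 1 / (m + 1) <=
    eps. *)
Lemma GLT_theta (A : mxseq R) (psi : R * R -> R) (p : nat -> {poly R}) :
  @measurable_fun _ _ T2 T1 setT psi ->
  (forall m x, `|psi x - (p m).[yv x]| <= m.+1%:R^-1) ->
  (forall m, exists n0, forall n, (n0 <= n)%N ->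
     lowsum (A n - toep n (pcoef (p m))) (m.+1%:R^-1) (m.+1%:R^-1 ^+ 3)) ->
  GLT A (of_theta (fun x => (psi x)%:C)).
Proof.
move=> mpsi pp H; split.
  split; apply: lmeasurable_measurable => /=; try exact: leb4_0; try exact: measurable_box4.
    by apply: (measurableT_comp mpsi); exact: measurable_snd.
  exact: measurable_cst.
exists (fun=> 1%N), (fun _ _ _ => 1), (fun m _ x => ((p m).[yv x])%:C); split.
- move=> m i _; split; last exact: trig_poly_poly.
  by exists (fun=> 1), (fun=> 0); split => //; exact: smooth_cst.
- move=> e e0; have [n0 Hn] := bound_nat e^-1.
  apply: cvg_near_cst; exists n0 => // m /= /Hn hm.
  rewrite [X in mu_ext _ X](_ : _ = set0) ?leb4_ext0 //.
  apply/seteqP; split => // -[x y] /= [_]; apply/negP; rewrite -leNgt.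
  rewrite big_ord1 mul1r /of_theta -rmorphB cabs_real distrC; apply: le_trans (pp m y) _.
  rewrite -[leRHS]invrK lef_pV2 ?posrE ?invr_gt0 //; apply: le_trans hm _.
  by rewrite ler_nat.
- apply: acsP => m; have [n0 Hn] := H m; exists n0 => n /Hn.
  by rewrite big_ord1 diag_sample1 mul1mx (toeplitz2_toep n (has_coefs_poly (p m))).
Qed.
End GltTheta.

(** * The preconditioner *)

Section Preconditioner.
Local Open Scope sesquilinear_scope.
Context {R : realType} (alpha : R) (ha : 1 < alpha < 2) (shift : nat -> R[i]).
Context (shift0 : forall e : R, 0 < e -> exists n0, forall n, (n0 <= n)%N -> nrm2 (shift n) <= e).
Local Notation C := R[i].
Local Notation T1 := (measurableTypeR R).
Local Notation T2 := (T1 * T1)%type.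
Local Notation talpha := (talpha alpha).
Local Notation tcoef := (tcoef alpha).

Lemma frob2_scalar k (a : C) : frob2 (a%:M : 'M[C]_k) = nrm2 a * k%:R.
Proof.
rewrite -diag_const_mx frob2_diag; under eq_bigr do rewrite mxE.
by rewrite sumr_const card_ord mulr_natr.
Qed.

Definition pval n (j : 'I_(n * n)) : C := (taueig n tcoef (grid j).1 (grid j).2)%:C + shift n.
(** Covers both preconditioners: the shift is either 0 or h^alpha mubar, and tends to 0 in both
    cases. *)
Definition prec n : 'M[C]_(n * n) := tauc n tcoef + (shift n)%:M.

Lemma precE n : prec n = sine2 n *m diag_mx (\row_j pval j) *m sine2 n.
Proof.
have -> : diag_mx (\row_j pval j) = diagR (fun j => taueig n tcoef (grid j).1 (grid j).2) + (shift n)%:M :> 'M[C]_(n * n).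
  by apply/matrixP => i j; rewrite !mxE mulrnDl.
by rewrite mulmxDr mulmxDl scalar_mxC -(mulmxA (shift n)%:M) sine2_sqr mulmx1.
Qed.

Lemma pval_close (e : R) : 0 < e -> exists n0, forall n (j : 'I_(n * n)), (n0 <= n)%N ->
  nrm2 (pval j - (talpha (grid j))%:C) <= e.
Proof.
move=> e0; have d0 : 0 < Num.min 1 (e / 16) by rewrite lt_min ltr01 divr_gt0.
have [M0 HM] := terr_cvg ha d0; have {HM} := HM _ (leqnn _).
rewrite le_min => /andP[M1 M16].
have [n0 Hn] := shift0 (divr_gt0 e0 (ltr0Sn R 3)).
exists (maxn n0 (size (tpoly alpha M0))) => n j; rewrite geq_max => /andP[/Hn h1 h2].
have E0 := terr_ge0 ha M0.
have := taueig_tcoef ha (grid j) h2; have := talpha_tpoly ha M0 (grid j); rewrite /pval.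
set l := taueig _ _ _ _; set t := talpha _; set p := _.[_]; move=> htp hlp.
rewrite addrAC -rmorphB; apply: le_trans (nrm2D _ _) _; rewrite nrm2_real.
have h : `|l - t| <= 2 * terr alpha M0.
  by rewrite -(subrKA p) (le_trans (ler_normD _ _)) // (distrC p); lra.
have : (l - t) ^+ 2 <= e / 4.
  by rewrite -real_normK ?num_real //; have := normr_ge0 (l - t); move: `|l - t| h => x; nra.
by lra.
Qed.

(** The link between [prec] and the Toeplitz matrix of [tpoly M] is the tau matrix of [tpoly M]: the
    l1 error of the coefficients controls the distance to the first, and finite support the distance
    to the second. *)
Lemma GLT_prec : GLT prec (of_theta (t_alpha alpha)).
Proof.
have hm_gt0 m : 0 < m.+1%:R^-1 :> R by rewrite invr_gt0 ltr0Sn.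
have hm_le1 m : m.+1%:R^-1 <= 1 :> R by rewrite invf_le1 ?ltr0Sn // ler1n.
(* The error enters squared: with h = 1 / (m + 1) <= 1 this choice leaves h^4 / 16 <= h^3 / 16. *)
have HM m : exists M, terr alpha M <= m.+1%:R^-1 ^+ 2 / 4.
  have e0 : 0 < m.+1%:R^-1 ^+ 2 / 4 :> R by rewrite divr_gt0 ?exprn_gt0.
  by have [M0 H] := terr_cvg ha e0; exists M0; exact: H.
have [M_ {}HM] := choice HM.
apply: (@GLT_theta _ prec talpha (fun m => tpoly alpha (M_ m))).
- exact: (bmeas_talpha ha).1.
- move=> m x; apply: le_trans (talpha_tpoly ha _ _) _; apply: le_trans (HM m) _.
  by have := hm_gt0 m; have := hm_le1 m; move: (m.+1%:R^-1) => h; nra.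
move=> m; set p := tpoly _ _; set h := m.+1%:R^-1.
have [h0 h1] : 0 < h /\ h <= 1 by split; [exact: hm_gt0 | exact: hm_le1].
have h3 : 0 < h ^+ 3 by rewrite exprn_gt0.
have [K HK] := toep_tauc_finsupp (@pcoef_supp R p).
have [n1 Hn1] := linear_le_square K (divr_gt0 h3 (ltr0Sn R 7)).
have [n2 Hn2] := shift0 (divr_gt0 h3 (ltr0Sn R 15)).
exists (maxn (size p) (maxn n1 n2)) => n; rewrite !geq_max => /and3P[/HK k0 /Hn1 k1 /Hn2 k2].
apply: (@lowsum_le _ _ _ (h ^+ 3) (h ^+ 3)) => //.
  by rewrite -[leRHS]mulr1 exprS ler_wpM2l ?(ltW h0) // exprn_ile1 // ltW.
apply: lowsum_frob; first exact: ltW.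
have -> : prec n - toep n (pcoef p) = (tauc n (sub_coefs tcoef (pcoef p)) + (shift n)%:M) + - (toep n (pcoef p) - tauc n (pcoef p)).
  by rewrite taucB /prec opprB [in RHS]addrA; congr (_ - _); rewrite addrAC subrK.
apply: le_trans (frob2D _ _) _; rewrite frob2N.
have k3 := frob2D (tauc n (sub_coefs tcoef (pcoef p))) (shift n)%:M.
have k4 := frob2_tauc n (sub_coefs tcoef (pcoef p)).
have k5 : l1 n (sub_coefs tcoef (pcoef p)) ^+ 2 <= h ^+ 3 / 16.
  have := l1_tcoef ha (M_ m) n; have := HM m; rewrite -/h -/p; have := l1_ge0 n (sub_coefs tcoef (pcoef p)).
  move: (l1 _ _) (terr _ _) => a b a0 bh ab.
  apply: (@le_trans _ _ ((h ^+ 2 / 4) ^+ 2)).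
    by rewrite ler_sqr ?nnegrE // ?(le_trans ab) // divr_ge0 // exprn_ge0 // ltW.
  by rewrite expr_div_n -exprM (_ : 4 ^+ 2 = 16 :> R) ?ler_wpM2r // -?natrX // exprS -[leRHS]mul1r ler_wpM2r // ltW.
move: k3; rewrite frob2_scalar => k3.
have N0 : 0 <= (n * n)%:R :> R by [].
have k6 := ler_wpM2r N0 k5; have k7 := ler_wpM2r N0 k2.
set q := h ^+ 3 in k1 k6 k7 *; set N := (n * n)%:R in k1 k3 k4 k6 k7 *.
have k8 : 2 * (2 * (q / 16 * N + q / 16 * N) + q / 8 * N) <= q * N.
  have qN : 0 <= q * N by rewrite mulr_ge0 // ltW.
  by lra.
by lra.
Qed.

End Preconditioner.

(** * Matrices diagonalized by the two-level sine transform *)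

Section SineDiagonal.
Local Open Scope sesquilinear_scope.
Context {R : realType} (n : nat).
Local Notation C := R[i].
Implicit Types d e : 'I_(n * n) -> C.

Definition sdiag d : 'M[C]_(n * n) := sine2 n *m diag_mx (\row_j d j) *m sine2 n.

Lemma sdiagD d e : sdiag (fun j => d j + e j) = sdiag d + sdiag e.
Proof.
rewrite /sdiag -mulmxDl -mulmxDr; congr (_ *m _ *m _).
by apply/matrixP => i j; rewrite !mxE mulrnDl.
Qed.

Lemma sdiagM d e : sdiag d *m sdiag e = sdiag (fun j => d j * e j).
Proof.
rewrite /sdiag -!mulmxA (mulmxA (sine2 n) (sine2 n)) sine2_sqr mul1mx !mulmxA -(mulmxA (sine2 n)).
congr (_ *m _ *m _); rewrite mulmx_diag; congr diag_mx.
by apply/rowP => j; rewrite !mxE.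
Qed.

Lemma sdiag1 : sdiag (fun=> 1) = 1%:M.
Proof.
rewrite /sdiag (_ : diag_mx _ = 1%:M) ?mulmx1 ?sine2_sqr //.
by apply/matrixP => i j; rewrite !mxE.
Qed.

Lemma sdiag_adj d : (sdiag d)^t* = sdiag (fun j => (d j)^*%R).
Proof.
have WA : (sine2 n)^t* = sine2 n := sine2_adj n.
rewrite /sdiag !adjM WA adj_diag mulmxA.
by apply: (congr1 (fun D => sine2 n *m diag_mx D *m sine2 n)); apply/rowP => j; rewrite !mxE.
Qed.

Lemma charpoly_sdiag d : char_poly (sdiag d) = \prod_j ('X - (d j)%:P).
Proof.
rewrite /sdiag -{1}inv_sine2 charpoly_sim ?charpoly_diag ?unitarymx_unit ?sine2_unitary //.
by apply: eq_bigr => j _; rewrite mxE.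
Qed.

Lemma rank_sdiag d (J : {pred 'I_(n * n)}) : (forall j, j \notin J -> d j = 0) ->
  (\rank (sdiag d) <= #|J|)%N.
Proof.
move=> h; apply: leq_trans (rankM_le _ _ _) _; apply: rank_diag => j /h.
by rewrite mxE.
Qed.

Lemma frob2_sdiagl d (A : 'M[C]_(n * n)) c : (forall j, nrm2 (d j) <= c) ->
  frob2 (sdiag d *m A) <= c * frob2 A.
Proof.
move=> h; rewrite /sdiag -!mulmxA (frob2_unitaryl _ (erefl _)) ?sine2_unitary //.
apply: le_trans (frob2_diagl _ (c := c) _) _; first by move=> i; rewrite mxE.
by rewrite (frob2_unitaryl _ (erefl _)) ?sine2_unitary.
Qed.

Lemma frob2_sdiagr d (A : 'M[C]_(n * n)) c : (forall j, nrm2 (d j) <= c) ->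
  frob2 (A *m sdiag d) <= c * frob2 A.
Proof.
move=> h; rewrite -frob2_adj adjM sdiag_adj -[in leRHS](frob2_adj A).
by apply: frob2_sdiagl => j; rewrite nrm2_conj.
Qed.

End SineDiagonal.

(** * Spectral distribution of the preconditioner *)

Section PreconditionerDistribution.
Local Open Scope sesquilinear_scope.
Context {R : realType} (alpha : R) (ha : 1 < alpha < 2) (shift : nat -> R[i]).
Context (shift0 : forall e : R, 0 < e -> exists n0, forall n, (n0 <= n)%N -> nrm2 (shift n) <= e).
Local Notation C := R[i].
Local Notation T1 := (measurableTypeR R).
Local Notation T2 := (T1 * T1)%type.
Local Notation talpha := (talpha alpha).
Local Notation tcoef := (tcoef alpha).
Local Notation pval := (pval alpha shift).
Local Notation prec := (prec alpha shift).

Lemma cavg_bound m (a : 'I_m -> C) e : 0 <= e -> (forall j, cabs (a j) <= e) ->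
  cabs (m%:R^-1 * \sum_j a j) <= e.
Proof.
move=> e0; case: (posnP m) a => [->|m0] a ae.
  by rewrite invr0 mul0r Normc.normc0.
have m1 : 0 < m%:R :> R by rewrite ltr0n.
rewrite Normc.normcM.
have -> : cabs (m%:R^-1 : C) = m%:R^-1.
  by rewrite -(rmorph_nat (real_complex R)) -fmorphV cabs_real ger0_norm // invr_ge0.
rewrite mulrC ler_pdivrMr //.
apply: (@le_trans _ _ (\sum_j cabs (a j))).
  elim/big_ind2: _ => // [|x b y d hb hd]; first by rewrite Normc.normc0.
  by apply: le_trans (le_normcD _ _) _; rewrite lerD.
apply: le_trans (ler_sum _ (fun j _ => ae j)) _.
by rewrite sumr_const card_ord mulr_natr.
Qed.

Lemma ReZ (a : R) (z : C) : complex.Re (a%:C * z) = a * complex.Re z.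
Proof. by case: z => x y /=; rewrite mul0r subr0. Qed.
Lemma ImZ (a : R) (z : C) : complex.Im (a%:C * z) = a * complex.Im z.
Proof. by case: z => x y /=; rewrite mul0r addr0. Qed.

Lemma boxpi_mean (g : R * R -> C) :
  mean_value boxpi g = (((2 * pi) ^- 2)%:C * cintegral boxpi g).
Proof. by rewrite /mean_value leb2_boxpi. Qed.

(** At the real samples of the symbol the real and imaginary parts of [F] fall under
    [grid_mean_continuous]. Uniform continuity near the compact range of the symbol then reaches the
    values [pval], which may be complex because of the shift. *)
Lemma grid_limit (F : C -> C) : continuous F ->
  ((n * n)%:R^-1 * \sum_(j < n * n) F (pval j)) @[n --> \oo] -->
    mean_value boxpi (fun x => F (t_alpha alpha x)).
Proof.
move=> Fc; apply: complex_cvg => e e0; have e4 : 0 < e / 4 by rewrite divr_gt0.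
have e2 : 0 < e / 2 by rewrite divr_gt0.
have Fr : continuous (F \o real_complex R).
  by move=> x; apply: continuous_comp; [exact: real_complex_cont | exact: Fc].
have rc : continuous (fun x : R => complex.Re (F x%:C)).
  by move=> x; apply: (continuous_comp (Fr x)); exact: Re_cont.
have ic : continuous (fun x : R => complex.Im (F x%:C)).
  by move=> x; apply: (continuous_comp (Fr x)); exact: Im_cont.
have [n1 H1] := cvg_eps (grid_mean_continuous ha rc) e4.
have [n2 H2] := cvg_eps (grid_mean_continuous ha ic) e4.
have [d d0 Hd] := complex_unif_cont (tmax alpha) Fc e2.
have [n3 H3] := pval_close ha shift0 (divr_gt0 d0 (ltr0Sn R 1)).
exists (maxn n1 (maxn n2 n3)) => n; rewrite !geq_max => /and3P[/H1 {}H1 /H2 {}H2 h3].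
set S := \sum_(j < n * n) F (talpha (grid j))%:C.
set L := mean_value _ _.
have -> : L - (n * n)%:R^-1 * \sum_(j < n * n) F (pval j) =
   (L - (n * n)%:R^-1 * S) + (n * n)%:R^-1 * \sum_(j < n * n) (F (talpha (grid j))%:C - F (pval j)).
  by rewrite sumrB mulrBr addrA subrK.
apply: le_trans (le_normcD _ _) _; rewrite [leRHS](splitr e) lerD //; last first.
  apply: cavg_bound => [|j]; first exact: ltW.
  rewrite -opprB normcN ltW // Hd ?talpha_ge0 ?talpha_le //.
  by apply: le_lt_trans (H3 _ _ h3) _; rewrite ltr_pdivrMr // ltr_pMr // ltr1n.
apply: le_trans (cabs_ReIm _) _; rewrite (_ : e / 2 = e / 4 + e / 4); last by field.
rewrite /L boxpi_mean -(rmorph_nat (real_complex R)) -fmorphV.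
rewrite !raddfB /= !ReZ !ImZ /S !raddf_sum.
by rewrite !mul0r subr0 addr0; apply: lerD; [exact: H1|exact: H2].
Qed.

Lemma admissible_boxpi (psi : R * R -> R) : @measurable_fun _ _ T2 T1 setT psi ->
  admissible boxpi (fun x => (psi x)%:C).
Proof.
move=> mpsi; split; first exact: measurable_boxpi.
  by rewrite leb2_boxpi lte_fin ltry andbT exprn_gt0 // mulr_gt0 ?pi_gt0.
split; apply: lmeasurable_measurable => /=; try exact: leb2_0; try exact: measurable_boxpi; first exact: mpsi.
exact: measurable_cst.
Qed.

Lemma eig_prec : eig_distr prec boxpi (t_alpha alpha).
Proof.
split; first by apply: admissible_boxpi; exact: (bmeas_talpha ha).1.
move=> F Fc _; have := grid_limit Fc; apply: cvg_trans; apply: near_eq_cvg.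
apply: nearW => n; rewrite (sum_eigvals F (z := @pval n)) //.
by rewrite precE charpoly_sdiag.
Qed.

Lemma sv_prec : sv_distr prec boxpi (t_alpha alpha).
Proof.
split; first by apply: admissible_boxpi; exact: (bmeas_talpha ha).1.
move=> F Fc _.
have Fc' : continuous (fun z : C => F (cabs z)).
  by move=> z; apply: (continuous_comp (@cabs_cont R z)); exact: Fc.
have := grid_limit Fc'; apply: cvg_trans; apply: near_eq_cvg.
apply: nearW => n; rewrite (sum_singvals F (d := fun j => nrm2 (pval j))).
  by congr (_ * _); apply: eq_bigr => j _; rewrite -normcE2 sqrtr_sqr ger0_norm ?cabs_ge0.
rewrite precE -[_ *m _ *m _]/(sdiag (@pval n)) sdiag_adj sdiagM charpoly_sdiag.
by apply: eq_bigr => j _; rewrite nrm2C mulrC.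
Qed.

(** If the last index counts, then K (m + 1) <= n, and all m + 1 indices together cost no more than
    that. *)
Lemma count_multiples K n m : (K * \sum_(i < m) (K * i.+1 <= n) <= n)%N.
Proof.
elim: m => [|m IH]; first by rewrite big_ord0 muln0.
rewrite big_ord_recr /=; have [h|h] := leqP (K * m.+1) n; last by rewrite addn0.
apply: leq_trans h; rewrite leq_mul2l addn1 ltnS; apply/orP; right.
by apply: leq_trans (leq_sum _ (fun i _ => leq_b1 _)) _; rewrite sum1_card card_ord.
Qed.

(** The assumption on the index says that the first angle is at least pi / K; its half lies in
    [0, pi / 2], where the sine increases, and the second angle can only enlarge the symbol. *)
Lemma talpha_far K n (j : 'I_(n * n)) : (0 < K)%N -> (n < K * (mxtens_unindex j).1.+1)%N ->
  (4 * sin (pi / (2 * K%:R)) ^+ 2) `^ (alpha / 2) <= talpha (grid j).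
Proof.
move=> K0; rewrite /talpha /grid; move: (mxtens_unindex j) => -[i i2] /= h.
have p0 := pi_gt0 R; have KR : 0 < K%:R :> R by rewrite ltr0n.
have th1 : pi / (2 * K%:R) <= node n i / 2 :> R.
  have n1 : 0 < n.+1%:R :> R by rewrite ltr0Sn.
  have Kn : n.+1%:R <= K%:R * i.+1%:R :> R by rewrite -natrM ler_nat.
  rewrite ler_pdivrMr ?mulr_gt0 // /node.
  have -> : i.+1%:R * pi / n.+1%:R / 2 * (2 * K%:R) = pi * (K%:R * i.+1%:R) / n.+1%:R :> R.
    by field; rewrite gt_eqF.
  by rewrite ler_pdivlMr // ler_wpM2l // ltW.
have th2 : node n i / 2 <= pi / 2 :> R.
  rewrite ler_pM2r ?invr_gt0 // /node ler_pdivrMr ?ltr0Sn // mulrC ler_wpM2l ?(ltW p0) //.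
  by rewrite ler_nat ltnW // ltnS.
have q0 : 0 < pi / (2 * K%:R) :> R by rewrite divr_gt0 // mulr_gt0.
have s0 : 0 <= sin (pi / (2 * K%:R)) :> R.
  by apply: sin_ge0_pi; lra.
apply: ge0_ler_powR.
- by rewrite divr_ge0 // (le_trans ler01) // ltW //; case/andP: ha.
- by rewrite nnegrE mulr_ge0 // sqr_ge0.
- by rewrite nnegrE addr_ge0 // mulr_ge0 // sqr_ge0.
apply: (@le_trans _ _ (4 * sin (node n i / 2) ^+ 2)); last by rewrite lerDl mulr_ge0 ?sqr_ge0.
apply: ler_wpM2l => //.
rewrite ler_sqr ?nnegrE //; last by apply: sin_ge0_pi; lra.
by rewrite leNgt ltr_sin -?leNgt // in_itv /=; lra.
Qed.

(** Outside the strip where the first angle is below pi / K, the symbol is at least t0, and with it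
    the eigenvalues are bounded below for large n. The strip holds at most a share 1 / K of the
    nodes. *)
Lemma few_small_pval (r : R) : 0 < r -> exists2 d : R, 0 < d <= 1 & exists n0, forall n, (n0 <= n)%N ->
  (#|[pred j : 'I_(n * n) | nrm2 (pval j) < d]|)%:R <= r * (n * n)%:R.
Proof.
move=> r0; have [K0 HK] := bound_nat r^-1; set K := K0.+1.
have Kr : r^-1 <= K%:R by exact: HK.
pose t0 : R := (4 * sin (pi / (2 * K%:R)) ^+ 2) `^ (alpha / 2).
have t0_gt0 : 0 < t0.
  have p0 := pi_gt0 R.
  apply: powR_gt0; rewrite mulr_gt0 // exprn_gt0 // sin_gt0_pi // divr_gt0 ?mulr_gt0 //=.
  rewrite ltr_pdivrMr ?mulr_gt0 // ltr_pMr // -natrM ltr1n /K; lia.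
have q0 : 0 < t0 ^+ 2 / 8 by rewrite divr_gt0 // exprn_gt0.
have [n0 Hn] := pval_close ha shift0 q0.
(* An eigenvalue of squared modulus below t0^2 / 4 at distance squared at most t0^2 / 8 from the
   symbol would force t0^2 < 2 (1/4 + 1/8) t0^2. The bound by 1 later gives d^2 <= d. *)
exists (Num.min 1 (t0 ^+ 2 / 4)).
  by rewrite lt_min ltr01 divr_gt0 ?exprn_gt0 //= ge_min lexx.
exists n0 => n h.
have sub j : nrm2 (@pval n j) < Num.min 1 (t0 ^+ 2 / 4) -> (K * (mxtens_unindex j).1.+1 <= n)%N.
  rewrite lt_min => /andP[_ hd]; rewrite leqNgt; apply/negP => /(talpha_far (ltn0Sn K0)).
  rewrite -/t0 => tt; have := Hn n j h; rewrite -nrm2N opprB => hc.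
  have := nrm2D (pval j) ((talpha (grid j))%:C - pval j); rewrite [pval j + _]addrC subrK nrm2_real => hh.
  have : t0 ^+ 2 <= talpha (grid j) ^+ 2 by rewrite ler_sqr ?nnegrE ?talpha_ge0 // ltW.
  by lra.
apply: (@le_trans _ _ (\sum_(j < n * n) ((K * (mxtens_unindex j).1.+1 <= n)%N%:R : R))).
  rewrite -sum1_card natr_sum big_mkcond /=; apply: ler_sum => j _.
  by rewrite inE; case: ifP => [/sub ->|] //.
rewrite (sum_unindex (fun j1 _ : 'I_n => ((K * j1.+1 <= n)%N%:R : R))).
under eq_bigr do rewrite sumr_const card_ord.
rewrite sumrMnl -natr_sum -[leLHS]mulr_natr natrM mulrA ler_wpM2r //.
have cm : K%:R * (\sum_(i < n) (K * i.+1 <= n))%:R <= n%:R :> R.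
  by rewrite -natrM ler_nat count_multiples.
rewrite -ler_pdivrMl //.
by apply: le_trans cm; rewrite ler_wpM2r.
Qed.

End PreconditionerDistribution.

Lemma acs_null_eq (R : realType) (Y Z : mxseq R) : (forall n, Y n = Z n) -> acs_null Z -> acs_null Y.
Proof. by move=> E nZ e /nZ [n0 Hn]; exists n0 => n /Hn; rewrite E. Qed.

Lemma dep_choice (T : nat -> Type) (P : forall n, T n -> Prop) :
  (forall n, exists y, P n y) -> exists f : forall n, T n, forall n, P n (f n).
Proof. by move=> H; exists (fun n => sval (cid (H n))) => n; exact: svalP. Qed.

(** * The preconditioned sequence *)

Section Preconditioned.
Local Open Scope sesquilinear_scope.
Context {R : realType} (alpha : R) (ha : 1 < alpha < 2) (shift : nat -> R[i]).
Context (shift0 : forall e : R, 0 < e -> exists n0, forall n, (n0 <= n)%N -> nrm2 (shift n) <= e).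
Context (pert : forall n, 'I_(n * n) -> R[i]).
Context (pert0 : forall e : R, 0 < e -> exists n0, forall n (j : 'I_(n * n)), (n0 <= n)%N -> nrm2 (pert j) <= e).
Local Notation C := R[i].
Local Notation talpha := (talpha alpha).
Local Notation tcoef := (tcoef alpha).
Local Notation pval := (pval alpha shift).
Local Notation prec := (prec alpha shift).
Context (prec_unit : forall n, (1 <= n)%N -> prec n \in unitmx).

Definition sysmx n : 'M[C]_(n * n) := toep n tcoef + diag_mx (\row_j pert j).
Definition psys n : 'M[C]_(n * n) := invmx (prec n) *m sysmx n.
Definition defect n : 'M[C]_(n * n) := sysmx n - prec n.

Lemma defect_small (e : R) : 0 < e -> exists n0, forall n, (n0 <= n)%N -> frob2 (defect n) <= e * (n * n)%:R.
Proof.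
move=> e0; have e8 : 0 < e / 16 by rewrite divr_gt0.
have [n1 H1] := toep_tauc_small (l1approx_tcoef ha) e8.
have [n2 H2] := shift0 e8; have [n3 H3] := pert0 e8.
exists (maxn n1 (maxn n2 n3)) => n; rewrite !geq_max => /and3P[/H1 h1 /H2 h2 h3].
have -> : defect n = (toep n tcoef - tauc n tcoef) + (diag_mx (\row_j pert j) - (shift n)%:M).
  by rewrite /defect /sysmx /prec opprD addrACA.
have k1 := frob2D (toep n tcoef - tauc n tcoef) (diag_mx (\row_j pert j) - (shift n)%:M).
have k2 := frob2D (diag_mx (\row_j (pert j : C))) (- ((shift n)%:M : 'M[C]_(n * n))).
rewrite frob2N frob2_scalar frob2_diag in k2.
have k3 : \sum_(i < n * n) nrm2 ((\row_j pert j) 0 i : C) <= e / 16 * (n * n)%:R.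
  apply: (@le_trans _ _ (\sum_(i < n * n) e / 16)); last by rewrite sumr_const card_ord mulr_natr.
  by apply: ler_sum => j _; rewrite mxE; exact: H3.
have k4 := ler_wpM2r (ler0n R (n * n)) h2.
apply: le_trans k1 _.
move: (frob2 _) (frob2 _) (\sum_(i < _) _) (nrm2 _ * _) h1 k2 k3 k4 => x y z w.
have N0 : 0 <= e * (n * n)%:R by rewrite mulr_ge0 // ltW.
by lra.
Qed.

Lemma pval_neq0 n (j : 'I_(n * n)) : pval j != 0.
Proof.
have n0 : (0 < n)%N by case: n j => [[[]]|].
have := prec_unit n0; rewrite precE !unitmx_mul => /andP[/andP[_]].
by rewrite unitmxE det_diag unitfE => /prodf_neq0 /(_ j isT); rewrite mxE.
Qed.

Lemma inv_precE n : (0 < n)%N -> invmx (prec n) = sdiag (fun j => (@pval n j)^-1).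
Proof.
move=> n0; rewrite -[LHS]mulmx1 -(@sdiag1 R n).
rewrite (_ : sdiag (fun=> 1) = prec n *m sdiag (fun j => (pval j)^-1)) ?mulKmx ?prec_unit //.
rewrite precE -[_ *m _ *m sine2 n]/(sdiag (@pval n)) sdiagM; congr sdiag.
by apply/funext => j; rewrite divff ?pval_neq0.
Qed.

Lemma psys_sub1 n : (0 < n)%N -> psys n - 1%:M = invmx (prec n) *m defect n.
Proof. by move=> n0; rewrite mulmxBr mulVmx ?prec_unit. Qed.

(** Cutting at the small eigenvalues of the preconditioner; it serves for the inverse and for the
    inverse square root alike. *)
Lemma sdiag_split n (d : R) (x : 'I_(n * n) -> C) c :
  (forall j, d <= nrm2 (pval j) -> nrm2 (x j) <= c) -> 0 <= c ->
  exists a b : 'I_(n * n) -> C, [/\ sdiag x = sdiag a + sdiag b,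
    (\rank (sdiag a) <= #|[pred j : 'I_(n * n) | (nrm2 (pval j) < d)%R]|)%N & forall j, nrm2 (b j) <= c].
Proof.
move=> h c0; exists (fun j => if nrm2 (pval j) < d then x j else 0),
  (fun j => if nrm2 (pval j) < d then 0 else x j); split.
- rewrite -sdiagD; congr sdiag; apply/funext => j.
  by case: ifP; rewrite ?addr0 ?add0r.
- by apply: rank_sdiag => j; rewrite inE => /negbTE ->.
- by move=> j; case: ltP => [_|/h //]; rewrite nrm20.
Qed.

Lemma psys_acs_null : acs_null (fun n => psys n - 1%:M).
Proof.
move=> e e0; have [d /andP[d0 _] [n1 H1]] := few_small_pval ha shift0 e0.
(* The retained part of the inverse has squared eigenvalues at most 1 / d, which turns d e into
   e. *)
have [n2 H2] := defect_small (mulr_gt0 d0 e0).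
exists (maxn n1 (maxn n2 1)) => n; rewrite !geq_max => /and3P[/H1 h1 /H2 h2 n0].
rewrite psys_sub1 // inv_precE //.
have [||a [b [-> ra hb]]] := @sdiag_split n d (fun j => (pval j)^-1) d^-1.
- by move=> j h; rewrite nrm2V lef_pV2 ?posrE // (lt_le_trans d0).
- by rewrite invr_ge0 ltW.
exists (sdiag a *m defect n), (sdiag b *m defect n); split; first by rewrite mulmxDl.
  apply: le_trans h1; rewrite ler_nat; exact: leq_trans (mxrankM_maxl _ _) ra.
by apply: le_trans (frob2_sdiagl _ hb) _; rewrite ler_pdivrMl // mulrA.
Qed.

Lemma GLT_psys : GLT psys (of_theta (fun=> 1)).
Proof.
have -> : of_theta (fun=> 1 : C) = of_theta (fun _ : R * R => (1 : R)%:C) by [].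
apply: (@GLT_theta _ psys (fun=> 1) (fun=> 1)); first exact: measurable_cst.
  by move=> m x; rewrite hornerC subrr normr0 invr_ge0.
have H : acs_null (fun n => psys n - toep n (pcoef 1)).
  apply: (@acs_null_eq _ _ (fun n => (psys n - 1%:M) + (1%:M - toep n (pcoef 1)))).
    by move=> n; rewrite addrA subrK.
  apply: acs_nullD psys_acs_null _; apply: acs_null_frob => e e0.
  have [K HK] := toep_tauc_finsupp (@pcoef_supp R 1).
  have [n1 H1] := linear_le_square K e0.
  exists (maxn 1 n1) => n; rewrite geq_max => /andP[n0 /H1 h1].
  have s1 : (size (1%R : {poly R}) <= n)%N by rewrite size_poly1.
  (* The eigenvalues of this tau matrix are the values of the polynomial 1, so [toep_tauc_finsupp]
     compares the Toeplitz approximant with the identity. *)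
  have E1 : tauc n (pcoef (1 : {poly R})) = 1%:M.
    apply: etrans (@sdiag1 R n); congr (_ *m diag_mx _ *m _).
    by apply/rowP => j; rewrite !mxE taueig_poly // hornerC.
  by rewrite -frob2N opprB -E1 (le_trans (HK _ s1)).
move=> m; set h := m.+1%:R^-1.
have [h0 h1] : 0 < h /\ h <= 1 by rewrite invr_gt0 ltr0Sn invf_le1 ?ltr0Sn // ler1n.
have h3 : 0 < h ^+ 3 by rewrite exprn_gt0.
have [n0 Hn] := H _ h3; exists n0 => n /Hn; apply: lowsum_le => //.
by rewrite -[leRHS]mulr1 exprS ler_wpM2l ?(ltW h0) // exprn_ile1 // ltW.
Qed.

Lemma mean_cst (w : C) : mean_value boxpi (fun=> w) = w.
Proof.
rewrite boxpi_mean /cintegral !Ib_cst; case: w => a b /=.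
apply/eqP; rewrite eq_complex /= !mul0r subr0 addr0 !mean_pi_cst !eqxx //.
Qed.

Lemma complex_local_cont (F : C -> C) (x e : R) : continuous F -> 0 <= x -> 0 < e ->
  exists2 d : R, 0 < d & forall w, nrm2 (w - x%:C) <= d -> cabs (F w - F x%:C) <= e.
Proof.
move=> Fc x0 e0; have [d d0 Hd] := complex_unif_cont x Fc e0.
exists (d / 2); first by rewrite divr_gt0.
move=> w h; apply/ltW/Hd; first by rewrite x0 lexx.
by apply: le_lt_trans h _; rewrite ltr_pdivrMr // ltr_pMr // ltr1n.
Qed.

(** With Y = [psys n] - 1, the Gram matrix minus 1 is the adjoint of Y, plus Y, plus the Gram matrix
    of Y, hence again low rank plus small norm. Unitary diagonalization preserves this, so the Gram
    eigenvalues cluster at 1, and the square root is absorbed into the test function [F']. *)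
Lemma sv_psys : sv_distr psys boxpi (fun=> 1).
Proof.
split; first by apply: (@admissible_boxpi _ (fun=> 1)); exact: measurable_cst.
move=> F Fc Fs.
have [V_ HV] := dep_choice (fun n => gram_spectral (psys n)).
have [d_ Hd] := dep_choice HV.
have GL : acs_null (fun n => (psys n)^t* *m psys n - 1%:M).
  apply: (@acs_null_eq _ _ (fun n => ((psys n - 1%:M)^t* + (psys n - 1%:M)) +
      (psys n - 1%:M)^t* *m (psys n - 1%:M))).
    move=> n; set Y := psys n - 1%:M.
    have -> : psys n = 1%:M + Y by rewrite addrC subrK.
    rewrite adjD trmx1 map_mx1 mulmxDl mul1mx mulmxDr mulmx1.
    by rewrite -[1%:M + Y + _]addrA (addrC 1%:M) addrK addrA (addrC Y).
  apply: acs_nullD; first apply: acs_nullD.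
  - by move=> e /psys_acs_null [n0 Hn]; exists n0 => n /Hn /lowsum_adj.
  - exact: psys_acs_null.
  - move=> e e0; have e3 : 0 < e / 3 by rewrite divr_gt0.
    have [n0 Hn] := psys_acs_null e3; exists n0 => n /Hn /lowsum_gram.
    by apply: lowsum_le; lra.
pose z n (j : 'I_(n * n)) : C := (d_ n j)%:C.
have cl : clustered z 1.
  apply: acs_null_clustered => e /GL [n0 Hn]; exists n0 => n /Hn h.
  have [Vu _ E] := Hd n.
  have -> : diag_mx (\row_i (z n i - 1)) = V_ n *m ((psys n)^t* *m psys n - 1%:M) *m (V_ n)^t*.
    rewrite mulmxBr mulmxBl mulmx1 (unitarymxP Vu) E.
    rewrite !mulmxA (unitarymxP Vu) mul1mx -!mulmxA (unitarymxP Vu) mulmx1.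
    by apply/matrixP => i j; rewrite !mxE mulrnBl.
  exact: lowsum_unitary Vu (adj_unitary Vu) h.
pose F' (w : C) := F (Num.sqrt (complex.Re w)).
have Fc' : continuous F'.
  move=> w; apply: (@continuous_comp _ _ _ (fun w : C => Num.sqrt (complex.Re w)) F); last exact: Fc.
  apply: (@continuous_comp _ _ _ (fun w : C => complex.Re w) (@Num.sqrt R) w (@Re_cont R w)).
  exact: sqrt_continuous.
have [B HB] := bounded_cs Fc Fs.
have := cluster_limit cl (fun w => HB _ : cabs (F' w) <= B) (fun e => complex_local_cont Fc' ler01).
rewrite mean_cst Normc.normc1 /F' /= sqrtr1; apply: cvg_trans; apply: near_eq_cvg.
apply: nearW => n; have [Vu _ E] := Hd n; rewrite (sum_singvals F (d := d_ n)) //.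
rewrite E -(invmx_unitary Vu) (charpoly_sim _ (unitarymx_unit Vu)) charpoly_diag.
by apply: eq_bigr => j _; rewrite mxE.
Qed.

End Preconditioned.

(* AM-GM on the weights q_i^2 q_j^2. *)
Lemma frob2_skew (R : rcfType) n (M : 'M[R[i]]_n) (q : 'I_n -> R) :
  2 * frob2 (diag_mx (\row_j (q j)%:C) *m M *m diag_mx (\row_j (q j)%:C)) <=
  frob2 (diag_mx (\row_j (q j ^+ 2)%:C) *m M) + frob2 (M *m diag_mx (\row_j (q j ^+ 2)%:C)).
Proof.
rewrite /frob2 mulr_sumr -big_split; apply: ler_sum => i _ /=.
rewrite mulr_sumr -big_split; apply: ler_sum => j _ /=.
rewrite !mul_mx_diag !mul_diag_mx !mxE !nrm2M !nrm2_real.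
have := nrm2_ge0 (M i j); move: (nrm2 _) (q i) (q j) => m a b m0.
rewrite -subr_ge0 (_ : _ - _ = m * (a ^+ 2 - b ^+ 2) ^+ 2); last by ring.
by rewrite mulr_ge0 ?sqr_ge0.
Qed.

(** * Eigenvalues of the preconditioned sequence *)

Section Eigen.
Local Open Scope sesquilinear_scope.
Context {R : realType} (alpha : R) (ha : 1 < alpha < 2) (shift : nat -> R[i]).
Context (shift0 : forall e : R, 0 < e -> exists n0, forall n, (n0 <= n)%N -> nrm2 (shift n) <= e).
Context (pert : forall n, 'I_(n * n) -> R[i]).
Context (pert0 : forall e : R, 0 < e -> exists n0, forall n (j : 'I_(n * n)), (n0 <= n)%N -> nrm2 (pert j) <= e).
Context (M2 : R).
Context (pert_le : forall n (j : 'I_(n * n)), nrm2 (pert j) <= M2 * (hstep n `^ alpha) ^+ 2).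
Context (s : nat -> R).
Context (shift_ge0 : forall n, (1 <= n)%N -> shift n = (s n)%:C /\ 0 <= s n).
Local Notation C := R[i].
Local Notation tcoef := (tcoef alpha).
Local Notation pval := (pval alpha shift).
Local Notation prec := (prec alpha shift).
Context (prec_unit : forall n, (1 <= n)%N -> prec n \in unitmx).
Local Notation sysmx := (sysmx alpha pert).
Local Notation psys := (psys alpha shift pert).
Local Notation defect := (defect alpha shift pert).

Definition rpval n (j : 'I_(n * n)) : R := taueig n tcoef (grid j).1 (grid j).2 + s n.

Lemma pvalE n (j : 'I_(n * n)) : (1 <= n)%N -> pval j = (rpval j)%:C.
Proof. by move=> /shift_ge0 [E _]; rewrite /pval E -rmorphD. Qed.

Lemma rpval_lb n (j : 'I_(n * n)) : (1 <= n)%N -> kap alpha * hstep n `^ alpha <= rpval j.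
Proof.
move=> n1; have [_ s0] := shift_ge0 n1; rewrite -[leLHS]addr0 lerD //; exact: taueig_lb.
Qed.

Lemma rpval_gt0 n (j : 'I_(n * n)) : (1 <= n)%N -> 0 < rpval j.
Proof.
move=> n1; apply: lt_le_trans (rpval_lb j n1).
by rewrite mulr_gt0 ?kap_gt0 // powR_gt0 // invr_gt0 ltr0Sn.
Qed.

Definition isqrt n (j : 'I_(n * n)) : R := (Num.sqrt (rpval j))^-1.
Definition prec_isqrt n := sdiag (fun j : 'I_(n * n) => (isqrt j)%:C).
Definition symdef n := prec_isqrt n *m defect n *m prec_isqrt n.

Lemma isqrt_sqr n (j : 'I_(n * n)) : (1 <= n)%N -> isqrt j ^+ 2 = (rpval j)^-1.
Proof. by move=> n1; rewrite exprVn sqr_sqrtr // ltW // rpval_gt0. Qed.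

Lemma prec_isqrt_sqr n : (1 <= n)%N -> prec_isqrt n *m prec_isqrt n = invmx (prec n).
Proof.
move=> n1; rewrite sdiagM (inv_precE prec_unit) //; congr sdiag; apply/funext => j.
by rewrite pvalE // -fmorphV -rmorphM -expr2 isqrt_sqr.
Qed.

Lemma prec_isqrt_unit n : (1 <= n)%N -> prec_isqrt n \in unitmx.
Proof.
move=> n1; have : invmx (prec n) \in unitmx by rewrite unitmx_inv prec_unit.
by rewrite -(prec_isqrt_sqr n1) unitmx_mul => /andP[].
Qed.

Lemma prec_isqrt_prec n : (1 <= n)%N -> prec_isqrt n *m prec n *m prec_isqrt n = 1%:M.
Proof.
by move=> n1; apply: mulmx1C; rewrite mulmxA prec_isqrt_sqr // mulVmx ?prec_unit.
Qed.

Lemma charpoly_psys n : (1 <= n)%N -> char_poly (psys n) = char_poly (1%:M + symdef n).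
Proof.
move=> n1; rewrite -(charpoly_sim (psys n) (prec_isqrt_unit n1)); congr char_poly.
rewrite /psys /symdef /defect -prec_isqrt_sqr //; move: (prec_isqrt_unit n1) (prec_isqrt_prec n1).
move: (prec_isqrt n) (sysmx n) => V A Vu VPV.
by rewrite !mulmxA mulVmx // mul1mx mulmxBr mulmxBl VPV addrC subrK.
Qed.

(** With the inverse square root split as A + B, where A has low rank, the product with the defect E
    is A E (A + B) + B E A + B E B. The first two terms have low rank; in the last each B costs a
    factor 1 / d, hence the budget d^2 e. *)
Lemma symdef_acs_null : acs_null symdef.
Proof.
move=> e e0; have e2 : 0 < e / 2 by rewrite divr_gt0.
have [d /andP[d0 d1] [n1 H1]] := few_small_pval ha shift0 e2.
have [n2 H2] := defect_small ha shift0 pert0 (mulr_gt0 (mulr_gt0 d0 d0) e0).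
exists (maxn n1 (maxn n2 1)) => n; rewrite !geq_max => /and3P[/H1 h1 /H2 h2 n0].
have [||a [b [E ra hb]]] := @sdiag_split _ alpha shift n d (fun j => (isqrt j)%:C) d^-1.
- move=> j; rewrite pvalE // !nrm2_real isqrt_sqr // => h.
  have p0 := rpval_gt0 j n0; rewrite lef_pV2 ?posrE //.
  have : d ^+ 2 <= rpval j ^+ 2 by apply: le_trans h; rewrite expr2 ler_piMr // ltW.
  by rewrite ler_sqr ?nnegrE // ltW.
- by rewrite invr_ge0 ltW.
exists (sdiag a *m defect n *m prec_isqrt n + sdiag b *m defect n *m sdiag a), (sdiag b *m defect n *m sdiag b); split.
- have {}E : prec_isqrt n = sdiag a + sdiag b := E.
  rewrite /symdef; move: (prec_isqrt n) (sdiag a) (sdiag b) (defect n) E => V A B Z ->.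
  by rewrite !mulmxDl -[in RHS]addrA -mulmxDr.
- apply: (@le_trans _ _ (e / 2 * (n * n)%:R + e / 2 * (n * n)%:R)); last first.
    by rewrite -mulrDl -splitr.
  apply: le_trans (lerD h1 h1); rewrite -natrD ler_nat.
  apply: leq_trans (mxrank_add _ _) _; apply: leq_add.
    by rewrite -mulmxA; exact: leq_trans (mxrankM_maxl _ _) ra.
  exact: leq_trans (mxrankM_maxr _ _) ra.
- apply: le_trans (frob2_sdiagr _ hb) _; rewrite ler_pdivrMl //.
  apply: le_trans (frob2_sdiagl _ hb) _; rewrite ler_pdivrMl //.
  by rewrite !mulrA.
Qed.

Lemma toep_adj n c : (toep n c : 'M[C]_(n * n))^t* = toep n c.
Proof.
apply/matrixP => i j; rewrite !mxE; apply: etrans (conjc_real _) _.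
by rewrite -abszN opprB -(abszN ((mxtens_unindex j).2%:Z - _)) opprB.
Qed.

Definition im_defect n (j : 'I_(n * n)) : C := pert j - (pert j)^*%R.

(** The Toeplitz matrix is real symmetric and [prec] is Hermitian because the shift is real, so only
    the perturbation contributes. *)
Lemma defect_skew n : (1 <= n)%N -> defect n - (defect n)^t* = diag_mx (\row_j @im_defect n j).
Proof.
move=> n1; rewrite /defect /sysmx.
have adjN (Z : 'M[C]_(n * n)) : (- Z)^t* = - Z^t* by rewrite !raddfN.
have PA : (prec n)^t* = prec n.
  rewrite precE -[_ *m _ *m sine2 n]/(sdiag (@pval n)) sdiag_adj; congr sdiag.
  apply/funext => j; rewrite pvalE //=; exact: conjc_real.
rewrite !adjD adjN PA toep_adj.
move: (prec n) (toep n tcoef) => P T; apply/matrixP => i j; rewrite !mxE eq_sym opprB.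
rewrite addrA subrK opprD addrACA subrr add0r.
by case: eqP => [->|_]; rewrite ?mulr1n ?mulr0n ?rmorph0 ?subrr.
Qed.

Lemma im_defect_le n (j : 'I_(n * n)) : nrm2 (im_defect j) <= 4 * M2 * (hstep n `^ alpha) ^+ 2.
Proof.
apply: le_trans (nrm2D _ _) _; rewrite nrm2N nrm2_conj.
by have := pert_le j; lra.
Qed.

Lemma frob2_diagr m n (A : 'M[C]_(m, n)) (d : 'rV[C]_n) c : (forall i, nrm2 (d 0 i) <= c) ->
  frob2 (A *m diag_mx d) <= c * frob2 A.
Proof.
move=> h; rewrite -frob2_adj adjM adj_diag -[in leRHS](frob2_adj A).
by apply: frob2_diagl => i; rewrite mxE nrm2_conj.
Qed.

(** In the sine basis the entries carry weights lambda^(-1/2) on both sides; [frob2_skew] collects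
    them as lambda^-1 on one side. The other side is then a unitary factor and a diagonal one with
    bounded entries, which leaves the sum of the lambda^-2. *)
Lemma frob2_symdef_skew n : (1 <= n)%N ->
  frob2 (symdef n - (symdef n)^t*) <= (4 * M2 * (hstep n `^ alpha) ^+ 2) * \sum_j (@rpval n j)^-1 ^+ 2.
Proof.
move=> n1; set c := 4 * M2 * _.
have PhA : (prec_isqrt n)^t* = prec_isqrt n.
  by rewrite sdiag_adj; congr sdiag; apply/funext => j; exact: conjc_real.
have -> : symdef n - (symdef n)^t* = prec_isqrt n *m diag_mx (\row_j @im_defect n j) *m prec_isqrt n.
  rewrite -defect_skew // /symdef; move: (prec_isqrt n) (defect n) PhA => V E VA.
  by rewrite !adjM VA mulmxBr mulmxBl mulmxA.
rewrite /prec_isqrt /sdiag; set D := diag_mx (\row_j im_defect j); set Q := diag_mx _.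
have -> : sine2 n *m Q *m sine2 n *m D *m (sine2 n *m Q *m sine2 n) = sine2 n *m (Q *m (sine2 n *m D *m sine2 n) *m Q) *m sine2 n.
  by rewrite !mulmxA.
rewrite (frob2_unitaryr _ (sine2_unitary n)) (frob2_unitaryl _ (erefl _) (sine2_unitary n)).
rewrite -(ler_pM2l (ltr0Sn R 1)); apply: le_trans (frob2_skew _ _) _.
have qs : frob2 (diag_mx (\row_j (@isqrt n j ^+ 2)%:C) : 'M[C]_(n * n)) = \sum_j (@rpval n j)^-1 ^+ 2.
  rewrite frob2_diag; apply: eq_bigr => j _; by rewrite mxE nrm2_real isqrt_sqr.
have dc (j : 'I_(n * n)) : nrm2 ((\row_j @im_defect n j) 0 j) <= c by rewrite mxE im_defect_le.
set M := sine2 n *m D *m sine2 n; set Q2 := diag_mx (\row_j (isqrt j ^+ 2)%:C) in qs *.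
have h1 : frob2 (Q2 *m M) <= c * frob2 Q2.
  rewrite /M !mulmxA (frob2_unitaryr _ (sine2_unitary n)); apply: le_trans (frob2_diagr _ dc) _.
  by rewrite (frob2_unitaryr _ (sine2_unitary n)).
have h2 : frob2 (M *m Q2) <= c * frob2 Q2.
  rewrite /M -!mulmxA (frob2_unitaryl _ (erefl _) (sine2_unitary n)).
  apply: le_trans (frob2_diagl _ dc) _.
  by rewrite (frob2_unitaryl _ (erefl _) (sine2_unitary n)).
by rewrite -qs mulr_natl mulr2n; exact: lerD h1 h2.
Qed.

Lemma hstep_pow (e : R) : 0 < e -> exists n0, forall n, (n0 <= n)%N -> hstep n `^ alpha <= e.
Proof.
move=> e0; have [n0 Hn] := bound_nat e^-1; exists n0 => n h.
have h0 : 0 < hstep n :> R by rewrite invr_gt0 ltr0Sn.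
have h1 : hstep n <= 1 :> R by rewrite invf_le1 ?ltr0Sn // ler1n.
apply: (@le_trans _ _ (hstep n `^ 1)).
  by apply: ger_powR; [rewrite h0 h1 | case/andP: ha => /ltW].
rewrite powRr1 ?(ltW h0) // -[leRHS]invrK lef_pV2 ?posrE ?invr_gt0 //.
by apply: le_trans (Hn _ h) _; rewrite ler_nat.
Qed.

Lemma symdef_skew_small (e : R) : 0 < e -> exists n0, forall n, (n0 <= n)%N ->
  frob2 (symdef n - (symdef n)^t*) <= e * (n * n)%:R.
Proof.
move=> e0; have k0 := kap_gt0 ha; set k := kap alpha in k0.
have m0 : 0 <= 4 * M2.
  (* The sign of [M2] comes from [pert_le] at n = 1, where an index exists. *)
  have := nrm2_ge0 (pert (ord0 : 'I_(1 * 1))); have := pert_le (ord0 : 'I_(1 * 1)).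
  move=> /[swap] h /(le_trans h); rewrite pmulr_lge0; first by move=> h2; lra.
  by rewrite exprn_gt0 // powR_gt0 // invr_gt0 ltr0Sn.
have r0 : 0 < e / 2 / (4 * M2 / k ^+ 2 + 1).
  by rewrite !divr_gt0 // ltr_wpDl // divr_ge0 // exprn_ge0 // ltW.
have [d /andP[d0 d1] [n1 H1]] := few_small_pval ha shift0 r0.
have [|n2 H2] := @hstep_pow (Num.min 1 (e / 2 / (4 * M2 / d + 1))).
  by rewrite lt_min ltr01 !divr_gt0 // ltr_wpDl // divr_ge0 // ltW.
exists (maxn n1 (maxn n2 1)) => n; rewrite !geq_max => /and3P[/H1 h1 /H2 h2 n0].
apply: le_trans (frob2_symdef_skew n0) _; rewrite mulr_sumr.
move: h2; have : 0 < hstep n `^ alpha by rewrite powR_gt0 // invr_gt0 ltr0Sn.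
have plb j := @rpval_lb n j n0; rewrite -/k in plb.
move: (hstep n `^ alpha) plb => H plb H0; rewrite le_min => /andP[H_1 He].
pose A := 4 * M2 / k ^+ 2; pose B := e / 2.
(* By [plb] no index contributes more than [A]; where the squared eigenvalue is at least d, the
   contribution is at most 4 M2 H^2 / d, which is at most [B] by the choice of n. *)
have tb j : 4 * M2 * H ^+ 2 * (@rpval n j)^-1 ^+ 2 <= A * (nrm2 (pval j) < d)%R%:R + B.
  have p0 := rpval_gt0 j n0; rewrite exprVn.
  have [hd|hd] := ltP (nrm2 (pval j)) d.
    rewrite mulr1; apply: ler_wpDr; first by rewrite /B divr_ge0 // ltW.
    rewrite /A -[leLHS]mulrA ler_wpM2l // ler_pdivrMr ?exprn_gt0 //.
    rewrite ler_pdivlMl ?exprn_gt0 // -exprMn ler_sqr ?nnegrE ?(ltW p0) //.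
    by rewrite mulr_ge0 // ltW.
  rewrite mulr0 add0r ler_pdivrMr ?exprn_gt0 //.
  move: hd; rewrite pvalE // nrm2_real => hd.
  apply: (@le_trans _ _ (B * d)); last by rewrite ler_wpM2l // /B divr_ge0 // ltW.
  have HH : H ^+ 2 <= H by rewrite expr2 ler_piMr // ltW.
  apply: (@le_trans _ _ (4 * M2 * (B / (4 * M2 / d + 1)))).
    by rewrite ler_wpM2l // (le_trans HH).
  rewrite mulrCA ler_wpM2l //; first by rewrite /B divr_ge0 // ltW.
  rewrite ler_pdivrMr ?ltr_wpDl ?divr_ge0 ?(ltW d0) //.
  by rewrite mulrDr mulr1 mulrCA divff ?gt_eqF // mulr1 lerDl ltW.
apply: le_trans (ler_sum _ (fun j _ => tb j)) _.
rewrite big_split /= -mulr_sumr sumr_const card_ord -[B *+ _]mulr_natr.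
rewrite -natr_sum (_ : (\sum_(j < n * n) _)%N = #|[pred j : 'I_(n * n) | (nrm2 (pval j) < d)%R]|); last first.
  rewrite -sum1_card [RHS]big_mkcond /=; apply: eq_bigr => j _; rewrite inE.
  by case: (_ < _)%R.
have A0 : 0 <= A by rewrite /A divr_ge0 // exprn_ge0 // ltW.
have := ler_wpM2l A0 h1; rewrite -/A mulrA => h3.
have h4 : A * (e / 2 / (A + 1)) <= B.
  by rewrite mulrCA ler_piMr ?divr_ge0 ?(ltW e0) // ler_pdivrMr ?mul1r ?lerDl // ltr_wpDl.
have := ler_wpM2r (ler0n R (n * n)) h4; rewrite /B in h3 h4 * => h5.
by lra.
Qed.

Lemma eig_psys : eig_distr psys boxpi (fun=> 1).
Proof.
split; first by apply: (@admissible_boxpi _ (fun=> 1)); exact: measurable_cst.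
move=> F Fc Fs.
have [U_ HU] := dep_choice (fun n => schur_skew (1%:M + symdef n)).
have [T_ HT] := dep_choice HU.
pose z n (j : 'I_(n * n)) : C := T_ n j j.
have cl : clustered z 1.
  apply: acs_null_clustered.
  (* The diagonal of T minus 1 is the conjugate of [symdef] minus the part of T off the diagonal;
     the latter is small by [schur_skew] and [symdef_skew_small]. *)
  apply: (@acs_null_eq _ _ (fun n => U_ n *m symdef n *m (U_ n)^t* + - (T_ n - diag_mx (\row_j T_ n j j)))).
    move=> n; have [Uu TE _ _] := HT n.
    rewrite opprB {2}TE mulmxDr mulmxDl mulmx1 (unitarymxP Uu).
    rewrite opprD addrCA [X in _ + X]addrCA subrr addr0.
    by apply/matrixP => i j; rewrite !mxE mulrnBl.
  apply: acs_nullD.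
    move=> e /symdef_acs_null [n0 Hn]; exists n0 => n /Hn h; have [Uu _ _ _] := HT n.
    exact: lowsum_unitary Uu (adj_unitary Uu) h.
  apply: acs_null_frob => e /symdef_skew_small [n0 Hn]; exists n0 => n /Hn h.
  have [_ _ _] := HT n; rewrite adjD trmx1 map_mx1 opprD addrACA subrr add0r frob2N => k.
  have := frob2_ge0 (T_ n - diag_mx (\row_j T_ n j j)).
  by have := le_trans k h; lra.
have [B HB] := bounded_cs Fc Fs.
have := cluster_limit cl HB (fun e => complex_local_cont Fc ler01).
rewrite mean_cst; apply: cvg_trans; apply: near_eq_cvg.
exists 1%N => // n n1; have [_ _ E _] := HT n.
by rewrite (sum_eigvals F (z := @z n)) ?charpoly_psys.
Qed.

End Eigen.

Lemma ge0_complexE (R : rcfType) (z : R[i]) : 0 <= z -> z = (complex.Re z)%:C /\ 0 <= complex.Re z.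
Proof. by case: z => a b; rewrite lecE /= => /andP[/eqP -> ->]. Qed.

(** * Both choices of the preconditioner *)

Section Final.
Local Open Scope sesquilinear_scope.
Context {R : realType} (alpha : R) (ha : 1 < alpha < 2).
Local Notation C := R[i].
Local Notation tcoef := (tcoef alpha).

Lemma toeplitz2_t_alpha n : toeplitz2 n (t_alpha alpha) = toep n tcoef.
Proof. exact: toeplitz2_toep (has_coefs_talpha ha). Qed.

Lemma hstep_sqr_small (K e : R) : 0 < e ->
  exists n0, forall n, (n0 <= n)%N -> K * (hstep n `^ alpha) ^+ 2 <= e.
Proof.
move=> e0; have e1 : 0 < Num.min 1 (e / (`|K| + 1)).
  by rewrite lt_min ltr01 divr_gt0 // ltr_wpDl.
have [n0 Hn] := hstep_pow ha e1; exists n0 => n /Hn.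
have h0 : 0 <= hstep n `^ alpha :> R by exact: powR_ge0.
move: (hstep n `^ alpha) h0 => H H0; rewrite le_min => /andP[H1 H2].
have HH : H ^+ 2 <= H by rewrite expr2 ler_piMr.
have K1 : 0 < `|K| + 1 by rewrite ltr_wpDl.
apply: (@le_trans _ _ ((`|K| + 1) * H ^+ 2)).
  by rewrite ler_wpM2r ?sqr_ge0 // (le_trans (ler_norm K)) // lerDl.
by rewrite mulrC -ler_pdivlMr // (le_trans HH).
Qed.

Lemma grid_bound (mu : R * R -> C) : (Linf_norm01 mu < +oo)%E ->
  (forall n i j : nat, (1 <= i <= n)%N -> (1 <= j <= n)%N ->
     ((cabs (mu (i%:R * hstep n, j%:R * hstep n)))%:E <= Linf_norm01 mu)%E) ->
  forall n i j : nat, (1 <= i <= n)%N -> (1 <= j <= n)%N ->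
     cabs (mu (i%:R * hstep n, j%:R * hstep n)) <= fine (Linf_norm01 mu).
Proof.
move=> fin H n i j hi hj; have := H n i j hi hj.
by case: (Linf_norm01 mu) fin => [r| |] //= _; rewrite ?lee_fin // leeNy_eq.
Qed.

(** Stated for any shift tending to 0, so that both preconditioners are instances. The last
    condition on the shift carries the sign hypothesis on [mubar] over to it, and holds trivially
    for the shift 0. *)
Lemma precond_distr (mu : R * R -> C) (mu_bounded : (Linf_norm01 mu < +oo)%E)
    (mu_grid : forall n i j : nat,
       (1 <= i <= n)%N -> (1 <= j <= n)%N ->
       ((cabs (mu (i%:R * hstep n, j%:R * hstep n)))%:E <= Linf_norm01 mu)%E)
    (mubar : nat -> C) (shift : nat -> C)
    (B P : mxseq R) :
  (forall n, B n = toeplitz2 n (t_alpha alpha)) ->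
  (forall n, P n = tau2 n (t_alpha alpha) + (shift n)%:M) ->
  (forall e : R, 0 < e -> exists n0, forall n, (n0 <= n)%N -> nrm2 (shift n) <= e) ->
  ((forall n, (1 <= n)%N -> 0 <= mubar n) -> forall n, (1 <= n)%N -> 0 <= shift n) ->
  [/\ GLT P (of_theta (t_alpha alpha)),
      sv_distr P boxpi (t_alpha alpha) &
      eig_distr P boxpi (t_alpha alpha)] /\
  ((forall n, (1 <= n)%N -> P n \in unitmx) ->
   let X : mxseq R := fun n =>
     invmx (P n) *m (B n + (hstep n `^ alpha)%:C *: Dmat n mu) in
   [/\ GLT X (of_theta (fun=> 1)),
       sv_distr X boxpi (fun=> 1) &
       (forall n, (1 <= n)%N -> 0 <= mubar n) -> eig_distr X boxpi (fun=> 1)]).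
Proof.
move=> hB hP shift0 shr.
have -> : P = prec alpha shift.
  apply: functional_extensionality_dep => n.
  by rewrite hP (tau2_tauc n (has_coefs_talpha ha)).
split; first by split; [exact: GLT_prec | exact: sv_prec | exact: eig_prec].
move=> prec_unit.
pose pert n (j : 'I_(n * n)) : C := (hstep n `^ alpha)%:C *
  mu ((mxtens_unindex j).1.+1%:R * hstep n, (mxtens_unindex j).2.+1%:R * hstep n).
have pert_le n (j : 'I_(n * n)) : nrm2 (pert n j) <= fine (Linf_norm01 mu) ^+ 2 * (hstep n `^ alpha) ^+ 2.
  rewrite nrm2M nrm2_real mulrC ler_wpM2r ?sqr_ge0 // -normcE2.
  have b0 := grid_bound mu_bounded mu_grid (n := n) (i := (mxtens_unindex j).1.+1) (j := (mxtens_unindex j).2.+1).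
  have {}b0 := b0 (ltn_ord _) (ltn_ord _).
  by rewrite ler_sqr ?nnegrE ?cabs_ge0 // (le_trans (cabs_ge0 _) b0).
have pert0 (e : R) : 0 < e -> exists n0, forall n (j : 'I_(n * n)), (n0 <= n)%N -> nrm2 (pert n j) <= e.
  move=> /(hstep_sqr_small (fine (Linf_norm01 mu) ^+ 2)) [n0 Hn]; exists n0 => n j /Hn.
  exact: le_trans (pert_le n j).
set X : mxseq R := fun n => _.
have -> : X = psys alpha shift pert.
  apply: functional_extensionality_dep => n; rewrite /X hB toeplitz2_t_alpha; congr (_ *m (_ + _)).
  by apply/matrixP => i j; rewrite !mxE mulrnAr.
split; [exact: GLT_psys | exact: sv_psys |].
move=> /shr {}shr; apply: (@eig_psys _ _ _ _ shift0 _ pert0 _ pert_le (fun n => complex.Re (shift n))) => // n n1.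
exact: ge0_complexE (shr n n1).
Qed.

End Final.

Theorem theorem6 (R : realType) (alpha : R) (halpha : 1 < alpha < 2)
    (mu : R * R -> R[i]) (mu_meas : lmeasurable_cfun leb2 box01 mu)
    (mu_bounded : (Linf_norm01 mu < +oo)%E)
    (mu_grid : forall n i j : nat,
       (1 <= i <= n)%N -> (1 <= j <= n)%N ->
       ((cabs (mu (i%:R * hstep n, j%:R * hstep n)))%:E <= Linf_norm01 mu)%E)
    (mubar : nat -> R[i])
    (mubar_bounded : exists M : R, forall n, (1 <= n)%N -> cabs (mubar n) <= M)
    (B P : mxseq R)
    (hB : forall n, B n = toeplitz2 n (t_alpha alpha))
    (hP : (forall n, P n = tau2 n (t_alpha alpha)) \/
          (forall n, P n = tau2 n (t_alpha alpha) +
                           ((hstep n `^ alpha)%:C * mubar n)%:M)) :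
  [/\ GLT P (of_theta (t_alpha alpha)),
      sv_distr P boxpi (t_alpha alpha) &
      eig_distr P boxpi (t_alpha alpha)] /\
  ((forall n, (1 <= n)%N -> P n \in unitmx) ->
   let X : mxseq R := fun n =>
     invmx (P n) *m (B n + (hstep n `^ alpha)%:C *: Dmat n mu) in
   [/\ GLT X (of_theta (fun=> 1)),
       sv_distr X boxpi (fun=> 1) &
       (forall n, (1 <= n)%N -> 0 <= mubar n) -> eig_distr X boxpi (fun=> 1)]).
Proof.
case: hP => hP.
  apply: (@precond_distr _ _ halpha mu mu_bounded mu_grid mubar (fun=> 0)) => //.
  - by move=> n; rewrite hP raddf0 addr0.
  - by move=> e e0; exists 0%N => n _; rewrite nrm20 ltW.
apply: (@precond_distr _ _ halpha mu mu_bounded mu_grid mubar (fun n => (hstep n `^ alpha)%:C * mubar n)) => //.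
  move=> e e0; have [M HM] := mubar_bounded.
  have [n0 Hn] := hstep_sqr_small halpha (M ^+ 2) e0.
  exists (maxn n0 1) => n; rewrite geq_max => /andP[/Hn h n1].
  apply: le_trans h; rewrite nrm2M nrm2_real mulrC ler_wpM2r ?sqr_ge0 // -normcE2.
  by rewrite ler_sqr ?nnegrE ?cabs_ge0 ?HM // (le_trans (cabs_ge0 _) (HM n n1)).
move=> m0 n n1; rewrite mulr_ge0 ?m0 // ler0c powR_ge0 //.
Qed.
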